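(* There exists a pair of non-isometric, Dirichlet isospectral, connected compact flat manifolds with piecewise smooth boundary that have the same heat content.
   Context: The Dirichlet spectrum of a compact flat Riemannian manifold $M$ with piecewise smooth boundary is the sequence of eigenvalues, with multiplicities, of $\Delta\varphi=\lambda\varphi$ on the interior of $M$ with $\varphi=0$ on $\partial M$, where $\Delta=-\operatorname{div}\nabla$; two such manifolds are Dirichlet isospectral if their Dirichlet spectra coincide. The heat content of $M$ is the function $t\mapsto\int_Mu(t,x)\,dx$, $t>0$, where $u$ is the solution of the heat equation $\partial_tu=-\Delta u$ on $M$ with Dirichlet boundary condition $u=0$ on $\partial M$ and initial value $u(0,\cdot)\equiv1$. *)

(* Defs.v *)
From HB Require Import structures.
From mathcomp Require Import all_boot all_order all_algebra.
From mathcomp Require Import all_classical all_reals all_analysis.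

Set Implicit Arguments.
Unset Strict Implicit.
Unset Printing Implicit Defensive.

Import Order.TTheory GRing.Theory Num.Theory.
Import numFieldNormedType.Exports.

Local Open Scope classical_set_scope.
Local Open Scope ring_scope.

Section EuclideanSpace.
Context {R : realType}.

Definition basis_vec n (i : 'I_n) : 'rV[R]_n := delta_mx 0 i.

(* f is of class C^k on the open set O: all partial derivatives of order at
   most k exist and are continuous on O. *)
Fixpoint Ck_on n (k : nat) (O : set 'rV[R]_n) (f : 'rV[R]_n -> R) : Prop :=
  if k is k'.+1 then
    {in O, continuous f} /\
    forall i : 'I_n, (forall x, O x -> derivable f x (basis_vec i)) /\
                     Ck_on k' O ('D_(basis_vec i) f)
  else {in O, continuous f}.

Definition smooth n (f : 'rV[R]_n -> R) : Prop := forall k, Ck_on k setT f.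

(* Continuous selections of finitely many smooth functions (the PC^oo
   functions of nonsmooth analysis); they are locally Lipschitz. *)
Definition piecewise_smooth n (g : 'rV[R]_n -> R) : Prop :=
  continuous g /\
  exists (m : nat) (h : 'I_m -> 'rV[R]_n -> R),
    (forall j, smooth (h j)) /\ (forall x, exists j, g x = h j x).

Definition epigraph n (g : 'rV[R]_n -> R) : set 'rV[R]_n.+1 :=
  [set x | g (col' ord_max x) <= x 0 ord_max].

Definition grad n (f : 'rV[R]_n -> R) (x : 'rV[R]_n) : 'rV[R]_n :=
  \row_i 'D_(basis_vec i) f x.

Definition divergence n (F : 'rV[R]_n -> 'rV[R]_n) (x : 'rV[R]_n) : R :=
  \sum_(i < n) 'D_(basis_vec i) (fun y => F y 0 i) x.

Definition laplacian n (f : 'rV[R]_n -> R) (x : 'rV[R]_n) : R :=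
  - divergence (grad f) x.

Definition orthogonal_mx n (A : 'M[R]_n) : Prop := A *m A^T = 1%:M.

Definition box n (a b : 'rV[R]_n) : set 'rV[R]_n :=
  [set x | forall i, a 0 i <= x 0 i <= b 0 i].

End EuclideanSpace.

Section Charts.
Context {R : realType} {n : nat} {T : topologicalType}.

(* [fwd] is only meaningful on [dom], and [bwd] on [fwd @` dom]. *)
Record chart := Chart {
  dom : set T;
  fwd : T -> 'rV[R]_n.+1;
  bwd : 'rV[R]_n.+1 -> T }.

Definition cod (c : chart) : set 'rV[R]_n.+1 := fwd c @` dom c.

(* Charts are homeomorphisms onto relatively open subsets of the closed region
   above the graph of a piecewise smooth function.  Rigid motions are absorbed
   in the chart, so any Lipschitz domain bounded by finitely many smooth pieces,
   reentrant corners included, is allowed; an interior chart is obtained by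
   placing the graph below the image of the chart. *)
Definition is_chart (c : chart) : Prop :=
  [/\ open (dom c),
      {within dom c, continuous (fwd c)},
      {within cod c, continuous (bwd c)},
      (forall p, dom c p -> bwd c (fwd c p) = p) &
      exists (g : 'rV[R]_n -> R) (O : set 'rV[R]_n.+1),
        [/\ piecewise_smooth g, open O & cod c = O `&` epigraph g]].

(* The transition map from c to d is locally a Euclidean rigid motion. *)
Definition flat_compatible (c d : chart) : Prop :=
  forall p, dom c p -> dom d p ->
  exists (A : 'M[R]_n.+1) (b : 'rV[R]_n.+1), orthogonal_mx A /\
    \forall q \near p, fwd d q = fwd c q *m A + b.

Definition atlas_interior (A : set chart) : set T :=
  [set p | exists c, [/\ A c, dom c p & (cod c)° (fwd c p)]].

End Charts.
Arguments chart : clear implicits.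

Definition borel (T : ptopologicalType) :=
  g_sigma_algebraType (@open T).

(* Flat Riemannian manifolds of dimension n.+1 with piecewise smooth boundary,
   given by an atlas of flat charts (the metric is the one pulled back from
   Euclidean space).  [volume] is the Riemannian measure: it is determined by
   the last two fields, as the interior is a countable union of preimages of
   boxes under charts. *)
Record flat_manifold (R : realType) (n : nat) := FlatManifold {
  space :> ptopologicalType;
  atlas : set (chart R n space);
  volume : {measure set (borel space) -> \bar R};
  space_hausdorff : hausdorff_space space;
  space_second_countable : @second_countable space;
  atlas_chart : forall c, atlas c -> is_chart c;
  atlas_cover : forall p : space, exists2 c, atlas c & dom c p;
  atlas_compatible :
    forall c d, atlas c -> atlas d -> flat_compatible c d;
  volume_box : forall c (a b : 'rV[R]_n.+1), atlas c ->
    (forall i, a 0 i <= b 0 i) -> box a b `<=` cod c ->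
    volume (bwd c @` box a b) = (\prod_i (b 0 i - a 0 i))%:E;
  volume_boundary : volume (~` atlas_interior atlas) = 0%E }.

Section FlatManifolds.
Context {R : realType} {n : nat}.
Implicit Types M N : flat_manifold R n.

Definition interiorM M (p : M) : Prop := atlas_interior (@atlas R n M) p.
Definition boundaryM M (p : M) : Prop := ~ interiorM p.

(* Riemannian isometry: a homeomorphism whose expressions in flat coordinates
   have orthogonal Jacobian matrices, that is, pull back the metric of N to the
   metric of M.  Smoothness up to the boundary is automatic, since such an
   expression is locally a rigid motion. *)
Definition is_isometry M N (f : M -> N) : Prop :=
  [/\ continuous f,
      (exists g : N -> M, [/\ continuous g, cancel f g & cancel g f]) &
      forall c d, @atlas R n M c -> @atlas R n N d ->
      forall x, (cod c)° x -> dom d (f (bwd c x)) ->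
        let F := fwd d \o f \o bwd c in
        differentiable F x /\ orthogonal_mx ('J F x)].

Definition isometric M N : Prop := exists f : M -> N, is_isometry f.

(* Functions on M which are C^2 in the interior, in flat coordinates. *)
Definition C2_interior M (phi : M -> R) : Prop :=
  forall c, @atlas R n M c -> Ck_on 2 (cod c)° (phi \o bwd c).

(* Delta phi = psi in the interior of M. *)
Definition laplacianM_eq M (phi psi : M -> R) : Prop :=
  forall c, @atlas R n M c ->
  forall x, (cod c)° x -> laplacian (phi \o bwd c) x = psi (bwd c x).

(* The solutions, zero included, of the Dirichlet eigenvalue problem. *)
Definition dirichlet_eigenspace M (lam : R) : set (M -> R) :=
  [set phi | [/\ continuous phi, C2_interior phi,
      laplacianM_eq phi (fun p => lam * phi p) &
      forall p, boundaryM p -> phi p = 0]].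

Definition has_dim (T : Type) (E : set (T -> R)) (m : nat) : Prop :=
  exists e : 'I_m -> T -> R,
  [/\ (forall j, E (e j)),
      (forall a : 'I_m -> R,
         (forall p, \sum_j a j * e j p = 0) -> forall j, a j = 0) &
      (forall phi, E phi ->
         exists a : 'I_m -> R, forall p, phi p = \sum_j a j * e j p)].

(* s lists the Dirichlet eigenvalues of M in nondecreasing order, each one as
   many times as the dimension of its eigenspace. *)
Definition is_dirichlet_spectrum M (s : nat -> R) : Prop :=
  {homo s : i j / (i <= j)%N >-> i <= j} /\
  forall lam, exists m,
    has_dim (dirichlet_eigenspace (M := M) lam) m /\
    ([set k | s k = lam] #= `I_m)%card.

Definition dirichlet_isospectral M N : Prop :=
  exists s, is_dirichlet_spectrum M s /\ is_dirichlet_spectrum N s.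

(* u solves the heat equation with Dirichlet boundary condition and initial
   value 1; only the values for t >= 0 matter.  The initial value is attained
   in L^2(M), as it is incompatible with the boundary condition. *)
Definition is_heat_solution M (u : R -> M -> R) : Prop :=
  [/\ {within [set z : R * M | 0 < z.1], continuous (fun z => u z.1 z.2)},
      (forall t, 0 < t ->
         [/\ forall p, interiorM p -> derivable (u ^~ p) t 1,
             C2_interior (u t) &
             laplacianM_eq (u t) (fun p => - derive1 (u ^~ p) t)]),
      (forall t p, 0 < t -> boundaryM p -> u t p = 0),
      (forall p, u 0 p = 1) &
      (\int[volume M]_p (((u t p - u 0 p) ^+ 2)%:E))%E @[t --> 0^'+] --> 0%E].

(* h is the heat content of M; only the values h t for t > 0 matter. *)
Definition is_heat_content M (h : R -> R) : Prop :=
  exists u : R -> M -> R, is_heat_solution u /\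
    forall t, 0 < t -> (\int[volume M]_p (u t p)%:E)%E = (h t)%:E.

Definition same_heat_content M N : Prop :=
  exists h, is_heat_content M h /\ is_heat_content N h.

End FlatManifolds.

(* Main.v *)
Require Import Defs.
From HB Require Import structures.
From mathcomp Require Import all_boot all_order all_algebra.
From mathcomp Require Import all_classical all_reals all_analysis.
From mathcomp Require Import measurable_realfun.
From mathcomp Require Import ring lra zify.

(* The manifolds are (R^4/L) x [0,1] and (R^4/L') x [0,1], where L and L' are obtained
   from two isospectral 4-dimensional lattices by scaling the coordinate axes by 1, 13,
   13^2, 13^3.  Dual vectors of the unscaled lattices correspond to each other up to the
   sign of one coordinate, so the scaled tori remain isospectral.  Separation of variables
   (Fourier series on the torus, and sin (k pi z) on [0,1]) then gives the Dirichlet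
   spectrum of both cylinders.  An isometry of the cylinders is locally, hence globally,
   induced by an affine rigid motion, whose linear part maps L into L'; since the axes are
   scaled so differently, it must be a diagonal matrix of signs, and this is excluded by
   arithmetic.  The heat solution depends on the height z only, and the two tori have the
   same volume, so that the heat contents coincide. *)

Set Implicit Arguments.
Unset Strict Implicit.
Unset Printing Implicit Defensive.

Import Order.TTheory GRing.Theory Num.Theory.
Import numFieldNormedType.Exports.

Local Open Scope classical_set_scope.
Local Open Scope ring_scope.

(** * The cylinder over a flat torus *)

(** The lattices form a pair of the Conway-Sloane family of isospectral lattices in dimension 4,
    which has one pair for every choice of four axis scales. Both manifolds have the same underlying
    space, the cylinder over R^4/Z^4: a lattice enters only through the charts, as a matrix [B]
    whose rows are a basis. Four points shape the proof. Completeness of the product eigenfunctions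
    rests on uniqueness of Fourier coefficients, for which an invariant mean on continuous periodic
    functions replaces the integral. An isometry is only known to be differentiable with orthogonal
    Jacobians, not to be of class C^1, so its local rigidity comes from the mean value theorem. The
    Riemannian measure has to be constructed: with a triangular basis the box spanned by the
    diagonal is a fundamental cell, and equal diagonals give the same cell for both lattices. The
    initial value 1 of the heat flow contradicts the boundary condition; the method of images gives
    a solution with explicit bounds as t tends to 0. *)

Section Trig.
Context {R : realType}.
Implicit Types a b t : R.

Definition tau : R := pi *+ 2.

Lemma tau_gt0 : 0 < tau.
Proof. by rewrite pmulrn_lgt0 // pi_gt0. Qed.

Lemma cos_tauDz a (k : int) : cos (tau * (a + k%:~R)) = cos (tau * a).
Proof.
have H n x : cos (tau * (x + n%:R)) = cos (tau * x).
  by rewrite mulrDr mulr_natr periodicn //; exact: cosD2pi.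
case: k => n; first exact: H.
by rewrite NegzE mulrNz -[RHS](H n.+1) -(H n.+1 (a - _)) subrK H.
Qed.

Lemma sin_tauDz a (k : int) : sin (tau * (a + k%:~R)) = sin (tau * a).
Proof.
have H n x : sin (tau * (x + n%:R)) = sin (tau * x).
  by rewrite mulrDr mulr_natr periodicn //; exact: sinD2pi.
case: k => n; first exact: H.
by rewrite NegzE mulrNz -[RHS](H n.+1) -(H n.+1 (a - _)) subrK H.
Qed.

(** After reduction to [0 <= u < 1], the double angle formula gives [sin (pi * u) = 0], while the
    sine is positive strictly between 0 and [pi]. *)
Lemma cos_tau_eq1 t : cos (tau * t) = 1 -> exists k : int, t = k%:~R.
Proof.
move=> h; exists (Num.floor t).
have /andP[f1 f2] := floor_itv t.
set u := t - (Num.floor t)%:~R.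
have u0 : 0 <= u by rewrite subr_ge0.
have u1 : u < 1 by rewrite ltrBlDl -[X in _ + X]/(1%:~R) -intrD.
have : cos (tau * u) = 1.
  by rewrite -h -[in RHS](subrK (Num.floor t)%:~R t) cos_tauDz.
rewrite /tau mulrnAl cos_mulr2n => /eqP; rewrite subr_eq => /eqP hc.
have hs : sin (pi * u) = 0.
  apply/eqP; rewrite -sqrf_eq0 sin2cos2 subr_eq0; apply/eqP.
  move: hc; rewrite -mulr2n => /eqP; rewrite eqrMn2r //= => /eqP ->.
  by [].
move: u0; rewrite le_eqVlt => /predU1P[/esym/eqP|u0].
  by rewrite subr_eq0 => /eqP.
have : 0 < sin (pi * u).
  by apply: sin_gt0_pi; rewrite mulr_gt0 ?pi_gt0 //= -[ltRHS]mulr1 ltr_pM2l ?pi_gt0.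
by rewrite hs ltxx.
Qed.

Lemma cos_sin_tau_eq a b : cos (tau * a) = cos (tau * b) ->
  sin (tau * a) = sin (tau * b) -> exists k : int, a = b + k%:~R.
Proof.
move=> hc hs; have [k hk] : exists k : int, a - b = k%:~R.
  by apply: cos_tau_eq1; rewrite mulrBr cosB hc hs -!expr2 cos2Dsin2.
by exists k; rewrite -hk addrC subrK.
Qed.

(** A branch of the argument, measured in turns. The argument of [asin] is the sine of the angle
    from [t0], expanded by the addition formula so that it is visibly continuous in the point
    [(c, s)]. *)
Definition arg_near (t0 c s : R) : R :=
  t0 + asin (s * cos (tau * t0) - c * sin (tau * t0)) / tau.

(** The half-circle centred at the angle [t0]: the cosine of the angle from [t0] is positive there,
    so that the arcsine recovers this angle modulo full turns. *)
Definition in_arc (t0 c s : R) : Prop := 0 < c * cos (tau * t0) + s * sin (tau * t0).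

Lemma in_arcE t0 t : in_arc t0 (cos (tau * t)) (sin (tau * t)) <->
  0 < cos (tau * (t - t0)).
Proof. by rewrite /in_arc mulrBr cosB. Qed.

Lemma arg_nearE t0 t :
  arg_near t0 (cos (tau * t)) (sin (tau * t)) = t0 + asin (sin (tau * (t - t0))) / tau.
Proof. by rewrite /arg_near mulrBr sinB. Qed.

Lemma quarter_in t : (`|t| < 4^-1) -> - (pi / 2) < tau * t < (pi / 2 : R).
Proof.
move=> h; have p := @pi_gt0 R.
rewrite -ltr_norml normrM (gtr0_norm tau_gt0) /tau.
have -> : (pi / 2 : R) = pi *+ 2 * 4^-1 by field.
by rewrite ltr_pM2l // pmulrn_lgt0.
Qed.

Lemma quarter_in_arc t0 t : `|t - t0| < 4^-1 ->
  in_arc t0 (cos (tau * t)) (sin (tau * t)).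
Proof. by move=> h; apply/in_arcE/cos_gt0_pihalf/quarter_in. Qed.

Lemma arg_nearK t0 t : `|t - t0| < 4^-1 ->
  arg_near t0 (cos (tau * t)) (sin (tau * t)) = t.
Proof.
move=> h; rewrite arg_nearE sinK.
  by rewrite mulrC mulKf ?subrKC // gt_eqF // tau_gt0.
by rewrite in_itv /=; have /andP[/ltW -> /ltW ->] := quarter_in h.
Qed.

Lemma in_arc_bound t0 t : in_arc t0 (cos (tau * t)) (sin (tau * t)) ->
  -1 < sin (tau * (t - t0)) < 1.
Proof.
move/in_arcE; set x := tau * _ => h; rewrite -ltr_norml.
rewrite -(@ltr_pXn2r _ 2) // ?nnegrE // expr1n real_normK ?num_real // sin2cos2.
by rewrite ltrBlDr ltrDl exprn_gt0.
Qed.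

Lemma arg_near_eq t0 t : in_arc t0 (cos (tau * t)) (sin (tau * t)) ->
  exists k : int, arg_near t0 (cos (tau * t)) (sin (tau * t)) = t + k%:~R.
Proof.
move=> h; have /andP[b1 b2] := in_arc_bound h.
move/in_arcE: h => h.
have nt : tau != 0 :> R by rewrite gt_eqF // tau_gt0.
rewrite arg_nearE; set y := asin _.
have E : tau * (y / tau) = y by rewrite mulrC divfK.
have [k hk] : exists k : int, y / tau = (t - t0) + k%:~R.
  apply: cos_sin_tau_eq; rewrite E /y.
    rewrite cos_asin ?(ltW b1) ?(ltW b2) // -cos2sin2.
    by rewrite sqrtr_sqr gtr0_norm.
  by rewrite asinK // in_itv /= (ltW b1) (ltW b2).
by exists k; rewrite hk; ring.
Qed.

Lemma arg_near_close t0 t : in_arc t0 (cos (tau * t)) (sin (tau * t)) ->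
  `|arg_near t0 (cos (tau * t)) (sin (tau * t)) - t0| < 4^-1.
Proof.
move=> h; have /andP[b1 b2] := in_arc_bound h; rewrite arg_nearE addrC addKr.
have p := @pi_gt0 R.
rewrite normrM normfV (gtr0_norm tau_gt0) ltr_pdivrMr ?tau_gt0 //.
have -> : 4^-1 * tau = pi / 2 :> R by rewrite /tau; field.
by rewrite ltr_norml asin_gtNpi2 ?asin_ltpi2 ?b1 ?b2 ?ltW.
Qed.

End Trig.

Section Coordinates.
Context {R : realType} {n : nat}.
Implicit Types (x : 'rV[R]_n.+1) (y : 'rV[R]_n).

(** The height is the last coordinate because [epigraph] bounds that coordinate from below. *)
Definition hor x : 'rV[R]_n := col' ord_max x.
Definition ver x : R := x 0 ord_max.
Definition mkpt y (z : R) : 'rV[R]_n.+1 :=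
  \row_j (if unlift ord_max j is Some i then y 0 i else z).

Lemma horE x i : hor x 0 i = x 0 (lift ord_max i).
Proof. by rewrite mxE. Qed.

Lemma mkpt_lift y z i : mkpt y z 0 (lift ord_max i) = y 0 i.
Proof. by rewrite mxE liftK. Qed.

Lemma mkpt_max y z : mkpt y z 0 ord_max = z.
Proof. by rewrite mxE unlift_none. Qed.

Lemma hor_mkpt y z : hor (mkpt y z) = y.
Proof. by apply/rowP => i; rewrite horE mkpt_lift. Qed.

Lemma ver_mkpt y z : ver (mkpt y z) = z.
Proof. exact: mkpt_max. Qed.

Lemma mkptK x : mkpt (hor x) (ver x) = x.
Proof.
by apply/rowP => j; case: (unliftP ord_max j) => [i|] ->;
   rewrite ?mkpt_lift ?mkpt_max ?horE.
Qed.

Lemma mkptP x1 x2 : hor x1 = hor x2 -> ver x1 = ver x2 -> x1 = x2.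
Proof. by move=> h v; rewrite -(mkptK x1) -(mkptK x2) h v. Qed.

Lemma hor_is_linear : linear hor.
Proof. by move=> a u v; apply/rowP => i; rewrite !mxE. Qed.
HB.instance Definition _ := GRing.isLinear.Build R _ _ _ hor hor_is_linear.

Lemma ver_is_linear : linear_for *%R ver.
Proof. by move=> a u v; rewrite /ver !mxE. Qed.
HB.instance Definition _ := GRing.isLinear.Build R _ _ _ ver ver_is_linear.

Definition flip x : 'rV[R]_n.+1 := mkpt (hor x) (1 - ver x).

Lemma flipK : involutive flip.
Proof. by move=> x; apply/mkptP; rewrite /flip ?hor_mkpt ?ver_mkpt ?subKr. Qed.

End Coordinates.

Section ContinuousAt.
Context {R : realType} {T : topologicalType}.

Lemma ct_cst (U : topologicalType) (a : U) (t : T) : {for t, continuous (fun _ : T => a)}.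
Proof. exact: cvg_cst. Qed.

Lemma ct_comp (U W : topologicalType) (f : T -> U) (g : U -> W) t :
  {for t, continuous f} -> {for f t, continuous g} -> {for t, continuous (fun s => g (f s))}.
Proof. by move=> cf cg; exact: (continuous_comp cf cg). Qed.

Lemma ct_pair (U W : topologicalType) (f : T -> U) (g : T -> W) t :
  {for t, continuous f} -> {for t, continuous g} -> {for t, continuous (fun s => (f s, g s))}.
Proof. by move=> cf cg; exact: (cvg_pair cf cg). Qed.

Lemma near_sub (t : T) (P Q : T -> Prop) : (\forall s \near t, P s) ->
  (forall s, P s -> Q s) -> \forall s \near t, Q s.
Proof. by move=> h PQ; apply: (@filterS _ (nbhs t) _ P Q) => //. Qed.

Lemma near_open (O : set T) (t : T) (P : T -> Prop) : open O -> O t ->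
  (forall s, O s -> P s) -> \forall s \near t, P s.
Proof. by move=> oO Ot; apply: near_sub; exact: open_nbhs_nbhs. Qed.

Lemma ct_eq (U : topologicalType) (f g : T -> U) (t : T) :
  (\forall s \near t, f s = g s) -> {for t, continuous f} -> {for t, continuous g}.
Proof.
move=> fg; rewrite /prop_for /continuous_at (nbhs_singleton fg).
by apply: cvg_trans; apply: near_eq_cvg; apply: near_sub fg _ => s ->.
Qed.

Lemma ctD (V : normedModType R) (f g : T -> V) t : {for t, continuous f} ->
  {for t, continuous g} -> {for t, continuous (fun s => f s + g s)}.
Proof. by move=> cf cg; exact: (cvgD cf cg). Qed.

Lemma ctB (V : normedModType R) (f g : T -> V) t : {for t, continuous f} ->
  {for t, continuous g} -> {for t, continuous (fun s => f s - g s)}.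
Proof. by move=> cf cg; exact: (cvgB cf cg). Qed.

Lemma ctZ (V : normedModType R) (k : T -> R) (f : T -> V) t : {for t, continuous k} ->
  {for t, continuous f} -> {for t, continuous (fun s => k s *: f s)}.
Proof. by move=> cf cg; exact: (cvgZ cf cg). Qed.

Lemma ctM (f g : T -> R) t : {for t, continuous f} ->
  {for t, continuous g} -> {for t, continuous (fun s => f s * g s)}.
Proof. by move=> cf cg; exact: (cvgM cf cg). Qed.

Lemma ct_coord m k (f : T -> 'M[R]_(m, k)) i j t : {for t, continuous f} ->
  {for t, continuous (fun s => f s i j)}.
Proof. by move=> cf; exact: (continuous_comp cf (@coord_continuous _ _ _ i j _)). Qed.

End ContinuousAt.

Section MatrixContinuity.
Context {R : realType}.

Lemma cvg_sumr (T : Type) (F : set_system T) {FF : Filter F} (V : normedModType R)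
    (I : Type) (r : seq I) (P : pred I) (f : I -> T -> V) (l : I -> V) :
  (forall i, P i -> f i t @[t --> F] --> l i) ->
  \sum_(i <- r | P i) f i t @[t --> F] --> \sum_(i <- r | P i) l i.
Proof.
move=> h; elim: r => [|i r IH].
  rewrite big_nil; under eq_fun do rewrite big_nil; exact: cvg_cst.
rewrite big_cons; under eq_fun do rewrite big_cons.
by case: ifP => // Pi; apply: cvgD => //; exact: h.
Qed.

Lemma cvg_mx (T : Type) (F : set_system T) (FF : Filter F) m n (f : T -> 'M[R]_(m, n)) (l : 'M[R]_(m, n)) :
  (forall i j, f t i j @[t --> F] --> l i j) -> f t @[t --> F] --> l.
Proof.
move=> h A [P lP PA].
have : \forall t \near F, forall i j, P i j (f t i j).
  apply: filter_forall => i; apply: filter_forall => j.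
  exact: (h i j _ (lP i j)).
by apply: filterS => t ht; exact: PA.
Qed.

Lemma continuous_mx (T : topologicalType) m n (f : T -> 'M[R]_(m, n)) t :
  (forall i j, {for t, continuous (fun t => f t i j)}) -> {for t, continuous f}.
Proof. by move=> h; apply: cvg_mx => i j; exact: h. Qed.

Lemma continuous_mulmx m n p (B : 'M[R]_(n, p)) :
  continuous (fun x : 'M[R]_(m, n) => x *m B).
Proof.
move=> x; apply: continuous_mx => i j.
rewrite (_ : (fun t : 'M[R]_(m, n) => _) = (fun t : 'M[R]_(m, n) => \sum_k t i k * B k j)); last first.
  by apply/funext => t; rewrite mxE.
apply: (@cvg_sumr _ (nbhs x) _) => k _; apply: cvgMr_tmp; exact: coord_continuous.
Qed.

Lemma continuous_hor n : continuous (@hor R n).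
Proof.
move=> x; apply: continuous_mx => i j.
rewrite (_ : (fun t => _) = (fun t : 'rV[R]_n.+1 => t i (lift ord_max j))); last first.
  by apply/funext => t; rewrite mxE.
exact: coord_continuous.
Qed.

Lemma continuous_ver n : continuous (@ver R n).
Proof. exact: coord_continuous. Qed.

Lemma continuous_mkpt (T : topologicalType) n (f : T -> 'rV[R]_n) (g : T -> R) t :
  {for t, continuous f} -> {for t, continuous g} ->
  {for t, continuous (fun t => mkpt (f t) (g t))}.
Proof.
move=> cf cg; apply: continuous_mx => i j.
rewrite (_ : (fun t => _) = fun t => if unlift ord_max j is Some k then f t 0 k else g t); last first.
  by apply/funext => s; rewrite mxE.
case: unliftP => [k _|_] //.
exact: (continuous_comp cf (@coord_continuous _ _ _ 0 k _)).
Qed.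

Lemma continuous_flip n : continuous (@flip R n).
Proof.
move=> x; apply: continuous_mkpt; first exact: continuous_hor.
exact: (cvgB (cvg_cst (1 : R)) (@continuous_ver n x)).
Qed.

End MatrixContinuity.

(** * The cylinder as a topological space *)

Section Cylinder.
Context (R : realType) (n : nat).

(** The retraction of the line onto [0,1]. It makes [cpt] and [proj] total and continuous; the price
    is that heights outside [0,1] are sent to the boundary. *)
Definition clamp (z : R) : R := Num.max 0 (Num.min 1 z).

Lemma clamp_ge0 z : 0 <= clamp z. Proof. by rewrite /clamp le_max lexx. Qed.
Lemma clamp_le1 z : clamp z <= 1.
Proof. by rewrite /clamp ge_max ler01 ge_min lexx. Qed.
Lemma clampE z : 0 <= z <= 1 -> clamp z = z.
Proof. by move=> /andP[z0 z1]; rewrite /clamp min_r // max_r. Qed.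
Lemma clamp_id z : clamp (clamp z) = clamp z.
Proof. by rewrite clampE // clamp_ge0 clamp_le1. Qed.
Lemma continuous_clamp : continuous clamp.
Proof.
move=> z; apply: continuous_max; first exact: cvg_cst.
by apply: continuous_min; [exact: cvg_cst|exact: cvg_id].
Qed.

(* The torus R^n/Z^n times [0,1], embedded by (cos 2 pi y, sin 2 pi y, z). *)
Local Notation amb := ('rV[R]_n * 'rV[R]_n * R)%type.

Definition amb_of (yz : 'rV[R]_n * R) : amb :=
  (\row_i cos (tau * yz.1 0 i), \row_i sin (tau * yz.1 0 i), clamp yz.2).

Definition cyl : Type := set_type (range amb_of).

HB.instance Definition _ := PseudoMetric.on cyl.

Definition cpt (y : 'rV[R]_n) (z : R) : cyl :=
  exist _ (amb_of (y, z)) (mem_set (imageT amb_of (y, z))).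
HB.instance Definition _ := isPointed.Build cyl (cpt 0 0).

Definition ccos (p : cyl) : 'rV[R]_n := (val p).1.1.
Definition csin (p : cyl) : 'rV[R]_n := (val p).1.2.
Definition cht (p : cyl) : R := (val p).2.

Lemma cpt_surj p : exists y z, 0 <= z <= 1 /\ p = cpt y z.
Proof.
case: p => a /= ap; have /set_mem [[y z] _ e] := ap.
exists y, (clamp z); split; first by rewrite clamp_ge0 clamp_le1.
by apply: val_inj => /=; rewrite /amb_of /= clamp_id -e.
Qed.

Lemma cht_cpt y z : cht (cpt y z) = clamp z. Proof. by []. Qed.

Definition intv (m : 'rV[int]_n) : 'rV[R]_n := map_mx intr m.

Lemma cpt_eq y z y' z' : cpt y z = cpt y' z' <->
  clamp z = clamp z' /\ exists m, y = y' + intv m.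
Proof.
split=> [e|[cz [m ->]]].
  split; first by rewrite -[LHS](cht_cpt y) e.
  have h i : exists k : int, y 0 i = y' 0 i + k%:~R.
    have := congr1 (fun p => ccos p 0 i) e; rewrite !mxE => ec.
    have := congr1 (fun p => csin p 0 i) e; rewrite !mxE => es.
    exact: cos_sin_tau_eq.
  have [m hm] := choice h.
  by exists (\row_i m i); apply/rowP => i; rewrite !mxE hm.
apply: val_inj => /=; congr (_, _, _) => //;
  by apply/rowP => i; rewrite !mxE ?cos_tauDz ?sin_tauDz.
Qed.

Lemma continuous_cval : continuous (val : cyl -> amb).
Proof. exact: initial_continuous. Qed.

Lemma continuous_ccos : continuous ccos.
Proof.
move=> p; have h : val q @[q --> p] --> (val p : amb) := @continuous_cval p.
exact: (cvg_comp _ _ (cvg_comp _ _ h cvg_fst) cvg_fst).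
Qed.

Lemma continuous_csin : continuous csin.
Proof.
move=> p; have h : val q @[q --> p] --> (val p : amb) := @continuous_cval p.
exact: (cvg_comp _ _ (cvg_comp _ _ h cvg_fst) cvg_snd).
Qed.

Lemma continuous_cht : continuous cht.
Proof.
move=> p; have h : val q @[q --> p] --> (val p : amb) := @continuous_cval p.
exact: (cvg_comp _ _ h cvg_snd).
Qed.

(* The topology of the cylinder is the initial topology of its embedding. *)
Lemma cvg_cyl (T : Type) (F : set_system T) (FF : Filter F) (f : T -> cyl) (p : cyl) :
  ccos (f t) @[t --> F] --> ccos p -> csin (f t) @[t --> F] --> csin p ->
  cht (f t) @[t --> F] --> cht p -> f t @[t --> F] --> p.
Proof.
move=> hc hs hh.
have hv : val (f t) @[t --> F] --> (val p : amb).
  rewrite (_ : (fun t => _) = (fun t => (ccos (f t), csin (f t), cht (f t)))); last first.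
    by apply/funext => t; rewrite /ccos /csin /cht; case: (val _) => [[]].
  rewrite (_ : val p = (ccos p, csin p, cht p)); last first.
    by rewrite /ccos /csin /cht; case: (val _) => [[]].
  exact: (cvg_pair (cvg_pair hc hs) hh).
move=> A [_ [[B oB <-] Bp] BA].
have : \forall t \near F, B (val (f t)) by apply: hv; exact: open_nbhs_nbhs.
by apply: filterS => t; exact: BA.
Qed.

Lemma continuous_cpt (T : topologicalType) (f : T -> 'rV[R]_n) (g : T -> R) t :
  {for t, continuous f} -> {for t, continuous g} ->
  {for t, continuous (fun t => cpt (f t) (g t))}.
Proof.
move=> cf cg; apply: cvg_cyl.
- apply: cvg_mx => i j; rewrite (_ : (fun t => _) = cos \o ( *%R tau) \o (fun t => f t 0 j)); last first.
    by apply/funext => s; rewrite !mxE.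
  rewrite mxE; apply: (continuous_comp (continuous_comp cf (@coord_continuous _ _ _ 0 j _))).
  by apply: continuous_comp; [exact: mulrl_continuous|exact: continuous_cos].
- apply: cvg_mx => i j; rewrite (_ : (fun t => _) = sin \o ( *%R tau) \o (fun t => f t 0 j)); last first.
    by apply/funext => s; rewrite !mxE.
  rewrite mxE; apply: (continuous_comp (continuous_comp cf (@coord_continuous _ _ _ 0 j _))).
  by apply: continuous_comp; [exact: mulrl_continuous|exact: continuous_sin].
- exact: (continuous_comp cg (@continuous_clamp _)).
Qed.

End Cylinder.

Section CylinderSpace.
Context {R : realType} {n : nat}.
Local Notation cyl := (cyl R n).

Lemma cyl_hausdorff : hausdorff_space cyl.
Proof.
rewrite open_hausdorff => p q pq.
have vpq : val p != val q by apply: contra_neq pq; exact: val_inj.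
have H : hausdorff_space ('rV[R]_n * 'rV[R]_n * R)%type by exact: norm_hausdorff.
move: H; rewrite open_hausdorff => /(_ _ _ vpq) [[A B] /= [Ap Bq] [oA oB AB]].
exists (val @^-1` A, val @^-1` B) => /=.
  by split; rewrite inE /=; [move: Ap|move: Bq]; rewrite inE.
have /continuousP cv := @continuous_cval R n.
split; [exact: cv|exact: cv|].
by rewrite -preimage_setI (eqP AB) preimage_set0.
Qed.

Lemma continuous_cpt_pair : continuous (fun yz : 'rV[R]_n * R => cpt yz.1 yz.2).
Proof. by move=> yz; apply: continuous_cpt; [exact: cvg_fst|exact: cvg_snd]. Qed.

Definition fracv (y : 'rV[R]_n) : 'rV[R]_n := \row_i (y 0 i - (Num.floor (y 0 i))%:~R).

Lemma fracv_itv y i : 0 <= fracv y 0 i < 1.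
Proof.
rewrite mxE; have /andP[f1 f2] := floor_itv (y 0 i).
by rewrite subr_ge0 f1 /= ltrBlDl -[X in _ + X]/(1%:~R) -intrD.
Qed.

Lemma fracvE y : y = fracv y + intv R (\row_i Num.floor (y 0 i)).
Proof. by apply/rowP => i; rewrite !mxE subrK. Qed.

Lemma cpt_fracv y z : cpt y z = cpt (fracv y) z.
Proof.
by apply/cpt_eq; split => //; exists (\row_i Num.floor (y 0 i)); exact: fracvE.
Qed.

Lemma cyl_compact : compact [set: cyl].
Proof.
have cA : compact ([set y : 'rV[R]_n | forall i, `[0, 1]%classic (y 0 i)] `*` `[0, 1]%classic : set ('rV[R]_n * R)).
  apply: compact_setX; last exact: segment_compact.
  by apply: (@rV_compact R n (fun=> `[0, 1]%classic)) => i; exact: segment_compact.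
have := continuous_compact (continuous_subspaceT continuous_cpt_pair) cA.
congr (compact _); apply/seteqP; split => // p _.
have [y [z [z01 ->]]] := cpt_surj p.
exists (fracv y, z); last by rewrite [RHS]cpt_fracv.
split => /= [i|]; rewrite in_itv //=.
by have /andP[-> /ltW ->] := fracv_itv y i.
Qed.

Lemma cyl_second_countable : @second_countable cyl.
Proof. exact: compact_second_countable cyl_compact. Qed.

(** Every point is joined to [cpt 0 0] by the image of a straight segment of the covering space. *)
Lemma cyl_connected : connected [set: cyl].
Proof.
have H (yz yz' : 'rV[R]_n * R) : exists A : set cyl, [/\ A (cpt yz.1 yz.2), A (cpt yz'.1 yz'.2) & connected A].
  exists ((fun t : R => cpt (yz.1 + t *: (yz'.1 - yz.1)) (yz.2 + t * (yz'.2 - yz.2))) @` `[0, 1]%classic); split.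
  - by exists 0; rewrite /= ?in_itv /= ?lexx ?ler01 // scale0r mul0r !addr0.
  - by exists 1; rewrite /= ?in_itv /= ?lexx ?ler01 // scale1r mul1r !subrKC.
  - apply: connected_continuous_connected; first exact/connected_intervalP/interval_is_interval.
    apply: continuous_subspaceT => t.
    apply: (@continuous_cpt _ _ _ (fun t : R => _) (fun t : R => _)).
      by apply: ctD; [exact: ct_cst|apply: ctZ; [exact: cvg_id|exact: ct_cst]].
    by apply: ctD; [exact: ct_cst|apply: ctM; [exact: cvg_id|exact: ct_cst]].
pose p0 : cyl := cpt 0 0.
have E : [set: cyl] = \bigcup_(A in [set A : set cyl | A p0 /\ connected A]) A.
  apply/seteqP; split => // p _.
  have [y [z [_ ->]]] := cpt_surj p.
  have [A [A0 Ap cA]] := H (0, 0) (y, z).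
  by exists A.
rewrite E; apply: bigcup_connected; first by exists p0 => A [].
by move=> A [].
Qed.

End CylinderSpace.

(** * Flat charts and rigid transition maps *)

Section Charts.
Context {R : realType} {n : nat} (B : 'M[R]_n) (uB : B \in unitmx).
Local Notation cyl := (cyl R n).
Implicit Types (x : 'rV[R]_n.+1) (y : 'rV[R]_n) (p q : cyl) (b : bool).

(** Coordinates with respect to the lattice basis formed by the rows of [B]. They turn the lattice
    into Z^n, so that all lattices share the space [cyl]. *)
Definition unitc x : 'rV[R]_n := hor x *m invmx B.

Definition proj x : cyl := cpt (unitc x) (ver x).

Definition in_arcs y p := forall i, in_arc (y 0 i) (ccos p 0 i) (csin p 0 i).

Definition locy y p : 'rV[R]_n := \row_i arg_near (y 0 i) (ccos p 0 i) (csin p 0 i).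

Definition flipb b x := if b then flip x else x.

(* Charts with [b = true] reflect z to 1 - z, so that the points at height 1 also
   lie on the graph bounding the epigraph from below. *)
Definition fchart y b : chart R n cyl := Chart
  [set p | in_arcs y p /\ (if b then 0 < cht p else cht p < 1)]
  (fun p => flipb b (mkpt (locy y p *m B) (cht p)))
  (fun x => proj (flipb b x)).

Definition fatlas : set (chart R n cyl) := [set c | exists y b, c = fchart y b].

Lemma flipbK b : involutive (flipb b).
Proof. by case: b => // x; exact: flipK. Qed.

Lemma continuous_flipb b : continuous (flipb b).
Proof. by case: b => x; [exact: continuous_flip|exact: cvg_id]. Qed.

Lemma hor_flipb b x : hor (flipb b x) = hor x.
Proof. by case: b => //; rewrite hor_mkpt. Qed.

Lemma ver_flipb b x : ver (flipb b x) = if b then 1 - ver x else ver x.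
Proof. by case: b => //; rewrite ver_mkpt. Qed.

Lemma continuous_unitc : continuous unitc.
Proof.
move=> x; exact: (ct_comp (@continuous_hor _ _ x) (@continuous_mulmx _ _ _ _ _ _)).
Qed.

Lemma continuous_proj : continuous proj.
Proof. by move=> x; apply: continuous_cpt; [exact: continuous_unitc|exact: continuous_ver]. Qed.

Lemma unitc_mkpt y z : unitc (mkpt (y *m B) z) = y.
Proof. by rewrite /unitc hor_mkpt mulmxK. Qed.

Lemma proj_mkpt y z : proj (mkpt (y *m B) z) = cpt y z.
Proof. by rewrite /proj unitc_mkpt ver_mkpt. Qed.

Lemma mkpt_unitc x : mkpt (unitc x *m B) (ver x) = x.
Proof. by rewrite /unitc mulmxKV // mkptK. Qed.

Lemma ver_proj x : 0 <= ver x <= 1 -> cht (proj x) = ver x.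
Proof. by move=> h; rewrite cht_cpt clampE. Qed.

Lemma proj_eq x x' : proj x = proj x' <->
  clamp (ver x) = clamp (ver x') /\ exists m, hor x = hor x' + intv R m *m B.
Proof.
rewrite cpt_eq; split=> -[-> [m hm]]; split => //; exists m.
  by rewrite -[LHS](mulmxKV uB) -/(unitc x) hm mulmxDl /unitc mulmxKV.
by rewrite /unitc hm mulmxDl mulmxK.
Qed.

Lemma in_arcs_near y p : in_arcs y p -> \forall q \near p, in_arcs y q.
Proof.
move=> h; apply: (@filter_forall _ _ _ (nbhs p) _) => i.
have cf : {for p, continuous (fun q => ccos q 0 i * cos (tau * y 0 i) + csin q 0 i * sin (tau * y 0 i))}.
  apply: ctD; (apply: ctM; last exact: ct_cst); apply: ct_coord.
    exact: continuous_ccos.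
  exact: continuous_csin.
exact: (cvgr_gt _ cf _ (h i)).
Qed.

Lemma fchart_dom_open y b : open (dom (fchart y b)).
Proof.
rewrite openE => p /= [h1 h2]; rewrite /interior /=.
near=> q; split; first by near: q; exact: in_arcs_near.
near: q; case: b h2 => h2.
  exact: (cvgr_gt _ (@continuous_cht _ _ p) _ h2).
exact: (cvgr_lt _ (@continuous_cht _ _ p) _ h2).
Unshelve. all: by end_near. Qed.

Lemma cpt_locy y p : in_arcs y p -> cpt (locy y p) (cht p) = p.
Proof.
have [y' [z [z01 ->]]] := cpt_surj p => h.
apply/cpt_eq; split; first by rewrite cht_cpt clamp_id.
have h' i : exists k : int, locy y (cpt y' z) 0 i = y' 0 i + k%:~R.
  by have := h i; rewrite !mxE => /arg_near_eq.
have [m hm] := choice h'.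
by exists (\row_i m i); apply/rowP => i; rewrite hm !mxE.
Qed.

Lemma locy_cpt y y' z : (forall i, `|y' 0 i - y 0 i| < 4^-1) -> locy y (cpt y' z) = y'.
Proof. by move=> h; apply/rowP => i; rewrite !mxE arg_nearK. Qed.

Lemma in_arcs_cpt y y' z : (forall i, `|y' 0 i - y 0 i| < 4^-1) -> in_arcs y (cpt y' z).
Proof. by move=> h i; rewrite !mxE; exact: quarter_in_arc. Qed.

Lemma locy_close y p i : in_arcs y p -> `|locy y p 0 i - y 0 i| < 4^-1.
Proof.
have [y' [z [z01 ->]]] := cpt_surj p => /(_ i); rewrite !mxE.
exact: arg_near_close.
Qed.

Lemma continuous_locy y p : in_arcs y p -> {for p, continuous (locy y)}.
Proof.
move=> h; apply: continuous_mx => k i.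
rewrite (_ : (fun q => _) = (fun q => y 0 i + asin (csin q 0 i * cos (tau * y 0 i) - ccos q 0 i * sin (tau * y 0 i)) / tau)); last first.
  by apply/funext => q; rewrite mxE.
apply: ctD; first exact: ct_cst.
apply: ctM; last exact: ct_cst.
have cf : {for p, continuous (fun q => csin q 0 i * cos (tau * y 0 i) - ccos q 0 i * sin (tau * y 0 i))}.
  apply: ctB; (apply: ctM; last exact: ct_cst); apply: ct_coord.
    exact: continuous_csin.
  exact: continuous_ccos.
apply: (ct_comp cf); apply: continuous_asin.
have := h i; have [y' [z [z01 ->]]] := cpt_surj p; rewrite !mxE => /in_arc_bound.
by rewrite mulrBr sinB.
Qed.

Lemma fchartK y b p : dom (fchart y b) p -> bwd (fchart y b) (fwd (fchart y b) p) = p.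
Proof. by move=> [h _] /=; rewrite flipbK proj_mkpt cpt_locy. Qed.

(** A chart covers half a period in each lattice direction, so two of its points never differ by a
    nonzero lattice vector. *)
Definition near_unitc y x := forall i, `|unitc x 0 i - y 0 i| < 4^-1.

Lemma fchart_cod y b : cod (fchart y b) = [set x | near_unitc y x /\ 0 <= ver x < 1].
Proof.
apply/seteqP; split => [_ [p /= [h1 h2] <-]|x [h1 h2]] /=.
  split.
    by move=> i; rewrite /unitc hor_flipb hor_mkpt mulmxK //; exact: locy_close.
  rewrite ver_flipb ver_mkpt.
  have [y' [z [z01 E]]] := cpt_surj p; move: h2; rewrite E cht_cpt clampE //.
  by case: b => h2; have /andP[z0 z1] := z01; lra.
have h3 : 0 <= ver (flipb b x) <= 1 by rewrite ver_flipb; case: b; lra.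
exists (proj (flipb b x)).
  split; first by apply: in_arcs_cpt => i; rewrite /unitc hor_flipb; exact: h1.
  by rewrite /= ver_proj // ver_flipb; case: b h3 => h3; lra.
rewrite /= ver_proj // locy_cpt; last by move=> i; rewrite /unitc hor_flipb; exact: h1.
by rewrite mkpt_unitc flipbK.
Qed.

Lemma near_unitc_open y : open [set x | near_unitc y x].
Proof.
rewrite openE => x /= h; apply: (@filter_forall _ _ _ (nbhs x) _) => i.
have cf : {for x, continuous (fun x' => `|unitc x' 0 i - y 0 i|)}.
  apply: (@ct_comp _ _ _ (fun x' => unitc x' 0 i - y 0 i)); last exact: norm_continuous.
  by apply: ctB; [apply: ct_coord; exact: continuous_unitc|exact: ct_cst].
exact: (cvgr_lt _ cf _ (h i)).
Qed.

Lemma Ck_cst k (O : set 'rV[R]_n) (r : R) : Ck_on k O (fun=> r).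
Proof.
elim: k r => [|k IH] r /=; first by move=> x _; exact: ct_cst.
split=> [x _|i]; first exact: ct_cst.
split=> [x _|]; first exact: derivable_cst.
rewrite (_ : 'D_(basis_vec i) (fun=> r) = fun=> 0); first exact: IH.
by apply/funext => x; rewrite derive_cst.
Qed.

Lemma fchart_is_chart y b : is_chart (fchart y b).
Proof.
split.
- exact: fchart_dom_open.
- apply: continuous_in_subspaceT => p /set_mem [h _].
  apply: (@ct_comp _ _ _ (fun p => mkpt (locy y p *m B) (cht p)) (flipb b)); last exact: continuous_flipb.
  apply: continuous_mkpt; last exact: continuous_cht.
  exact: (ct_comp (continuous_locy h) (@continuous_mulmx _ _ _ _ _ _)).
- apply: continuous_subspaceT => x.
  exact: (ct_comp (@continuous_flipb _ _) (@continuous_proj _)).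
- exact: fchartK.
(* The bounding graph is the floor, of constant height 0; the reflection in [fchart] brings the top
   boundary to it as well. *)
- exists (fun=> 0), ([set x | near_unitc y x] `&` [set x | ver x < 1]); split.
  + split; first by move=> x; exact: ct_cst.
    by exists 1%N, (fun _ _ => 0); split=> [_ k|x]; [exact: Ck_cst|exists ord0].
  + apply: openI; first exact: near_unitc_open.
    have /continuousP := @continuous_ver R n.
    move=> /(_ [set r | r < 1]); apply; exact: open_lt.
  + rewrite fchart_cod; apply/seteqP; split => x /=; rewrite /epigraph /= -/(ver x).
      by move=> [h /andP[h1 h2]].
    by move=> [[h h2] h1]; rewrite h1 h2.
Qed.

Lemma fatlas_cover p : exists2 c, fatlas c & dom c p.
Proof.
have [y [z [/andP[z0 z1] E]]] := cpt_surj p.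
exists (fchart y (z == 1)); first by exists y, (z == 1).
split.
  by rewrite E; apply: in_arcs_cpt => i; rewrite subrr normr0.
by rewrite /= E cht_cpt clampE ?z0 //; case: eqVneq => [->//|zn]; rewrite lt_neqAle zn.
Qed.

Definition flip_mx : 'M[R]_n.+1 := diag_mx (mkpt (const_mx 1) (-1)).

Lemma mul_flip_mx x : x *m flip_mx = mkpt (hor x) (- ver x).
Proof.
apply/mkptP; rewrite ?hor_mkpt ?ver_mkpt.
  by apply/rowP => i; rewrite !horE mul_mx_diag mxE mkpt_lift mxE mulr1.
by rewrite /ver mul_mx_diag mxE mkpt_max mulrN1.
Qed.

Lemma flip_mx_orth : orthogonal_mx flip_mx.
Proof.
rewrite /orthogonal_mx tr_diag_mx mulmx_diag -diag_const_mx; congr diag_mx.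
apply/rowP => j; rewrite !mxE; case: unliftP => [i _|_]; rewrite ?mxE ?mulr1 //.
by rewrite mulrNN mulr1.
Qed.

Lemma flipE x : flip x = x *m flip_mx + mkpt 0 1.
Proof.
rewrite mul_flip_mx; apply/mkptP; rewrite linearD /= ?hor_mkpt ?ver_mkpt ?addr0 //.
by rewrite addrC.
Qed.

Lemma flipb_rigid b : exists (A : 'M[R]_n.+1) v, orthogonal_mx A /\ forall x, flipb b x = x *m A + v.
Proof.
case: b.
  by exists flip_mx, (mkpt 0 1); split; [exact: flip_mx_orth|exact: flipE].
exists 1%:M, 0; split; first by rewrite /orthogonal_mx trmx1 mulmx1.
by move=> x; rewrite mulmx1 addr0.
Qed.

Lemma int_near_cst (T : topologicalType) (f : T -> R) (t : T) : {for t, continuous f} ->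
  (\forall s \near t, exists k : int, f s = k%:~R) -> \forall s \near t, f s = f t.
Proof.
move=> cf h; have [k hk] := nbhs_singleton h.
have h1 : \forall s \near t, `|f t - f s| < 1 by exact: (cvgr_dist_lt _ _ cf _ ltr01).
near=> s; have [k' hk'] : exists k : int, f s = k%:~R by near: s.
have : `|f t - f s| < 1 by near: s.
rewrite hk hk' -intrB -intr_norm -[1]/(1%:~R) ltr_int => h2.
by congr (_%:~R); lia.
Unshelve. all: by end_near. Qed.

Lemma fatlas_compatible c d : fatlas c -> fatlas d -> flat_compatible c d.
Proof.
move=> [y [b ->]] [y' [b' ->]] p [h1 h2] [h1' h2'].
(* Two local lifts of a point differ by an integer vector; it varies continuously with the point and
   is therefore locally constant. *)
have H : \forall q \near p, forall i, locy y' q 0 i - locy y q 0 i = locy y' p 0 i - locy y p 0 i.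
  apply: (@filter_forall _ _ _ (nbhs p) _) => i.
  apply: (@int_near_cst _ (fun q => locy y' q 0 i - locy y q 0 i)).
    by apply: ctB; apply: ct_coord; exact: continuous_locy.
  near=> q.
  have a1 : in_arcs y q by near: q; exact: in_arcs_near.
  have a2 : in_arcs y' q by near: q; exact: in_arcs_near.
  have : cpt (locy y' q) (cht q) = cpt (locy y q) (cht q) by rewrite !cpt_locy.
  by move=> /cpt_eq [_ [m ->]]; exists (m 0 i); rewrite !mxE addrAC subrr add0r.
have [A [v [oA hA]]] := flipb_rigid b.
have [A' [v' [oA' hA']]] := flipb_rigid b'.
(* Undo the reflection of the first chart, whose linear part has inverse [A^T], translate by the
   lattice vector between the two lifts, then apply the reflection of the second chart. *)
exists (A^T *m A'), (v' + (mkpt ((locy y' p - locy y p) *m B) 0 - v *m A^T) *m A'); split.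
  rewrite /orthogonal_mx trmx_mul trmxK mulmxA -(mulmxA _ A') oA' mulmx1.
  by apply: mulmx1C.
near=> q.
have E : forall i, locy y' q 0 i - locy y q 0 i = locy y' p 0 i - locy y p 0 i by near: q.
have {}E : mkpt (locy y' q *m B) (cht q) =
           mkpt (locy y q *m B) (cht q) + mkpt ((locy y' p - locy y p) *m B) 0.
  apply: mkptP; rewrite linearD /= ?hor_mkpt ?ver_mkpt ?addr0 // -mulmxDl; congr (_ *m B).
  by apply/rowP => i; have := E i; rewrite !mxE => <-; rewrite addrC subrK.
rewrite /= hA hA' E !mulmxDl !mulNmx !mulmxA -(mulmxA _ A A^T) oA mulmx1.
by rewrite [RHS]addrACA subrKC addrAC.
Unshelve. all: by end_near. Qed.

End Charts.

(** * Partial derivatives and functions of class C^k *)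

Section PartialDerivatives.
Context {R : realType}.

(** Gives access to the one-variable chain rule and mean value theorem along a line. *)
Lemma is_derive_lineP (V W : normedModType R) (f : V -> W) x v d :
  is_derive x v f d <-> is_derive (0 : R) 1 (fun h : R => f (h *: v + x)) d.
Proof.
have E : 'D_v f x = 'D_1 (fun h : R => f (h *: v + x)) 0.
  apply: (congr1 (fun F : R -> W => lim (F @ 0^'))); apply/funext => h /=.
  by rewrite addr0 scale0r add0r [_%:A]mulr1.
split=> -[dv <-].
  by apply: DeriveDef; [move/derivable1P: dv|rewrite E].
by apply: DeriveDef; [apply/derivable1P|rewrite E].
Qed.

Context {n : nat}.
Implicit Types (f g : 'rV[R]_n -> R) (O : set 'rV[R]_n) (x : 'rV[R]_n).

Lemma Ck_sub k O O' f : O' `<=` O -> Ck_on k O f -> Ck_on k O' f.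
Proof.
move=> sO; elim: k f => [|k IH] f /=.
  by move=> h x; rewrite inE => Ox; apply: h; rewrite inE; exact: sO.
move=> [cf h]; split.
  by move=> x; rewrite inE => Ox; apply: cf; rewrite inE; exact: sO.
move=> i; have [h1 h2] := h i; split; last exact: IH.
by move=> x Ox; apply: h1; exact: sO.
Qed.

Lemma Ck_local k O f : (forall x, O x -> exists2 O', O' x & Ck_on k O' f) -> Ck_on k O f.
Proof.
elim: k f => [|k IH] f h /=.
  move=> x; rewrite inE => Ox; have [U Ux hO] := h x Ox.
  by apply: hO; rewrite inE.
split.
  move=> x; rewrite inE => Ox; have [U Ux [cf _]] := h x Ox.
  by apply: cf; rewrite inE.
move=> i; split.
  by move=> x Ox; have [U Ux [_ /(_ i) [d _]]] := h x Ox; exact: d.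
apply: IH => x Ox; have [U Ux [_ /(_ i) [_ d]]] := h x Ox.
by exists U.
Qed.

Lemma Ck_eq k O f g : open O -> (forall x, O x -> f x = g x) ->
  Ck_on k O f -> Ck_on k O g.
Proof.
move=> oO; elim: k f g => [|k IH] f g fg.
  move=> h x xO; have Ox : O x by rewrite inE in xO.
  by apply: ct_eq (h x xO); exact: near_open Ox fg.
move=> [cf h]; split.
  move=> x xO; have Ox : O x by rewrite inE in xO.
  by apply: ct_eq (cf x xO); exact: near_open Ox fg.
move=> i; have [h1 h2] := h i; split.
  by move=> x Ox; apply: near_eq_derivable (h1 x Ox); exact: near_open Ox fg.
by apply: IH h2 => x Ox; apply: near_eq_derive; exact: near_open Ox fg.
Qed.

Lemma C2_intro O f (df : 'I_n -> 'rV[R]_n -> R) (ddf : 'I_n -> 'I_n -> 'rV[R]_n -> R) :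
  open O -> {in O, continuous f} -> (forall i, {in O, continuous (df i)}) ->
  (forall i j, {in O, continuous (ddf i j)}) ->
  (forall i x, O x -> is_derive x (basis_vec i) f (df i x)) ->
  (forall i j x, O x -> is_derive x (basis_vec j) (df i) (ddf i j x)) ->
  Ck_on 2 O f /\ forall x, O x -> laplacian f x = - \sum_i ddf i i x.
Proof.
move=> oO cf cdf cddf h1 h2; split.
  split=> // i; split; first by move=> x /(h1 i) [].
  apply: (@Ck_eq 1 O (df i)) => //; first by move=> x /(h1 i) [_ <-].
  split=> // j; split; first by move=> x /(h2 i j) [].
  apply: (@Ck_eq 0 O (ddf i j)) => //; first by move=> x /(h2 i j) [_ <-].
  exact: cddf.
move=> x Ox; rewrite /laplacian /divergence; congr (- _); apply: eq_bigr => i _.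
have [_ <-] := h2 i i x Ox; apply: near_eq_derive.
apply: near_open oO Ox _ => y Oy.
by rewrite mxE; have [_ ->] := h1 i y Oy.
Qed.

Lemma laplacianE f x :
  laplacian f x = - \sum_i 'D_(basis_vec i) ('D_(basis_vec i) f) x.
Proof.
rewrite /laplacian /divergence; congr (- _); apply: eq_bigr => i _.
by rewrite (_ : (fun y => grad f y 0 i) = 'D_(basis_vec i) f) //; apply/funext => y; rewrite mxE.
Qed.

End PartialDerivatives.

(** * The cylinder as a flat manifold with boundary *)

Section CylinderManifold.
Context {R : realType} {n : nat} (B : 'M[R]_n) (uB : B \in unitmx).
Local Notation cyl := (cyl R n).

Lemma fchart_int y b : (cod (fchart B y b))° = [set x | near_unitc B y x /\ 0 < ver x < 1].
Proof.
apply/seteqP; split=> x.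
  move=> xc; have := nbhs_singleton xc; rewrite fchart_cod // => -[h1 /andP[h2 h3]].
  (* At height 0, lowering the last coordinate alone leaves the codomain, so such a point is not
     interior. *)
  split=> //; rewrite h3 andbT lt_neqAle h2 andbT; apply/negP; rewrite eq_sym => /eqP v0.
  have ct : {for (0 : R), continuous (fun t : R => mkpt (hor x) t)}.
    by apply: (@continuous_mkpt _ _ _ (fun=> hor x) id); [exact: ct_cst|exact: cvg_id].
  have : \forall t \near (0 : R), 0 <= t.
    have := ct (cod (fchart B y b)); rewrite -{1}v0 mkptK => /(_ xc).
    move=> h0; apply: (near_sub h0) => t; rewrite /preimage /= fchart_cod //= ver_mkpt.
    by move=> [_ /andP[]].
  move=> /nbhs_ballP [e /= e0 /(_ (- (e / 2)))].
  rewrite /ball /= opprK add0r gtr0_norm ?divr_gt0 // => h.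
  suff : 0 <= - (e / 2) by rewrite oppr_ge0 leNgt divr_gt0.
  by apply: h; rewrite ltr_pdivrMr // ltr_pMr // ltr1n.
have oE : open [set x | near_unitc B y x /\ 0 < ver x < 1].
  rewrite (_ : [set x | _] = [set x | near_unitc B y x] `&` ([set x | 0 < ver x] `&` [set x | ver x < 1])).
    apply: openI; first exact: near_unitc_open.
    have /continuousP co := @continuous_ver R n.
    apply: openI; first by move: (co [set r | 0 < r]); apply; exact: open_gt.
    by move: (co [set r | r < 1]); apply; exact: open_lt.
  by apply/seteqP; split => z /= [? /andP].
move=> h; apply: (interiorS (A := [set x | near_unitc B y x /\ 0 < ver x < 1])).
  by move=> z [h1 /andP[h2 h3]]; rewrite fchart_cod //=; split=> //; rewrite h3 ltW.
by move: h; rewrite {1}((interior_id _).1 oE).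
Qed.

Lemma fatlas_interior : atlas_interior (fatlas B) = [set p : cyl | 0 < cht p < 1].
Proof.
apply/seteqP; split=> p.
  move=> [_ [[y [b ->]] [h1 _]]]; rewrite fchart_int /= => -[_].
  by rewrite ver_flipb ver_mkpt; case: b => //; lra.
move=> /= /andP[z0 z1]; have [y [z [z01 E]]] := cpt_surj p.
have h1 : in_arcs y p by rewrite E; apply: in_arcs_cpt => i; rewrite subrr normr0.
exists (fchart B y false); split; [by exists y, false|by []|].
rewrite fchart_int /= ver_mkpt z0 z1; split => // i.
by rewrite unitc_mkpt //; exact: locy_close.
Qed.

Variable mu : {measure set (borel cyl) -> \bar R}.
Hypothesis mu_box : forall c (a b : 'rV[R]_n.+1), fatlas B c ->
  (forall i, a 0 i <= b 0 i) -> box a b `<=` cod c ->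
  mu (bwd c @` box a b) = (\prod_i (b 0 i - a 0 i))%:E.
Hypothesis mu_boundary : mu (~` atlas_interior (fatlas B)) = 0%E.

(** The measure stays a parameter: the eigenvalue problem and the isometries do not involve it. A
    suitable one is constructed below for triangular [B]. *)
Definition cylM : flat_manifold R n := @FlatManifold R n cyl (fatlas B) mu
  (@cyl_hausdorff R n) (@cyl_second_countable R n)
  (fun c => fun h : fatlas B c => let: ex_intro y (ex_intro b e) := h in
     eq_rect_r _ (fchart_is_chart uB y b) e)
  (@fatlas_cover R n B) (fatlas_compatible uB) mu_box mu_boundary.

Lemma boundaryME (p : cylM) : boundaryM p <-> cht p = 0 \/ cht p = 1.
Proof.
have [y [z [/andP[z0 z1] E]]] := cpt_surj p.
have hE : cht p = z by rewrite E cht_cpt clampE // z0.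
rewrite /boundaryM /interiorM /= fatlas_interior /= hE; split.
  move=> h; have : ~~ (0 < z < 1) by apply/negP.
  rewrite negb_and -!leNgt => /orP[h1|h1]; [left|right]; lra.
by case=> ->; rewrite ltxx ?andbF.
Qed.

Lemma cylM_has_boundary : exists p : cylM, boundaryM p.
Proof. by exists (cpt 0 0); apply/boundaryME; left; rewrite cht_cpt clampE // lexx ler01. Qed.

Definition slab : set 'rV[R]_n.+1 := [set x | 0 < ver x < 1].

Lemma slab_open : open slab.
Proof.
rewrite (_ : slab = [set x | 0 < ver x] `&` [set x | ver x < 1]).
  have /continuousP co := @continuous_ver R n.
  apply: openI; first by move: (co [set r | 0 < r]); apply; exact: open_gt.
  by move: (co [set r | r < 1]); apply; exact: open_lt.
by apply/seteqP; split => z /= /andP.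
Qed.

(** The slab covers the interior of the manifold, so a function can be studied as one
    lattice-periodic function on the slab instead of chart by chart. *)
Lemma C2_interior_elim (phi : cylM -> R) : C2_interior phi ->
  Ck_on 2 slab (fun x => phi (proj B x)).
Proof.
move=> h; apply: Ck_local => x xs.
exists (cod (fchart B (unitc B x) false))°.
  by rewrite fchart_int; split=> // i; rewrite subrr normr0.
by have := h (fchart B (unitc B x) false); apply; exists (unitc B x), false.
Qed.

Lemma laplacianM_elim (phi psi : cylM -> R) : laplacianM_eq phi psi ->
  forall x, slab x -> laplacian (fun x => phi (proj B x)) x = psi (proj B x).
Proof.
move=> h x xs; have := h (fchart B (unitc B x) false); apply.
  by exists (unitc B x), false.
by rewrite fchart_int; split=> // i; rewrite subrr normr0.
Qed.

(* It suffices to know phi in horizontal and vertical coordinates, up to the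
   reflection z -> 1 - z used by the charts at the top boundary. *)
Lemma C2_laplacian_intro (phi psi : cylM -> R) :
  (forall b, Ck_on 2 slab (fun x => phi (proj B (flipb b x))) /\
    forall x, slab x -> laplacian (fun x => phi (proj B (flipb b x))) x = psi (proj B (flipb b x))) ->
  C2_interior phi /\ laplacianM_eq phi psi.
Proof.
move=> h; split.
  move=> _ [y [b ->]]; have [h1 _] := h b; apply: Ck_sub h1.
  by rewrite fchart_int => x [].
move=> _ [y [b ->]] x; rewrite fchart_int => -[_ xs]; have [_ h1] := h b.
exact: h1.
Qed.

(** The lifts [locy] are continuous local sections of the covering, so continuity can be tested on
    the covering space. *)
Lemma cyl_continuous_intro (phi : cyl -> R) :
  (forall y z, 0 <= z <= 1 -> {for ((y, z) : 'rV[R]_n * R), continuous (fun yz => phi (cpt yz.1 yz.2))}) ->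
  continuous phi.
Proof.
move=> h; suff H (p : cyl) : {for p, continuous phi} by move=> p; exact: H.
have [y [z [z01 E]]] := cpt_surj p.
have h1 : in_arcs y p by rewrite E; apply: in_arcs_cpt => i; rewrite subrr normr0.
have hp : 0 <= cht p <= 1 by rewrite E cht_cpt clamp_ge0 clamp_le1.
have c1 : {for p, continuous (fun q => (locy y q, cht q))}.
  exact: (cvg_pair (continuous_locy h1) (@continuous_cht _ _ p)).
have c2 : {for p, continuous (fun q => phi (cpt (locy y q) (cht q)))}.
  exact: (ct_comp c1 (h _ _ hp)).
have e : \forall q \near p, phi (cpt (locy y q) (cht q)) = phi q.
  have h2 := in_arcs_near h1.
  by move: h2; apply: (@filterS _ (nbhs p) _) => q hq; rewrite cpt_locy.
exact: (ct_eq e c2).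
Qed.

End CylinderManifold.

(** * Fourier analysis on the torus *)

Section Mean.
Context {R : realType} {n : nat}.
Local Notation V := 'rV[R]_n.
Implicit Types (f g : V -> R) (y h : V).

Definition periodicv (f : V -> R) : Prop := forall y m, f (y + intv R m) = f y.

Lemma periodicv_fracv f y : periodicv f -> f y = f (fracv y).
Proof. by move=> pf; rewrite {1}(fracvE y) pf. Qed.

Lemma cube_compact : compact [set y : V | forall i, 0 <= y 0 i <= 1].
Proof.
rewrite (_ : [set y : V | _] = [set y : V | forall i, `[0, 1]%classic (y 0 i)]).
  by apply: (@rV_compact R n (fun=> `[0, 1]%classic)) => i; exact: segment_compact.
by apply/seteqP; split => y /= h i; have := h i; rewrite /= in_itv.
Qed.

(** The closed unit cube contains a full period and is compact; this turns joint continuity at each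
    [(y, s0)] into an estimate uniform in [y]. *)
Lemma periodicv_unif (T : topologicalType) (s0 : T) (g : V -> T -> R) (e : R) :
  (forall s, periodicv (g^~ s)) ->
  (forall y, {for (y, s0), continuous (fun ys : V * T => g ys.1 ys.2)}) ->
  0 < e -> \forall s \near s0, forall y, `|g y s - g y s0| < e.
Proof.
move=> pg cg e0.
have H : \forall s \near s0, [set y : V | forall i, 0 <= y 0 i <= 1] `<=`
    (fun y => `|g y s - g y s0| < e).
  have /compact_near_coveringP C := cube_compact.
  apply: C => y _.
  have c1 : {for (y, s0), continuous (fun ys : V * T => g ys.1 s0)}.
    have cs : {for y, continuous (g^~ s0)}.
      apply: (@ct_comp _ _ _ (fun y => (y, s0)) (fun ys : V * T => g ys.1 ys.2)); last exact: cg.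
      by apply: ct_pair; [exact: cvg_id|exact: ct_cst].
    by apply: (ct_comp (f := fst) (g := g^~ s0)); [exact: cvg_fst|exact: cs].
  have c2 : {for (y, s0), continuous (fun ys : V * T => g ys.1 ys.2 - g ys.1 s0)}.
    by apply: ctB => //; exact: cg.
  have := @cvgr_dist_lt R R _ (nbhs (y, s0)) _ _ _ c2 _ e0.
  rewrite /= subrr => h0; have h := h0 (nbhs_filter _).
  have h' : \forall ys \near (y, s0), `|g ys.1 ys.2 - g ys.1 s0| < e.
    by apply: (near_sub h) => ys; rewrite sub0r normrN.
  exact: h'.
apply: (near_sub H) => s hs y.
have -> : g y s = g (fracv y) s by rewrite (periodicv_fracv _ (pg s)).
have -> : g y s0 = g (fracv y) s0 by rewrite (periodicv_fracv _ (pg s0)).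
by apply: hs => i; have /andP[-> /ltW ->] := fracv_itv y i.
Qed.

Definition cper f := continuous f /\ periodicv f.

Lemma cper_bounded f : cper f -> exists C : R, forall y, `|f y| <= C.
Proof.
move=> [cf pf].
have cn : continuous (fun y => `|f y|).
  by move=> y; exact: (ct_comp (@cf y) (@norm_continuous _ _ _)).
have ne : [set y : V | forall i, 0 <= y 0 i <= 1] !=set0.
  by exists 0 => i; rewrite mxE lexx ler01.
have [c _ hc] := compact_EVT_max ne cube_compact (continuous_subspaceT cn).
exists `|f c| => y; rewrite (periodicv_fracv _ pf); apply: hc; rewrite inE => i.
by have /andP[-> /ltW ->] := fracv_itv y i.
Qed.

Lemma cper_shift_unif f e : cper f -> 0 < e ->
  \forall s \near (0 : V), forall y, `|f (y + s) - f y| < e.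
Proof.
move=> [cf pf] e0.
have := @periodicv_unif V 0 (fun y s => f (y + s)) e _ _ e0.
have h1 s : periodicv (fun y => f (y + s)) by move=> y m; rewrite addrAC pf.
have h2 y : {for (y, 0), continuous (fun ys : V * V => f (ys.1 + ys.2))}.
  apply: (@ct_comp _ _ _ (fun ys : V * V => ys.1 + ys.2) f); last exact: cf.
  by apply: ctD; [exact: cvg_fst|exact: cvg_snd].
by move=> /(_ h1 h2) h; apply: (near_sub h) => s hs y; have := hs y; rewrite addr0.
Qed.

Definition gridpt (N : nat) (j : {ffun 'I_n -> 'I_N.+1}) : V :=
  \row_i ((j i)%:R / N.+1%:R).

Definition gridavg (N : nat) f : R :=
  (\sum_(j : {ffun 'I_n -> 'I_N.+1}) f (gridpt j)) / #|{ffun 'I_n -> 'I_N.+1}|%:R.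

Lemma card_grid_gt0 N : 0 < #|{ffun 'I_n -> 'I_N.+1}|%:R :> R.
Proof. by rewrite ltr0n card_ffun card_ord expn_gt0. Qed.

Lemma gridavg_cst N (c : R) : gridavg N (fun=> c) = c.
Proof.
by rewrite /gridavg sumr_const -[_ *+ _]mulr_natr mulfK // gt_eqF // card_grid_gt0.
Qed.

Lemma gridavgD N f g : gridavg N (fun y => f y + g y) = gridavg N f + gridavg N g.
Proof. by rewrite /gridavg big_split mulrDl. Qed.

Lemma gridavgZ N (c : R) f : gridavg N (fun y => c * f y) = c * gridavg N f.
Proof. by rewrite /gridavg -mulr_sumr mulrA. Qed.

Lemma gridavg_le N f g : (forall y, f y <= g y) -> gridavg N f <= gridavg N g.
Proof.
move=> fg; rewrite ler_pM2r ?invr_gt0 ?card_grid_gt0 //; exact: ler_sum.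
Qed.

(** Translation by a grid vector permutes the grid points modulo Z^n; [s true] is this permutation
    and [s false] its inverse. *)
Lemma gridavg_shift N f (p : 'rV[int]_n) : periodicv f ->
  gridavg N (fun y => f (y + \row_i ((p 0 i)%:~R / N.+1%:R))) = gridavg N f.
Proof.
move=> pf; congr (_ / _).
have N0 : N.+1%:R != 0 :> R by rewrite pnatr_eq0.
have P0 : (0 : int) < (N.+1)%:Z by [].
pose q (k : int) : 'I_N.+1 := inord `|(k %% (N.+1)%:Z)%Z|%N.
have qE (k : int) : (q k)%:Z = (k %% (N.+1)%:Z)%Z.
  rewrite /q inordK; first by rewrite gez0_abs // modz_ge0.
  by rewrite -ltz_nat gez0_abs ?modz_ge0 // ltz_pmod.
pose s (e : bool) (j : {ffun 'I_n -> 'I_N.+1}) : {ffun 'I_n -> 'I_N.+1} :=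
  [ffun i => q ((j i)%:Z + (if e then p 0 i else - p 0 i))].
have sK e : cancel (s e) (s (~~ e)).
  move=> j; apply/ffunP => i; rewrite !ffunE; apply: val_inj; apply/eqP.
  rewrite -eqz_nat; apply/eqP; rewrite qE qE modzDml -addrA.
  have -> : (if e then p 0 i else - p 0 i) + (if ~~ e then p 0 i else - p 0 i) = 0.
    by case: e; rewrite /= ?addrN ?addNr.
  by rewrite addr0 modz_small // ltz_nat ltn_ord.
rewrite [RHS](reindex (s true)); last by exists (s false) => j _; [exact: (sK true)|exact: (sK false)].
apply: eq_bigr => j _.
rewrite -[RHS](pf _ (\row_i divz ((j i)%:Z + p 0 i) (N.+1)%:Z)); congr (f _).
apply/rowP => i; rewrite !mxE ffunE.
have e1 := divz_eq ((j i)%:Z + p 0 i) (N.+1)%:Z.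
have -> : (q ((j i)%:Z + p 0 i))%:R = (modz ((j i)%:Z + p 0 i) (N.+1)%:Z)%:~R :> R.
  by rewrite -qE.
have := congr1 (fun k : int => k%:~R : R) e1; rewrite rmorphD /= rmorphD rmorphM /= => e2.
by apply: (mulIf N0); rewrite !mulrDl !divfK // -[(j i)%:R]/((j i)%:~R) e2 addrC.
Qed.

Lemma ultra_ex : exists U : set_system nat, UltraFilter U /\ \oo `<=` U.
Proof. exact: ultraFilterLemma. Qed.

Definition ufilter : set_system nat := xget [set: set nat] [set U | UltraFilter U /\ \oo `<=` U].

Lemma ufilterP : UltraFilter ufilter /\ \oo `<=` ufilter.
Proof. by rewrite /ufilter; case: xgetP => //; have [U HU] := ultra_ex => /(_ U). Qed.

#[global] Instance ufilter_ultra : UltraFilter ufilter := ufilterP.1.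

(* An invariant mean on the torus: the limit of the grid averages along an
   ultrafilter, so that no integration theory is needed. *)
Definition mean f : R := lim (gridavg N f @[N --> ufilter]).

(** The image of an ultrafilter on a compact interval has a cluster point, and an ultrafilter
    converges to its cluster points. *)
Lemma ultra_cvg (u : nat -> R) (C : R) : (forall N, `|u N| <= C) ->
  cvg (u N @[N --> ufilter]).
Proof.
move=> hu.
have cC : compact `[- C, C]%classic by exact: segment_compact.
have FA : (u N @[N --> ufilter]) `[- C, C]%classic.
  rewrite /nbhs /=; apply: (@filterS _ ufilter _ setT); last exact: filterT.
  by move=> N _ /=; rewrite in_itv /= -ler_norml.
have [p [_ clp]] := cC _ (fmap_proper_filter u _) FA.
apply/cvg_ex; exists p => A Ap; rewrite /nbhs /=.
have [//|h] := in_ultra_setVsetC (u @^-1` A) ufilter_ultra.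
have [x [+ Ax]] := clp (~` A) A h Ap.
by [].
Qed.

Lemma mean_cvg f : cper f -> gridavg N f @[N --> ufilter] --> mean f.
Proof.
move=> cpf; have [C hC] := cper_bounded cpf.
apply: (@ultra_cvg (fun N => gridavg N f) C) => N.
rewrite ler_norml -(gridavg_cst N (- C)) -{2}(gridavg_cst N C).
by apply/andP; split; apply: gridavg_le => y; have := hC y; rewrite ler_norml => /andP[].
Qed.

Lemma cper_cst (c : R) : cper (fun=> c).
Proof. by split => // y; exact: ct_cst. Qed.

Lemma cperD f g : cper f -> cper g -> cper (fun y => f y + g y).
Proof.
move=> [cf pf] [cg pg]; split; first by move=> y; exact: (ctD (@cf y) (@cg y)).
by move=> y m; rewrite pf pg.
Qed.

Lemma cperM f g : cper f -> cper g -> cper (fun y => f y * g y).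
Proof.
move=> [cf pf] [cg pg]; split; first by move=> y; exact: (ctM (@cf y) (@cg y)).
by move=> y m; rewrite pf pg.
Qed.

Lemma cperZ (c : R) f : cper f -> cper (fun y => c * f y).
Proof. exact: cperM (cper_cst c). Qed.

Lemma cperB f g : cper f -> cper g -> cper (fun y => f y - g y).
Proof.
move=> [cf pf] [cg pg]; split; first by move=> y; exact: (ctB (@cf y) (@cg y)).
by move=> y m; rewrite pf pg.
Qed.

Lemma cper_shift f h : cper f -> cper (fun y => f (y + h)).
Proof.
move=> [cf pf]; split; last by move=> y m; rewrite addrAC pf.
move=> y; apply: (@ct_comp _ _ _ (fun y => y + h) f); last exact: cf.
by apply: ctD; [exact: cvg_id|exact: ct_cst].
Qed.

Lemma mean_cst (c : R) : mean (fun=> c) = c.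
Proof.
rewrite /mean; under eq_fun do rewrite gridavg_cst; exact: lim_cst.
Qed.

Lemma meanD f g : cper f -> cper g -> mean (fun y => f y + g y) = mean f + mean g.
Proof.
move=> cf cg; apply: cvg_lim => //; under eq_fun do rewrite gridavgD.
exact: cvgD (mean_cvg cf) (mean_cvg cg).
Qed.

Lemma meanZ (c : R) f : cper f -> mean (fun y => c * f y) = c * mean f.
Proof.
move=> cf; apply: cvg_lim => //; under eq_fun do rewrite gridavgZ.
exact: cvgMl_tmp (mean_cvg cf).
Qed.

Lemma mean_le f g : cper f -> cper g -> (forall y, f y <= g y) -> mean f <= mean g.
Proof.
move=> cf cg fg.
apply: (ler_cvg_to (mean_cvg cf) (mean_cvg cg)).
by apply: (@filterS _ ufilter _ setT) => [N _|]; [exact: gridavg_le|exact: filterT].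
Qed.

Lemma meanB f g : cper f -> cper g -> mean (fun y => f y - g y) = mean f - mean g.
Proof.
move=> cf cg; rewrite -[- mean g]mulN1r -meanZ // -meanD //; last exact: cperZ.
by congr mean; apply/funext => y; rewrite mulN1r.
Qed.

Lemma mean_norm_le f (C : R) : cper f -> (forall y, `|f y| <= C) -> `|mean f| <= C.
Proof.
move=> cf hC; rewrite ler_norml -{1}(mean_cst (- C)) -{2}(mean_cst C).
by apply/andP; split; apply: mean_le => //; try exact: cper_cst;
   move=> y; have := hC y; rewrite ler_norml => /andP[].
Qed.

(** Grid translations preserve grid averages exactly. Every [h] is within [1 / N.+1] of a grid
    translation in each coordinate, and uniform continuity makes the resulting error smaller than
    any [e]. *)
Lemma mean_shift f h : cper f -> mean (fun y => f (y + h)) = mean f.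
Proof.
move=> cf; have cfh := cper_shift h cf.
suff H e : 0 < e -> `|mean (fun y => f (y + h)) - mean f| <= e.
  apply/eqP; rewrite -subr_eq0 -normr_le0; apply/ler_addgt0Pr => e e0; rewrite add0r; exact: H.
move=> e0; have /nbhs_ballP [d /= d0 hd] := cper_shift_unif cf e0.
rewrite -meanB //.
have cB : cper (fun y => f (y + h) - f y).
  by apply: cperD => //; have := cperZ (-1) cf; congr cper; apply/funext => y; rewrite mulN1r.
have K : (`|gridavg N (fun y => f (y + h) - f y)| @[N --> ufilter]) --> `|mean (fun y => f (y + h) - f y)|.
  by apply: cvg_norm; exact: mean_cvg.
apply: (cvgr_to_le K); apply: ufilterP.2.
(* From here on the mesh of the grid is below the modulus of continuity [d] belonging to [e]. *)
have [N0 hN0] : exists N0 : nat, d^-1 < N0%:R.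
  by exists (Num.truncn d^-1).+1; have := real_truncnS_gt (num_real d^-1).
exists N0 => // N /= N0N.
pose p : 'rV[int]_n := \row_i Num.floor (h 0 i * N.+1%:R).
pose s : V := \row_i ((p 0 i)%:~R / N.+1%:R).
have -> : gridavg N (fun y => f (y + h) - f y) = gridavg N (fun y => f (y + h) - f (y + s)).
  have e1 (u v : V -> R) : gridavg N (fun y => u y - v y) = gridavg N u - gridavg N v.
    rewrite -[- gridavg N v]mulN1r -gridavgZ -gridavgD.
    by congr gridavg; apply/funext => y; rewrite mulN1r.
  by rewrite !e1 gridavg_shift //; exact: cf.2.
rewrite ler_norml -(gridavg_cst N (- e)) -{2}(gridavg_cst N e).
have He y : `|f (y + h) - f (y + s)| <= e.
  have -> : y + h = (y + s) + (h - s) by rewrite addrACA subrr addr0.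
  apply/ltW/hd; rewrite mx_norm_ball /ball_ /= sub0r normrN.
  rewrite [ltLHS]mx_normrE; apply: bigmax_lt => // -[a i] _ /=.
  rewrite ord1 !mxE.
  have /andP[f1 f2] := floor_itv (h 0 i * N.+1%:R).
  have NN : 0 < N.+1%:R :> R by rewrite ltr0n.
  have e2 : h 0 i - (Num.floor (h 0 i * N.+1%:R))%:~R / N.+1%:R =
     (h 0 i * N.+1%:R - (Num.floor (h 0 i * N.+1%:R))%:~R) / N.+1%:R.
    by rewrite mulrBl mulfK // gt_eqF.
  rewrite e2 normrM normfV (gtr0_norm NN) ger0_norm ?subr_ge0 // ltr_pdivrMr //.
  apply: (@le_lt_trans _ _ 1).
    by apply: ltW; rewrite ltrBlDl -[X in _ + X]/(1%:~R) -intrD.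
  rewrite -ltr_pdivrMl // mulr1; apply: (lt_trans hN0).
  by rewrite ltr_nat ltnS.
by apply/andP; split; apply: gridavg_le => y; have := He y; rewrite ler_norml => /andP[].
Qed.

End Mean.

(** * Uniqueness of Fourier coefficients *)

Section Fourier.
Context {R : realType} {n : nat}.
Local Notation V := 'rV[R]_n.
Implicit Types (f g : V -> R) (y h : V) (m : 'rV[int]_n).

Definition dotz m y : R := \sum_i (m 0 i)%:~R * y 0 i.

(** The Hartley kernel. It gives one real function for each integer vector, and these are
    orthonormal for [mean]; cosines and sines would have to be paired over half of the lattice. *)
Definition cas (t : R) : R := cos t + sin t.

Definition casm m y : R := cas (tau * dotz m y).

Lemma dotzD m y h : dotz m (y + h) = dotz m y + dotz m h.
Proof. by rewrite /dotz -big_split; apply: eq_bigr => i _; rewrite mxE mulrDr. Qed.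

Lemma dotzDl m m' y : dotz (m + m') y = dotz m y + dotz m' y.
Proof. by rewrite /dotz -big_split; apply: eq_bigr => i _; rewrite mxE intrD mulrDl. Qed.

Lemma dotzN m y : dotz (- m) y = - dotz m y.
Proof. by rewrite /dotz -sumrN; apply: eq_bigr => i _; rewrite mxE mulrNz mulNr. Qed.

Lemma dotz_delta i y : dotz (delta_mx 0 i) y = y 0 i.
Proof.
rewrite /dotz (bigD1 i) //= mxE !eqxx mul1r big1 ?addr0 // => j ji.
by rewrite mxE (negbTE ji) andbF mul0r.
Qed.

Lemma dotz_intv m m' : exists k : int, dotz m (intv R m') = k%:~R.
Proof.
exists (\sum_i m 0 i * m' 0 i); rewrite rmorph_sum; apply: eq_bigr => i _.
by rewrite mxE /= intrM.
Qed.

Lemma continuous_dotz m : continuous (dotz m).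
Proof.
move=> y; apply: (@cvg_sumr _ _ (nbhs y) _) => i _.
by apply: cvgMl_tmp; exact: coord_continuous.
Qed.

Lemma cper_trig (F : R -> R) m : continuous F ->
  (forall a (k : int), F (tau * (a + k%:~R)) = F (tau * a)) ->
  cper (fun y => F (tau * dotz m y)).
Proof.
move=> cF pF; split.
  move=> y; apply: (@ct_comp _ _ _ (fun y => tau * dotz m y) F); last exact: cF.
  by apply: ctM; [exact: ct_cst|exact: continuous_dotz].
by move=> y m'; rewrite dotzD; have [k ->] := dotz_intv m m'; rewrite pF.
Qed.

Lemma cper_cos m : cper (fun y => cos (tau * dotz m y)).
Proof. by apply: cper_trig; [exact: continuous_cos|exact: cos_tauDz]. Qed.

Lemma cper_sin m : cper (fun y => sin (tau * dotz m y)).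
Proof. by apply: cper_trig; [exact: continuous_sin|exact: sin_tauDz]. Qed.

Lemma cper_casm m : cper (casm m).
Proof. exact: cperD (cper_cos m) (cper_sin m). Qed.

(** Translation by this [h] changes the sign of every trigonometric function of frequency [m], which
    forces its mean to vanish. *)
Lemma half_period m : m != 0 -> exists h, dotz m h = 2^-1.
Proof.
move=> m0; have [i mi] : exists i, m 0 i != 0.
  apply/existsP; apply: contraNT m0; rewrite negb_exists => /forallP H.
  by apply/eqP/rowP => i; rewrite mxE; apply/eqP; have := H i; rewrite negbK.
exists ((2 * (m 0 i)%:~R)^-1 *: delta_mx 0 i).
rewrite /dotz (bigD1 i) //= !mxE !eqxx mulr1 big1 ?addr0.
  by rewrite invfM mulrCA mulfV ?mulr1 // intr_eq0.
by move=> j ji; rewrite !mxE (negbTE ji) andbF !mulr0.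
Qed.

Lemma mean_alt f h : cper f -> (forall y, f (y + h) = - f y) -> mean f = 0.
Proof.
move=> cf hf; have := mean_shift h cf.
have -> : (fun y => f (y + h)) = (fun y => -1 * f y).
  by apply/funext => y; rewrite hf mulN1r.
by rewrite meanZ // => H; lra.
Qed.

Lemma mean_cos m : mean (fun y => cos (tau * dotz m y)) = (m == 0)%:R.
Proof.
have [->|m0] := eqVneq m 0.
  rewrite -[RHS](mean_cst (n := n)); congr mean; apply/funext => y.
  by rewrite /dotz big1 ?mulr0 ?cos0 // => i _; rewrite mxE mul0r.
have [h hh] := half_period m0; apply: (mean_alt (h := h)); first exact: cper_cos.
move=> y; rewrite dotzD hh mulrDr.
have -> : tau * 2^-1 = pi :> R by rewrite /tau; field.
by rewrite cosDpi.
Qed.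

Lemma mean_sin m : mean (fun y => sin (tau * dotz m y)) = 0.
Proof.
have [->|m0] := eqVneq m 0.
  rewrite -[RHS](mean_cst (n := n)); congr mean; apply/funext => y.
  by rewrite /dotz big1 ?mulr0 ?sin0 // => i _; rewrite mxE mul0r.
have [h hh] := half_period m0; apply: (mean_alt (h := h)); first exact: cper_sin.
move=> y; rewrite dotzD hh mulrDr.
have -> : tau * 2^-1 = pi :> R by rewrite /tau; field.
by rewrite sinDpi.
Qed.

Lemma cas_mul (a b : R) : cas a * cas b = cos (a - b) + sin (a + b).
Proof. by rewrite /cas cosB sinD; ring. Qed.

Lemma mean_casm m m' : mean (fun y => casm m y * casm m' y) = (m == m')%:R.
Proof.
rewrite (_ : (fun y => _) = (fun y => cos (tau * dotz (m - m') y) + sin (tau * dotz (m + m') y))); last first.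
  by apply/funext => y; rewrite /casm cas_mul !dotzDl dotzN mulrDr mulrDr mulrN.
by rewrite meanD ?mean_cos ?mean_sin ?addr0 ?subr_eq0 //; [exact: cper_cos|exact: cper_sin].
Qed.

Lemma cas_cos (a b : R) : cas a * cos b = (cas (a + b) + cas (a - b)) / 2.
Proof. by rewrite /cas cosB sinB cosD sinD; field. Qed.

Lemma casm_shift m y h :
  casm m (y + h) = cos (tau * dotz m h) * casm m y + sin (tau * dotz m h) * casm (- m) y.
Proof. rewrite /casm /cas dotzN mulrN dotzD mulrDr cosD sinD cosN sinN; ring. Qed.

Lemma mean_sum (I : Type) (r : seq I) (F : I -> V -> R) :
  (forall i, cper (F i)) ->
  cper (fun y => \sum_(i <- r) F i y) /\ mean (fun y => \sum_(i <- r) F i y) = \sum_(i <- r) mean (F i).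
Proof.
move=> cF; elim: r => [|i r [c1 IH]].
  have -> : (fun y : V => \sum_(i <- [::]) F i y) = fun=> 0 by apply/funext => y; rewrite big_nil.
  by rewrite big_nil mean_cst; split => //; exact: cper_cst.
have -> : (fun y : V => \sum_(j <- i :: r) F j y) = fun y => F i y + \sum_(j <- r) F j y.
  by apply/funext => y; rewrite big_cons.
by split; [exact: cperD|rewrite big_cons meanD // IH].
Qed.

(** Finitely many translates of the region where [b] exceeds [b 0 / 2] cover the torus. The sum of
    the translated functions is thus bounded below, and each translate has the same mean. *)
Lemma mean_gt0 b : cper b -> (forall y, 0 <= b y) -> 0 < b 0 -> 0 < mean b.
Proof.
move=> cb b_ge0 b0.
have b2 : b 0 / 2 < b 0 by rewrite ltr_pdivrMr // ltr_pMr // ltr1n.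
have hn : \forall y \near (0 : V), b 0 / 2 < b y by exact: (cvgr_gt _ (cb.1 0) _ b2).
have /nbhs_ballP [d /= d0 hd] := hn.
have [N hN] : exists N : nat, d^-1 < N.+1%:R.
  by exists (Num.truncn d^-1); have := real_truncnS_gt (num_real d^-1).
have NN : 0 < N.+1%:R :> R by rewrite ltr0n.
have P0 : (0 : int) < (N.+1)%:Z by [].
have cover y : exists j : {ffun 'I_n -> 'I_N.+1}, b 0 / 2 < b (y + gridpt j).
  pose p i : int := - Num.floor (y 0 i * N.+1%:R).
  pose q i : 'I_N.+1 := inord `|(p i %% (N.+1)%:Z)%Z|%N.
  have qE i : (q i)%:Z = (p i %% (N.+1)%:Z)%Z.
    rewrite /q inordK; first by rewrite gez0_abs // modz_ge0.
    by rewrite -ltz_nat gez0_abs ?modz_ge0 // ltz_pmod.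
  exists [ffun i => q i].
  rewrite -[ltRHS](cb.2 _ (\row_i divz (p i) (N.+1)%:Z)); apply: hd.
  rewrite mx_norm_ball /ball_ /= sub0r normrN [ltLHS]mx_normrE.
  apply: bigmax_lt => // -[a i] _ /=; rewrite ord1 !mxE ffunE.
  have e1 : (q i)%:R = (p i)%:~R - (divz (p i) (N.+1)%:Z)%:~R * N.+1%:R :> R.
    rewrite -[(q i)%:R]/((q i)%:~R) qE.
    have := congr1 (fun k : int => k%:~R : R) (divz_eq (p i) (N.+1)%:Z).
    by rewrite rmorphD rmorphM /= => {1}->; rewrite addrAC subrr add0r.
  have -> : y 0 i + (q i)%:R / N.+1%:R + (divz (p i) (N.+1)%:Z)%:~R =
     (y 0 i * N.+1%:R - (Num.floor (y 0 i * N.+1%:R))%:~R) / N.+1%:R.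
    rewrite e1 /p mulrNz; field.
    by rewrite gt_eqF.
  have /andP[f1 f2] := floor_itv (y 0 i * N.+1%:R).
  rewrite normrM normfV (gtr0_norm NN) ger0_norm ?subr_ge0 // ltr_pdivrMr //.
  apply: (@le_lt_trans _ _ 1); last by rewrite -ltr_pdivrMl // mulr1.
  by apply: ltW; rewrite ltrBlDl -[X in _ + X]/(1%:~R) -intrD.
have [cs ms] := mean_sum (enum {ffun 'I_n -> 'I_N.+1}) (fun j => cper_shift (gridpt j) cb).
have : b 0 / 2 <= mean (fun y => \sum_(j <- enum {ffun 'I_n -> 'I_N.+1}) b (y + gridpt j)).
  rewrite -(mean_cst (n := n) (b 0 / 2)); apply: mean_le => //; first exact: cper_cst.
  move=> y; have [j hj] := cover y; rewrite big_enum /= (bigD1 j) //=.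
  by rewrite (le_trans (ltW hj)) // lerDl sumr_ge0.
rewrite ms; under eq_bigr do rewrite mean_shift //.
rewrite big_enum /= sumr_const => h.
have c0 : (0 < #|{: {ffun 'I_n -> 'I_N.+1}}|)%N by rewrite -(ltr0n R) card_grid_gt0.
rewrite -(pmulrn_lgt0 _ c0); apply: lt_le_trans h; by rewrite divr_gt0.
Qed.

(** A trigonometric polynomial with values in [0,1] that equals 1 only where the coordinate is an
    integer. Powers of the product [bump] concentrate at the integer points. *)
Definition bumpc (i : 'I_n) y : R := (1 + cos (tau * y 0 i)) / 2.

Definition bump y : R := \prod_i bumpc i y.

Lemma cper_bumpc i : cper (bumpc i).
Proof.
have c1 := cper_cos (delta_mx 0 i).
rewrite (_ : bumpc i = fun y => 2^-1 * (1 + cos (tau * dotz (delta_mx 0 i) y))).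
  by apply: cperZ; apply: cperD => //; exact: cper_cst.
by apply/funext => y; rewrite /bumpc dotz_delta mulrC.
Qed.

Lemma bumpc_itv i y : 0 <= bumpc i y <= 1.
Proof. have := cos_geN1 (tau * y 0 i); have := cos_le1 (tau * y 0 i); rewrite /bumpc; lra. Qed.

Lemma cper_prod (I : Type) (r : seq I) (F : I -> V -> R) :
  (forall i, cper (F i)) -> cper (fun y => \prod_(i <- r) F i y).
Proof.
move=> cF; elim: r => [|i r IH].
  have -> : (fun y : V => \prod_(i <- [::]) F i y) = fun=> 1 by apply/funext => y; rewrite big_nil.
  exact: cper_cst.
have -> : (fun y : V => \prod_(j <- i :: r) F j y) = fun y => F i y * \prod_(j <- r) F j y.
  by apply/funext => y; rewrite big_cons.
exact: cperM.
Qed.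

Lemma cper_bump : cper bump.
Proof. exact: cper_prod cper_bumpc. Qed.

Lemma bump_itv y : 0 <= bump y <= 1.
Proof.
rewrite /bump; apply/andP; split.
  by apply: prodr_ge0 => i _; have /andP[] := bumpc_itv i y.
by apply: prodr_ile1 => i _; exact: bumpc_itv.
Qed.

Lemma bump0 : bump 0 = 1.
Proof. by rewrite /bump big1 // => i _; rewrite /bumpc mxE mulr0 cos0; field. Qed.

Lemma bump_eq1 y : bump y = 1 -> exists m, y = intv R m.
Proof.
move=> h; have H i : exists k : int, y 0 i = k%:~R.
  apply: cos_tau_eq1; have : bumpc i y = 1.
    apply/eqP; rewrite eq_le; have /andP[_ ->] := bumpc_itv i y; rewrite /= -h /bump (bigD1 i) //=.
    rewrite ler_piMr //; first by have /andP[] := bumpc_itv i y.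
    by apply: prodr_ile1 => j _; exact: bumpc_itv.
  by rewrite /bumpc; lra.
have [m hm] := choice H; exists (\row_i m i).
by apply/rowP => i; rewrite !mxE hm.
Qed.

Definition orth_all f (K : V -> R) : Prop :=
  cper K /\ forall m, mean (fun y => f y * K y * casm m y) = 0.

(** By [cas_cos], multiplication by a cosine only mixes the frequencies [m + e] and [m - e], so
    orthogonality to all [casm m] persists. *)
Lemma orth_all_bumpc f K i : cper f -> orth_all f K ->
  orth_all f (fun y => K y * bumpc i y).
Proof.
move=> cf [cK h]; split; first by apply: cperM => //; exact: cper_bumpc.
move=> m; pose e := delta_mx 0 i : 'rV[int]_n.
have c1 m' : cper (fun y => f y * K y * casm m' y).
  by apply: cperM; [exact: cperM|exact: cper_casm].
rewrite (_ : (fun y => _) = (fun y => 2^-1 * (f y * K y * casm m y) +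
   4^-1 * (f y * K y * casm (m + e) y + f y * K y * casm (m - e) y))).
  rewrite meanD ?meanZ ?meanD ?h ?addr0 ?mulr0 ?addr0 //; try exact: cperZ.
  - exact: cperD.
  - exact/cperZ/cperD.
apply/funext => y; rewrite /casm !dotzDl dotzN dotz_delta (mulrDr tau) (mulrDr tau) mulrN.
have := cas_cos (tau * dotz m y) (tau * y 0 i); rewrite /bumpc.
set a := cas (_ + _); set b := cas (_ - _); set CA := cas _; set CO := cos _ => E.
transitivity (f y * K y * 2^-1 * (CA + CA * CO)); first by field.
by rewrite E; field.
Qed.

Lemma orth_all_bumpX f N : cper f -> (forall m, mean (fun y => f y * casm m y) = 0) ->
  orth_all f (fun y => bump y ^+ N).
Proof.
move=> cf h; elim: N => [|N IH].
  split; first by under eq_fun do rewrite expr0; exact: cper_cst.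
  by move=> m; under eq_fun do rewrite expr0 mulr1; exact: h.
have : orth_all f (fun y => bump y ^+ N * \prod_(i <- enum 'I_n) bumpc i y).
  elim: (enum 'I_n) => [|i r IHr].
    by rewrite (_ : (fun y => _) = (fun y => bump y ^+ N)) //; apply/funext => y; rewrite big_nil mulr1.
  rewrite (_ : (fun y => _) = (fun y => bump y ^+ N * (\prod_(j <- r) bumpc j y) * bumpc i y)).
    exact: orth_all_bumpc.
  by apply/funext => y; rewrite big_cons -mulrA; congr (_ * _); rewrite mulrC.
by congr orth_all; apply/funext => y; rewrite exprSr /bump big_enum.
Qed.

(** If [f 0 > 0], then [f * bump ^+ N] has mean zero for all [N]. Yet it is positive near the
    integer points, where the powers of [bump] decay more slowly than in the region where [f] is
    small or negative. *)
Lemma casm_orth_le0 f : cper f -> (forall m, mean (fun y => f y * casm m y) = 0) -> f 0 <= 0.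
Proof.
move=> cf h; rewrite leNgt; apply/negP => f0.
have [C hC] := cper_bounded cf.
pose e := f 0 / 2.
have e0 : 0 < e by rewrite divr_gt0.
(* [bump] equals 1 only at integer points, where [f = f 0 > e]; by compactness of a period it is
   bounded away from 1 where [f <= e]. If that region is empty, the value 1 is taken for [eta]. *)
have [eta [eta0 eta1 heta]] : exists eta : R, [/\ 0 < eta, eta <= 1 & forall y, f y <= e -> bump y <= 1 - eta].
  pose A := [set y : V | forall i, 0 <= y 0 i <= 1] `&` [set y | f y <= e].
  have cA : compact A.
    apply: compact_closedI; first exact: cube_compact.
    by apply: (preimage_closed (f := f) (D := [set r | r <= e])); [move=> x _; exact: cf.1|exact: closed_le].
  have [A0|/set0P Ane] := eqVneq A set0.
    exists 1; split => // y fy; exfalso.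
    have : A (fracv y).
      split => /= [i|]; last by rewrite -periodicv_fracv //; exact: cf.2.
      by have /andP[-> /ltW ->] := fracv_itv y i.
    by rewrite A0.
  have [c Ac hc] := compact_EVT_max Ane cA (continuous_subspaceT cper_bump.1).
  have /andP[b0 b1] := bump_itv c.
  exists (1 - bump c); split.
  - rewrite subr_gt0 lt_neqAle b1 andbT; apply/negP => /eqP /bump_eq1 [m cm].
    move: Ac; rewrite inE => -[_ /=]; rewrite cm -[intv R m]add0r cf.2 /e; lra.
  - by rewrite gerBl.
  - move=> y fy; rewrite subKr (periodicv_fracv _ cper_bump.2); apply: hc; rewrite inE; split.
      by move=> i; have /andP[-> /ltW ->] := fracv_itv y i.
    by rewrite /= -periodicv_fracv //; exact: cf.2.
(* Two levels of [bump]: it is at most [c] where [f <= e], and the test function [b] lives where it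
   exceeds the larger level [a], so that [f > e] on the support of [b]. *)
pose a := 1 - eta / 2; pose c := 1 - eta.
have a0 : 0 < a by rewrite /a; lra.
have c0 : 0 <= c by rewrite /c; lra.
have ca : c < a by rewrite /c /a; lra.
pose b y := Num.max 0 (bump y - a).
have cb : cper b.
  split; last by move=> y m; rewrite /b cper_bump.2.
  move=> y; apply: (@continuous_max _ _ (fun=> 0) (fun y => bump y - a)); first exact: ct_cst.
  by apply: ctB; [exact: cper_bump.1|exact: ct_cst].
have mb : 0 < mean b.
  apply: mean_gt0 => //; first by move=> y; rewrite /b le_max lexx.
  by rewrite /b bump0 lt_max /a; apply/orP; right; lra.
have C0 : 0 <= C by apply: le_trans (hC 0).
(* Average the pointwise bound of [e * a ^+ N * b] by [f * bump ^+ N + C * c ^+ N], in which the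
   first summand has mean zero. Since [c < a], large [N] gives a contradiction. *)
have key N : e * a ^+ N * mean b <= C * c ^+ N.
  have [cK hK] := orth_all_bumpX N cf h.
  have cfK : cper (fun y => f y * bump y ^+ N) by exact: cperM.
  have m0 : mean (fun y => f y * bump y ^+ N) = 0.
    have := hK 0; congr (_ = _); congr mean; apply/funext => y.
    by rewrite /casm /cas /dotz big1 ?mulr0 ?cos0 ?sin0 ?addr0 ?mulr1 // => i _; rewrite mxE mul0r.
  have : mean (fun y => e * a ^+ N * b y) <= mean (fun y => f y * bump y ^+ N + C * c ^+ N).
    apply: mean_le; [exact: cperZ|by apply: cperD => //; exact: cper_cst|move=> y].
    have /andP[q0 q1] := bump_itv y.
    have Cc : 0 <= C * c ^+ N by rewrite mulr_ge0 // exprn_ge0.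
    have [fy|fy] := lerP (f y) e.
      have qc : bump y <= c by exact: heta.
      have -> : b y = 0 by rewrite /b; apply: max_l; rewrite subr_le0 (le_trans qc) // ltW.
      rewrite mulr0 -lerBlDr sub0r.
      have : `|f y * bump y ^+ N| <= C * c ^+ N.
        by rewrite normrM ler_pM // ger0_norm ?exprn_ge0 // lerXn2r ?nnegrE.
      by rewrite ler_norml => /andP[].
    rewrite ler_wpDr // /b; have [qa|qa] := lerP (bump y - a) 0.
      by rewrite mulr0 mulr_ge0 ?exprn_ge0 // ltW // (lt_trans e0).
    rewrite -mulrA ler_pM ?(ltW e0) ?(ltW fy) //.
      by rewrite mulr_ge0 ?exprn_ge0 ?ltW.
    apply: (@le_trans _ _ (a ^+ N)).
      by rewrite ler_piMr ?exprn_ge0 ?(ltW a0) //; lra.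
    by rewrite lerXn2r ?nnegrE ?(ltW a0) //; move: qa; rewrite subr_gt0 => /ltW.
  rewrite meanZ // meanD ?m0 ?mean_cst ?add0r //; exact: cper_cst.
pose r := c / a.
have r1 : `|r| < 1.
  by rewrite /r ger0_norm ?divr_ge0 ?(ltW a0) // ltr_pdivrMr // mul1r.
have key2 N : e * mean b <= C * r ^+ N.
  have aN : 0 < a ^+ N by rewrite exprn_gt0.
  by rewrite /r expr_div_n mulrA ler_pdivlMr // mulrAC.
have lim0 : (C * r ^+ N) @[N --> \oo] --> C * 0 by apply: cvgMl_tmp; exact: cvg_expr.
have : e * mean b <= C * 0 by apply: (cvgr_to_ge lim0); exact: nearW.
by rewrite mulr0 leNgt mulr_gt0.
Qed.

(* Uniqueness of Fourier coefficients, for the real basis cas. *)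
Theorem casm_unique f : cper f -> (forall m, mean (fun y => f y * casm m y) = 0) -> forall y, f y = 0.
Proof.
move=> cf h y; apply/eqP.
have cN : cper (fun z => - f z).
  by have := cperZ (-1) cf; congr cper; apply/funext => z; rewrite mulN1r.
(* The estimate at 0 is carried to [y] by translation: a translated [casm m] is a combination of
   [casm m] and [casm (- m)]. It is then used for [f] and for its opposite. *)
have H g : cper g -> (forall m, mean (fun y => g y * casm m y) = 0) -> g y <= 0.
  move=> cg hg; have := @casm_orth_le0 (fun z => g (z + y)); rewrite add0r; apply.
    exact: cper_shift.
  move=> m.
  have c1 m' : cper (fun z => g z * casm m' z) by apply: cperM => //; exact: cper_casm.
  rewrite -(mean_shift (- y)); last by apply: cperM; [exact: cper_shift|exact: cper_casm].
  rewrite (_ : (fun z => _) = fun z => cos (tau * dotz m (- y)) * (g z * casm m z) + sin (tau * dotz m (- y)) * (g z * casm (- m) z)).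
    by rewrite meanD ?meanZ ?hg ?mulr0 ?addr0 //; exact: cperZ.
  by apply/funext => z; rewrite subrK casm_shift; ring.
rewrite eq_le H //= -oppr_le0; apply: (H (fun z => - f z)) => // m.
rewrite (_ : (fun z => _) = fun z => -1 * (f z * casm m z)).
  by rewrite meanZ ?h ?mulr0 //; apply: cperM => //; exact: cper_casm.
by apply/funext => z; rewrite mulN1r mulNr.
Qed.

End Fourier.

Section OneVariable.
Context {R : realType}.

Lemma is_derive1_continuous (F : R -> R) (t d : R) : is_derive t 1 F d -> {for t, continuous F}.
Proof. by move=> [dF _]; exact/differentiable_continuous/derivable1_diffP. Qed.

Lemma mvt_near0 (F F' : R -> R) (d h : R) : (forall t : R, `|t| < d -> is_derive t 1 F (F' t)) ->
  `|h| < d -> exists2 c, `|c| <= `|h| & F h - F 0 = F' c * h.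
Proof.
move=> dF hd.
have cF (a b : R) : - d < a -> b < d -> {within `[a, b], continuous F}.
  move=> da bd; apply: continuous_in_subspaceT => t /set_mem /=; rewrite in_itv /= => /andP[ta tb].
  by apply: is_derive1_continuous; apply: dF; rewrite ltr_norml (lt_le_trans da) //= (le_lt_trans tb).
have [h0|h0|->] := ltgtP h 0; last by exists 0; rewrite ?normr0 // subrr mulr0.
- move: hd; rewrite ltr0_norm // => hd.
  have [|//|c] := @MVT R F F' h 0 h0.
  - move=> t; rewrite in_itv /= => /andP[th t0]; apply: dF; rewrite ltr0_norm //.
    by apply: lt_trans hd; rewrite ltrN2.
  - by apply: cF; lra.
  rewrite in_itv /= => /andP[ch c0] e; exists c; first by rewrite !ltr0_norm // lerN2 ltW.
  by rewrite -opprB e sub0r mulrN opprK.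
- move: hd; rewrite gtr0_norm // => hd.
  have [|//|c] := @MVT R F F' 0 h h0.
  - move=> t; rewrite in_itv /= => /andP[th t0]; apply: dF; rewrite gtr0_norm //.
    exact: lt_trans hd.
  - by apply: cF; lra.
  rewrite in_itv /= => /andP[ch c0] e; exists c; first by rewrite !gtr0_norm // ltW.
  by rewrite e subr0.
Qed.

(** The remainder form of differentiability: such estimates pass through means and series without
    division by [h]. *)
Lemma is_derive_eps (F : R -> R) (t d : R) :
  (forall e, 0 < e -> \forall h \near (0 : R), `|F (h + t) - F t - h * d| <= e * `|h|) ->
  is_derive t 1 F d.
Proof.
move=> H; suff K : (h^-1 *: (F (h%:A + t) - F t) @[h --> 0^']) --> d.
  by split; [apply/cvg_ex; exists d|exact: (cvg_lim _ K)].
apply/cvgrPdist_le => e e0; have := H e e0 => h0.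
rewrite near_withinE; apply: (near_sub h0) => h hh hn.
have -> : d - h^-1 *: (F (h%:A + t) - F t) = - (h^-1 * (F (h + t) - F t - h * d)).
  by rewrite [h%:A]mulr1 /GRing.scale /=; field.
rewrite normrN normrM normfV -ler_pdivlMl ?invr_gt0 ?normr_gt0 // invrK [leRHS]mulrC.
exact: hh.
Qed.

End OneVariable.

(** * Averages over horizontal slices *)

Section Slices.
Context {R : realType} {n : nat} (B : 'M[R]_n) (uB : B \in unitmx).
Local Notation W := 'rV[R]_n.+1.
Implicit Types (P Q : W -> R) (x v : W) (y : 'rV[R]_n).

Definition latper P : Prop := forall x m, P (x + mkpt (intv R m *m B) 0) = P x.

Lemma unitcD x v : unitc B (x + v) = unitc B x + unitc B v.
Proof. by rewrite /unitc linearD mulmxDl. Qed.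

Lemma unitcZ (a : R) x : unitc B (a *: x) = a *: unitc B x.
Proof. by rewrite /unitc linearZ -scalemxAl. Qed.

Lemma latper_proj (phi : cyl R n -> R) : latper (fun x => phi (proj B x)).
Proof.
move=> x m; congr phi; apply/proj_eq => //; rewrite !linearD /= ver_mkpt addr0; split => //.
by exists m; rewrite hor_mkpt.
Qed.

Lemma latper_derive P v : latper P -> latper ('D_v P).
Proof.
move=> pP x m; rewrite /derive; apply: (congr1 (fun F : R -> R => lim (F @ 0^'))).
by apply/funext => h /=; rewrite addrA !pP.
Qed.

Lemma latperM P Q : latper P -> latper Q -> latper (fun x => P x * Q x).
Proof. by move=> pP pQ x m; rewrite pP pQ. Qed.

Definition slabper P : Prop := latper P /\ forall x, slab x -> {for x, continuous P}.

Definition pt y (z : R) : W := mkpt (y *m B) z.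

Lemma ptD y y' z : pt (y + y') z = pt y z + mkpt (y' *m B) 0.
Proof.
by apply/mkptP; rewrite linearD /= ?hor_mkpt ?ver_mkpt ?mulmxDl ?addr0.
Qed.

Lemma continuous_pt y z : {for (y, z), continuous (fun yz : 'rV[R]_n * R => pt yz.1 yz.2)}.
Proof.
apply: continuous_mkpt; last exact: cvg_snd.
by apply: (@ct_comp _ _ _ fst (fun y => y *m B)); [exact: cvg_fst|exact: continuous_mulmx].
Qed.

Lemma slice_cper P z : slabper P -> 0 < z < 1 -> cper (fun y => P (pt y z)).
Proof.
move=> [pP cP] z01; split; last by move=> y m; rewrite ptD pP.
move=> y; apply: (@ct_comp _ _ _ (fun y => pt y z) P).
  apply: (@ct_comp _ _ _ (fun y => (y, z)) (fun yz => pt yz.1 yz.2)); last exact: continuous_pt.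
  by apply: ct_pair; [exact: cvg_id|exact: ct_cst].
by apply: cP; rewrite /slab /= ver_mkpt.
Qed.

Definition slmean P z : R := mean (fun y => P (pt y z)).

Lemma slab_basis (z : R) j : 0 < z < 1 -> exists2 d : R, 0 < d &
  forall t : R, `|t| < d -> forall y, slab (t *: basis_vec j + pt y z).
Proof.
move=> /andP[z0 z1]; exists (Num.min z (1 - z)).
  by rewrite lt_min z0 subr_gt0.
move=> t; rewrite lt_min => /andP[t1 t2] y'; rewrite /slab /= linearD linearZ /= ver_mkpt.
have [e|e] : ver (basis_vec j) = 1 :> R \/ ver (basis_vec j) = 0 :> R.
  rewrite /ver mxE eqxx /=; case: eqP => _; [left|right]; by [].
- move: t1 t2; rewrite e mulr1 !ltr_norml => /andP[? ?] /andP[? ?]; lra.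
- by rewrite e mulr0 add0r z0 z1.
Qed.

(* Periodicity and compactness make the difference quotients converge uniformly. *)
Lemma slice_unif_derive P j (z e : R) : slabper P ->
  (forall x, slab x -> derivable P x (basis_vec j)) ->
  (forall x, slab x -> {for x, continuous ('D_(basis_vec j) P)}) ->
  0 < z < 1 -> 0 < e ->
  \forall h \near (0 : R), forall y,
    `|P (h *: basis_vec j + pt y z) - P (pt y z) - h * 'D_(basis_vec j) P (pt y z)| <= e * `|h|.
Proof.
move=> [pP cP] dP cD z01 e0.
set D := 'D_(basis_vec j) P; have pD : latper D by exact: latper_derive.
have [d d0 hd] := slab_basis j z01.
have c1 y : {for (y, 0 : W), continuous (fun ys : 'rV[R]_n * W => D (ys.2 + pt ys.1 z))}.
  apply: (@ct_comp _ _ _ (fun ys : 'rV[R]_n * W => ys.2 + pt ys.1 z) D).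
    apply: ctD; first exact: cvg_snd.
    apply: (@ct_comp _ _ _ (fun ys : 'rV[R]_n * W => (ys.1, z)) (fun yz => pt yz.1 yz.2)); last exact: continuous_pt.
    by apply: ct_pair; [exact: cvg_fst|exact: ct_cst].
  by apply: cD; rewrite /= add0r /slab /= ver_mkpt.
have p1 s : periodicv (fun y => D (s + pt y z)) by move=> y m; rewrite ptD addrA pD.
have H := periodicv_unif p1 c1 e0.
have cz : (fun h : R => h *: (basis_vec j : W)) @ (0 : R) --> (0 : W).
  by rewrite -[X in _ --> X](scale0r (basis_vec j : W)); apply: cvgZr_tmp; exact: cvg_id.
have /nbhs_ballP [r /= r0 hr] := cz _ H.
have : \forall h \near (0 : R), `|h| < Num.min d r.
  have m0 : 0 < Num.min d r by rewrite lt_min d0 r0.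
  by apply: (near_sub (nbhs0_lt m0)).
move=> K; apply: (near_sub K) => h; rewrite lt_min => /andP[hd' hr'] y.
pose G t := P (t *: basis_vec j + pt y z).
have dG (t : R) : `|t| < d -> is_derive t 1 G (D (t *: basis_vec j + pt y z)).
  move=> td; apply/is_derive_lineP.
  have /is_derive_lineP := derivableP (dP _ (hd t td y)).
  congr (is_derive _ _ _ _); apply/funext => u.
  by rewrite /G scalerDl addrA [u%:A]mulr1.
have [c ch e1] := mvt_near0 dG hd'.
have -> : P (h *: basis_vec j + pt y z) - P (pt y z) = D (c *: basis_vec j + pt y z) * h.
  by rewrite -e1 /G scale0r add0r.
rewrite (mulrC h) -mulrBl normrM ler_wpM2r //.
have cr : ball 0 r c by rewrite /ball /= sub0r normrN (le_lt_trans ch).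
by have := hr c cr y; rewrite add0r => /ltW.
Qed.

Lemma slabper_derive P j : slabper P ->
  (forall x, slab x -> {for x, continuous ('D_(basis_vec j) P)}) ->
  slabper ('D_(basis_vec j) P).
Proof. by move=> [pP cP] cD; split => //; exact: latper_derive. Qed.

(** Differentiation under the mean, justified by the uniform remainder estimate
    [slice_unif_derive]. *)
Lemma slmean_vert P (z : R) : slabper P ->
  (forall x, slab x -> derivable P x (basis_vec ord_max)) ->
  (forall x, slab x -> {for x, continuous ('D_(basis_vec ord_max) P)}) ->
  0 < z < 1 -> is_derive z 1 (slmean P) (slmean ('D_(basis_vec ord_max) P) z).
Proof.
move=> sP dP cD z01; apply: is_derive_eps => e e0.
have H := slice_unif_derive sP dP cD z01 e0.
have [d d0 hd] := slab_basis ord_max z01.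
have : \forall h \near (0 : R), `|h| < d by apply: nbhs0_lt.
move=> K; near=> h.
have hh : forall y, `|P (h *: basis_vec ord_max + pt y z) - P (pt y z) - h * 'D_(basis_vec ord_max) P (pt y z)| <= e * `|h| by near: h.
have E y : h *: basis_vec ord_max + pt y z = pt y (h + z).
  apply/mkptP; rewrite linearD linearZ /= ?hor_mkpt ?ver_mkpt.
    rewrite (_ : hor _ = 0) ?scaler0 ?add0r //.
    by apply/rowP => i; rewrite horE !mxE [lift _ _ == _]eq_sym (negbTE (neq_lift _ _)) andbF.
  by rewrite /ver mxE !eqxx mulr1.
have hz : 0 < h + z < 1.
  have : slab (h *: basis_vec ord_max + pt 0 z) by apply: hd; near: h.
  by rewrite E /slab /= ver_mkpt.
have c1 := slice_cper sP hz; have c2 := slice_cper sP z01.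
have c3 := slice_cper (slabper_derive sP cD) z01.
rewrite /slmean -meanB // -meanZ // -meanB; [|exact: cperB|exact: cperZ].
apply: mean_norm_le; first by apply: cperB; [exact: cperB|exact: cperZ].
by move=> y; have := hh y; rewrite E.
Unshelve. all: by end_near. Qed.

(** A horizontal translation does not change the mean over a slice, so the mean of a horizontal
    derivative is zero. This is the source of integration by parts on the torus. *)
Lemma slmean_hor P (i : 'I_n) (z : R) : slabper P ->
  (forall x, slab x -> derivable P x (basis_vec (lift ord_max i))) ->
  (forall x, slab x -> {for x, continuous ('D_(basis_vec (lift ord_max i)) P)}) ->
  0 < z < 1 -> slmean ('D_(basis_vec (lift ord_max i)) P) z = 0.
Proof.
move=> sP dP cD z01; set v := basis_vec _; apply/eqP; rewrite -normr_le0.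
apply/ler_addgt0Pr => e e0; rewrite add0r.
have H := slice_unif_derive sP dP cD z01 e0.
have c2 := slice_cper sP z01.
have c3 := slice_cper (slabper_derive sP cD) z01.
have /nbhs_ballP [r /= r0 hr] := H.
(* A single nonzero increment suffices: the two means of [P] cancel exactly, and dividing by the
   increment bounds the mean of the derivative by [e]. *)
have hh := hr (r / 2).
have r20 : 0 < r / 2 by rewrite divr_gt0.
have {}hh : forall y, `|P ((r / 2) *: v + pt y z) - P (pt y z) - (r / 2) * 'D_v P (pt y z)| <= e * `|r / 2|.
  apply: hh; rewrite /ball /= sub0r normrN gtr0_norm //.
  by rewrite ltr_pdivrMr // ltr_pMr // ltr1n.
have E y : (r / 2) *: v + pt y z = pt (y + (r / 2) *: unitc B v) z.
  apply/mkptP; rewrite linearD linearZ /= ?hor_mkpt ?ver_mkpt.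
    by rewrite mulmxDl addrC -scalemxAl /unitc mulmxKV.
  rewrite /ver mxE /= (_ : _ == _ = false) ?mulr0 ?add0r //.
  by apply/negbTE; exact: neq_lift.
have c1 : cper (fun y => P ((r / 2) *: v + pt y z)).
  by under eq_fun do rewrite E; exact: (cper_shift _ c2).
have m0 : mean (fun y => P ((r / 2) *: v + pt y z)) = mean (fun y => P (pt y z)).
  by under eq_fun do rewrite E; rewrite (mean_shift _ c2).
have : `|mean (fun y => P ((r / 2) *: v + pt y z) - P (pt y z) - (r / 2) * 'D_v P (pt y z))| <= e * `|r / 2|.
  by apply: mean_norm_le hh; apply: cperB; [exact: cperB|exact: cperZ].
rewrite meanB; [|exact: cperB|exact: cperZ].
rewrite meanB // meanZ // m0 subrr sub0r normrN normrM mulrC ler_pM2r //.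
by rewrite normr_gt0 gt_eqF.
Qed.

End Slices.

(** * Dirichlet eigenfunctions and the spectrum *)

Section DirichletODE.
Context {R : realType}.

Lemma itv_const (F : R -> R) (x0 x1 : R) :
  (forall z, x0 < z < x1 -> is_derive z 1 F 0) ->
  forall z z', x0 < z < x1 -> x0 < z' < x1 -> F z = F z'.
Proof.
move=> dF; suff H z z' : x0 < z -> z < z' -> z' < x1 -> F z = F z'.
  move=> z z' /andP[h1 h2] /andP[h3 h4]; case: (ltgtP z z') => [zz|zz|-> //].
    exact: H.
  by apply/esym/H.
move=> h1 h2 h3; have [||c _] := @MVT R F (fun=> 0) z z' h2.
- move=> t; rewrite in_itv /= => /andP[h4 h5]; apply: dF.
  by rewrite (lt_trans h1) //= (lt_trans h5).
- apply: continuous_in_subspaceT => t /set_mem /=; rewrite in_itv /= => /andP[h4 h5].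
  apply: (@is_derive1_continuous _ _ _ 0); apply: dF.
  by rewrite (lt_le_trans h1) //= (le_lt_trans h5).
by rewrite mul0r => /eqP; rewrite subr_eq0 => /eqP ->.
Qed.

Lemma is_derive_sin_lin (w z : R) : is_derive z 1 (fun t => sin (w * t)) (w * cos (w * z)).
Proof.
have h1 : is_derive z 1 (fun t : R => w * t) w.
  by apply: is_derive_eq; rewrite /GRing.scale /= mulr1 ?mulr0 ?addr0.
have h2 := is_derive_sin (w * z).
by have := is_derive1_comp h2 h1; congr (is_derive _ _ _ _); rewrite mulrC.
Qed.

Lemma is_derive_cos_lin (w z : R) : is_derive z 1 (fun t => cos (w * t)) (- (w * sin (w * z))).
Proof.
have h1 : is_derive z 1 (fun t : R => w * t) w.
  by apply: is_derive_eq; rewrite /GRing.scale /= mulr1 ?mulr0 ?addr0.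
have h2 := is_derive_cos (w * z).
by have := is_derive1_comp h2 h1; congr (is_derive _ _ _ _); rewrite mulNr mulrC.
Qed.

Lemma sin_eq0_nat (w : R) : 0 < w -> sin w = 0 -> exists2 k : nat, (0 < k)%N & w = k%:R * pi.
Proof.
move=> w0 hs; have p0 := @pi_gt0 R.
have : cos (tau * (w / pi)) = 1.
  have -> : tau * (w / pi) = w *+ 2 by rewrite /tau mulrnAl mulrC divfK // gt_eqF.
  rewrite cos_mulr2n; have := cos2Dsin2 w; rewrite hs expr0n addr0 => ->.
  by rewrite mulr2n addrK.
move=> /cos_tau_eq1 [k hk].
have kE : w = k%:~R * pi by rewrite -hk divfK // gt_eqF.
have k0 : (0 < k)%R by move: w0; rewrite kE pmulr_lgt0 // ltr0z.
by exists `|k|%N; [rewrite absz_gt0 gt_eqF|rewrite kE -{1}(gtz0_abs k0)].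
Qed.

Lemma continuous_zero (f : R -> R) (x0 : R) : {for x0, continuous f} ->
  (forall d : R, 0 < d -> exists2 z, `|x0 - z| < d & f z = 0) -> f x0 = 0.
Proof.
move=> cf H; apply/eqP; apply: contraT => fn.
have f0 : 0 < `|f x0| by rewrite normr_gt0.
have h : \forall z \near x0, `|f x0 - f z| < `|f x0| by exact: (cvgr_dist_lt _ _ cf _ f0).
have /nbhs_ballP [d /= d0 hd] := h.
have [z zd fz] := H d d0; have := hd z zd.
by rewrite /= fz subr0 ltxx.
Qed.

Section ODE.
Variables (a a' : R -> R) (mu : R).
Hypothesis da : forall z : R, 0 < z < 1 -> is_derive z 1 a (a' z).
Hypothesis da' : forall z : R, 0 < z < 1 -> is_derive z 1 a' (- mu * a z).
Hypothesis (ca0 : {for (0 : R), continuous a}) (ca1 : {for (1 : R), continuous a}).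
Hypothesis (a0 : a 0 = 0) (a1 : a 1 = 0).

(** The functions [p] and [q] in the proof are the components of [(a, a' / w)] in a frame rotating
    with speed [w], hence constant. Continuity at the end points then turns the boundary values into
    conditions on the amplitudes. *)
Lemma dirichlet_ode_osc (w : R) : 0 < w -> mu = w ^+ 2 ->
  exists c, (forall z, 0 <= z <= 1 -> a z = c * sin (w * z)) /\ c * sin w = 0.
Proof.
move=> w0 muE; have wn : w != 0 by rewrite gt_eqF.
have half : 0 < (2^-1 : R) < 1 by rewrite invr_gt0 ltr0n /= invf_lt1 // ltr1n.
pose p z := a z * cos (w * z) - (a' z / w) * sin (w * z).
pose q z := a z * sin (w * z) + (a' z / w) * cos (w * z).
have dp (z : R) : 0 < z < 1 -> is_derive z 1 p 0.
  move=> hz; have e1 := da hz; have e2 := da' hz.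
  have e3 := is_derive_cos_lin w z; have e4 := is_derive_sin_lin w z.
  by apply: is_derive_eq; rewrite /GRing.scale /= muE; field.
have dq (z : R) : 0 < z < 1 -> is_derive z 1 q 0.
  move=> hz; have e1 := da hz; have e2 := da' hz.
  have e3 := is_derive_cos_lin w z; have e4 := is_derive_sin_lin w z.
  by apply: is_derive_eq; rewrite /GRing.scale /= muE; field.
pose P := p 2^-1; pose Q := q 2^-1.
have aE z : 0 < z < 1 -> a z = P * cos (w * z) + Q * sin (w * z).
  move=> hz; rewrite /P /Q (itv_const dp half hz) (itv_const dq half hz) /p /q.
  by rewrite -[LHS]mulr1 -(cos2Dsin2 (w * z)); field.
have cF : continuous (fun z => P * cos (w * z) + Q * sin (w * z)).
  move=> z.
  have c1 := is_derive1_continuous (is_derive_cos_lin w z).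
  have c2 := is_derive1_continuous (is_derive_sin_lin w z).
  exact: (cvgD (cvgM (cvg_cst P) c1) (cvgM (cvg_cst Q) c2)).
pose f z := a z - (P * cos (w * z) + Q * sin (w * z)).
have f0 : f 0 = 0.
  apply: continuous_zero; first by apply: ctB => //; exact: cF.
  move=> d d0; exists (Num.min d 1 / 2).
    rewrite sub0r normrN gtr0_norm; last by rewrite divr_gt0 // lt_min d0 ltr01.
    rewrite ltr_pdivrMr // (@le_lt_trans _ _ d) ?ge_min ?lexx //.
    by rewrite ltr_pMr // ltr1n.
  rewrite /f aE ?subrr //; apply/andP; split.
    by rewrite divr_gt0 // lt_min d0 ltr01.
  by rewrite ltr_pdivrMr // (@le_lt_trans _ _ 1) ?ge_min ?lexx ?orbT // mul1r ltr1n.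
have f1 : f 1 = 0.
  apply: continuous_zero; first by apply: ctB => //; exact: cF.
  have L (d : R) : 0 < d -> 0 < Num.min d 1 / 2 by move=> d0; rewrite divr_gt0 // lt_min d0 ltr01.
  have L1 (d : R) : Num.min d 1 / 2 < 1.
    by rewrite ltr_pdivrMr // (@le_lt_trans _ _ 1) ?ge_min ?lexx ?orbT // mul1r ltr1n.
  move=> d d0; exists (1 - Num.min d 1 / 2).
    rewrite subKr gtr0_norm ?L //.
    rewrite ltr_pdivrMr // (@le_lt_trans _ _ d) ?ge_min ?lexx //.
    by rewrite ltr_pMr // ltr1n.
  by rewrite /f aE ?subrr //; have := L d d0; have := L1 d; lra.
have P0 : P = 0 by move: f0; rewrite /f a0 mulr0 cos0 sin0; lra.
exists Q; split.
  move=> z /andP[]; rewrite le_eqVlt => /predU1P[<- _|z0].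
    by rewrite a0 mulr0 sin0 mulr0.
  rewrite le_eqVlt => /predU1P[->|z1].
    by move: f1; rewrite /f P0 mulr1; lra.
  by rewrite aE ?z0 // P0 mul0r add0r.
by move: f1; rewrite /f P0 a1 mulr1; lra.
Qed.

(** For [mu <= 0] the function [a * a'] is nondecreasing. If [a z1] were nonzero, the square of [a]
    would first rise from 0 and later fall back to 0, so that [a * a'] would be positive at some [x]
    and negative at a later [y]. *)
Lemma dirichlet_ode_nonosc : mu <= 0 -> forall z, 0 <= z <= 1 -> a z = 0.
Proof.
move=> mu0.
have cont (z : R) : 0 <= z <= 1 -> {for z, continuous a}.
  move=> /andP[]; rewrite le_eqVlt => /predU1P[<- //|z0].
  rewrite le_eqVlt => /predU1P[-> //|z1].
  by apply: (is_derive1_continuous (@da z _)); rewrite z0.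
have csq (x y : R) : 0 <= x -> y <= 1 -> {within `[x, y], continuous (fun z => a z * a z)}.
  move=> x0 y1; apply: continuous_in_subspaceT => z /set_mem /=; rewrite in_itv /= => /andP[h1 h2].
  have cz : {for z, continuous a} by apply: cont; rewrite (le_trans x0) //= (le_trans h2).
  exact: (ctM cz cz).
have dsq (z : R) : 0 < z < 1 -> is_derive z 1 (fun z => a z * a z) (2 * (a z * a' z)).
  by move=> hz; have e1 := da hz; apply: is_derive_eq; rewrite /GRing.scale /=; ring.
have dpr (z : R) : 0 < z < 1 -> is_derive z 1 (fun z => a z * a' z) (a' z ^+ 2 - mu * a z ^+ 2).
  by move=> hz; have e1 := da hz; have e2 := da' hz; apply: is_derive_eq; rewrite /GRing.scale /=; ring.
move=> z1 /andP[]; rewrite le_eqVlt => /predU1P[<- //|z10].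
rewrite le_eqVlt => /predU1P[-> //|z11].
apply/eqP; apply: contraT => az.
have A0 : 0 < a z1 ^+ 2 by rewrite exprn_even_gt0.
have [||x] := @MVT R (fun z => a z * a z) (fun z => 2 * (a z * a' z)) 0 z1 z10.
- by move=> t; rewrite in_itv /= => /andP[h1 h2]; apply: dsq; rewrite h1 (lt_trans h2).
- exact/csq/ltW.
rewrite in_itv /= => /andP[x0 x1]; rewrite a0 mul0r !subr0 -expr2 => e1.
have [||y] := @MVT R (fun z => a z * a z) (fun z => 2 * (a z * a' z)) z1 1 z11.
- by move=> t; rewrite in_itv /= => /andP[h1 h2]; apply: dsq; rewrite h2 (lt_trans z10).
- by apply: csq => //; exact: ltW.
rewrite in_itv /= => /andP[y0 y1]; rewrite a1 mul0r sub0r -expr2 => e2.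
have xy : x < y by apply: lt_trans y0.
have [||t] := @MVT R (fun z => a z * a' z) (fun z => a' z ^+ 2 - mu * a z ^+ 2) x y xy.
- move=> t; rewrite in_itv /= => /andP[h1 h2]; apply: dpr.
  by rewrite (lt_trans x0) //= (lt_trans h2).
- apply: continuous_in_subspaceT => t /set_mem /=; rewrite in_itv /= => /andP[h1 h2].
  apply: (is_derive1_continuous (@dpr t _)).
  by rewrite (lt_le_trans x0) //= (le_lt_trans h2).
move=> _ e3.
have : 0 <= (a' t ^+ 2 - mu * a t ^+ 2) * (y - x).
  apply: mulr_ge0; last by rewrite subr_ge0 ltW.
  by rewrite subr_ge0 (@le_trans _ _ 0) ?sqr_ge0 // mulr_le0_ge0 // sqr_ge0.
rewrite -e3.
have : 0 < a x * a' x.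
  have : 0 < 2 * (a x * a' x) * z1 by rewrite -e1.
  by rewrite pmulr_lgt0 // pmulr_rgt0.
have : a y * a' y < 0.
  have : 2 * (a y * a' y) * (1 - z1) < 0 by rewrite -e2 oppr_lt0.
  by rewrite pmulr_llt0 ?subr_gt0 // pmulr_rlt0.
lra.
Qed.

Theorem dirichlet_ode :
  (forall k : nat, (0 < k)%N -> mu = (k%:R * pi) ^+ 2 ->
    exists c, forall z, 0 <= z <= 1 -> a z = c * sin (k%:R * pi * z)) /\
  ((forall k : nat, (0 < k)%N -> mu <> (k%:R * pi) ^+ 2) -> forall z, 0 <= z <= 1 -> a z = 0).
Proof.
split.
  move=> k k0 muE; have [|c [hc _]] := @dirichlet_ode_osc (k%:R * pi) _ muE.
    by rewrite mulr_gt0 ?ltr0n // pi_gt0.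
  by exists c.
move=> hk; have [mu0|mu0] := lerP mu 0; first exact: dirichlet_ode_nonosc.
have s0 : 0 < Num.sqrt mu by rewrite sqrtr_gt0.
have [|c [hc /eqP]] := dirichlet_ode_osc s0 _; first by rewrite sqr_sqrtr // ltW.
rewrite mulf_eq0 => /orP[/eqP c0 z hz|/eqP]; first by rewrite hc // c0 mul0r.
move=> /(sin_eq0_nat s0) [k k0 e] z; exfalso; apply: (hk k k0).
by rewrite -e sqr_sqrtr // ltW.
Qed.

End ODE.
End DirichletODE.

(** * Fourier coefficients of eigenfunctions *)

Section Eigenfunctions.
Context {R : realType} {n : nat} (B : 'M[R]_n) (uB : B \in unitmx).
Local Notation W := 'rV[R]_n.+1.
Local Notation unitc := (unitc B).
Local Notation slmean := (slmean B).
Local Notation pt := (pt B).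
Implicit Types (x v : W) (m : 'rV[int]_n).

Definition wave m x : R := casm m (unitc x).

(** The coordinates of the dual lattice vector belonging to [m], followed by 0 in the vertical
    direction; [energy m] is the squared length of this vector times [tau ^+ 2]. *)
Definition freq m (j : 'I_n.+1) : R := dotz m (unitc (basis_vec j)).

Definition energy m : R := \sum_j (tau * freq m j) ^+ 2.

Lemma freqN m j : freq (- m) j = - freq m j.
Proof. by rewrite /freq dotzN. Qed.

Lemma hor_basis_max : hor (basis_vec ord_max) = 0 :> 'rV[R]_n.
Proof. by apply/rowP => i; rewrite horE !mxE [lift _ _ == _]eq_sym (negbTE (neq_lift _ _)) andbF. Qed.

Lemma ver_basis j : ver (basis_vec j : W) = (j == ord_max)%:R.
Proof. by rewrite /ver mxE eqxx eq_sym. Qed.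

Lemma freq_max m : freq m ord_max = 0.
Proof.
by rewrite /freq /unitc hor_basis_max mul0mx /dotz big1 // => i _; rewrite mxE mulr0.
Qed.

Lemma wave_pt m y z : wave m (pt y z) = casm m y.
Proof. by rewrite /wave unitc_mkpt. Qed.

Lemma continuous_wave m : continuous (wave m).
Proof.
move=> x; apply: (@ct_comp _ _ _ unitc (casm m)); first exact: continuous_unitc.
exact: (cper_casm m).1.
Qed.

Lemma latper_wave m : latper B (wave m).
Proof.
move=> x m'; rewrite /wave unitcD (_ : unitc (mkpt _ 0) = intv R m') ?(cper_casm m).2 //.
by rewrite unitc_mkpt.
Qed.

Lemma dotzZ m (a : R) y : dotz m (a *: y) = a * dotz m y.
Proof. by rewrite /dotz mulr_sumr; apply: eq_bigr => i _; rewrite mxE mulrCA. Qed.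

Lemma is_derive_affine (a b z : R) : is_derive z 1 (fun t => a * t + b) a.
Proof. by apply: is_derive_eq; rewrite /GRing.scale /= ?mulr1 ?mulr0 ?addr0 ?add0r. Qed.

(** The derivative of [cas] at [t] is [cas (- t)], so differentiation replaces [m] by its opposite;
    two derivatives bring it back. *)
Lemma is_derive_wave m x j : is_derive x (basis_vec j) (wave m) (tau * freq m j * wave (- m) x).
Proof.
apply/is_derive_lineP.
set a := tau * freq m j; set b := tau * dotz m (unitc x).
have h := is_derive_affine a b 0.
have E : (fun t : R => wave m (t *: basis_vec j + x)) = (fun t => cos (a * t + b) + sin (a * t + b)).
  apply/funext => t; rewrite /wave /casm unitcD unitcZ dotzD dotzZ mulrDr mulrCA -/(freq m j).
  by rewrite (mulrC t).
rewrite E.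
have h1 := @is_derive1_comp _ cos (fun t => a * t + b) 0 _ _ (is_derive_cos (a * 0 + b)) h.
have h2 := @is_derive1_comp _ sin (fun t => a * t + b) 0 _ _ (is_derive_sin (a * 0 + b)) h.
have := is_deriveD h1 h2; congr (is_derive _ _ _ _).
rewrite /wave /casm /cas dotzN mulrN cosN sinN mulr0 add0r -/b; ring.
Qed.

Section Coefficients.
Variables (P : W -> R) (m : 'rV[int]_n) (j : 'I_n.+1).
Hypotheses (sP : slabper B P) (dP : forall x, slab x -> derivable P x (basis_vec j))
  (cP : forall x, slab x -> {for x, continuous ('D_(basis_vec j) P)}).

Lemma slabper_wave m' : slabper B (fun x => P x * wave m' x).
Proof.
split; first by apply: latperM; [exact: sP.1|exact: latper_wave].
by move=> x sx; apply: ctM; [exact: sP.2|exact: continuous_wave].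
Qed.

Lemma is_derive_mul_wave x : slab x -> is_derive x (basis_vec j) (fun x => P x * wave m x)
  ('D_(basis_vec j) P x * wave m x + tau * freq m j * (P x * wave (- m) x)).
Proof.
move=> sx; have h1 := derivableP (dP sx); have h2 := is_derive_wave m x j.
have := is_deriveM h1 h2; congr (is_derive _ _ _ _).
rewrite /GRing.scale /=; ring.
Qed.

Lemma derive_mul_wave_cont x : slab x ->
  {for x, continuous ('D_(basis_vec j) (fun x => P x * wave m x))}.
Proof.
move=> sx; apply: (@ct_eq _ _ (fun x => 'D_(basis_vec j) P x * wave m x + tau * freq m j * (P x * wave (- m) x))).
  apply: near_open (@slab_open R n) sx _ => y sy.
  by have [_ ->] := is_derive_mul_wave sy.
apply: ctD; first by apply: ctM; [exact: cP|exact: continuous_wave].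
by apply: ctM; [exact: ct_cst|apply: ctM; [exact: sP.2|exact: continuous_wave]].
Qed.

Lemma slmean_derive_mul_wave z : 0 < z < 1 ->
  slmean ('D_(basis_vec j) (fun x => P x * wave m x)) z =
  slmean (fun x => 'D_(basis_vec j) P x * wave m x) z +
    tau * freq m j * slmean (fun x => P x * wave (- m) x) z.
Proof.
move=> z01; have sD := slabper_derive sP cP.
have c1 : cper (fun y => 'D_(basis_vec j) P (pt y z) * wave m (pt y z)).
  apply: (slice_cper (P := fun x => 'D_(basis_vec j) P x * wave m x)) => //.
  split; first by apply: latperM; [exact: sD.1|exact: latper_wave].
  by move=> x sx; apply: ctM; [exact: sD.2|exact: continuous_wave].
have c2 := slice_cper (slabper_wave (- m)) z01.
rewrite /slmean -meanZ // -meanD //; last exact: cperZ.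
congr mean; apply/funext => y.
have sy : slab (pt y z) by rewrite /slab /= ver_mkpt.
by have [_ ->] := is_derive_mul_wave sy.
Qed.

End Coefficients.

Lemma slmean_parts P m j (z : R) : slabper B P ->
  (forall x, slab x -> derivable P x (basis_vec (lift ord_max j))) ->
  (forall x, slab x -> {for x, continuous ('D_(basis_vec (lift ord_max j)) P)}) ->
  0 < z < 1 ->
  slmean (fun x => 'D_(basis_vec (lift ord_max j)) P x * wave m x) z =
  - (tau * freq m (lift ord_max j)) * slmean (fun x => P x * wave (- m) x) z.
Proof.
move=> sP d1 c1 z01.
have e1 := slmean_derive_mul_wave m sP d1 c1 z01.
have d1' x : slab x -> derivable (fun x => P x * wave m x) x (basis_vec (lift ord_max j)).
  by move=> sx; have [] := is_derive_mul_wave m d1 sx.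
have c1' x : slab x -> {for x, continuous ('D_(basis_vec (lift ord_max j)) (fun x => P x * wave m x))}.
  by move=> sx; exact: derive_mul_wave_cont.
have e2 := slmean_hor uB (slabper_wave sP m) d1' c1' z01.
by rewrite e2 in e1; apply/eqP; rewrite mulNr -addr_eq0 -e1.
Qed.

Lemma slmean_laplace P m j (z : R) : slabper B P ->
  (forall x, slab x -> derivable P x (basis_vec (lift ord_max j))) ->
  (forall x, slab x -> {for x, continuous ('D_(basis_vec (lift ord_max j)) P)}) ->
  (forall x, slab x -> derivable ('D_(basis_vec (lift ord_max j)) P) x (basis_vec (lift ord_max j))) ->
  (forall x, slab x -> {for x, continuous ('D_(basis_vec (lift ord_max j)) ('D_(basis_vec (lift ord_max j)) P))}) ->
  0 < z < 1 ->
  slmean (fun x => 'D_(basis_vec (lift ord_max j)) ('D_(basis_vec (lift ord_max j)) P) x * wave m x) z =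
  - (tau * freq m (lift ord_max j)) ^+ 2 * slmean (fun x => P x * wave m x) z.
Proof.
move=> sP d1 c1 d2 c2 z01.
rewrite (slmean_parts m (slabper_derive sP c1) d2 c2 z01) (slmean_parts (- m) sP d1 c1 z01).
by rewrite opprK freqN mulrN opprK mulrA mulNr -expr2.
Qed.

Lemma continuous_slmean P : latper B P -> continuous P -> continuous (slmean P).
Proof.
move=> pP cP z0; apply/cvgrPdist_le => e e0.
have c1 (y : 'rV[R]_n) : {for (y, z0), continuous (fun yz : 'rV[R]_n * R => P (pt yz.1 yz.2))}.
  by apply: (@ct_comp _ _ _ (fun yz : 'rV[R]_n * R => pt yz.1 yz.2) P); [exact: continuous_pt|exact: cP].
have p1 s : periodicv (fun y => P (pt y s)) by move=> y m; rewrite ptD pP.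
have cp s : cper (fun y => P (pt y s)).
  split; last exact: p1.
  move=> y; apply: (@ct_comp _ _ _ (fun y => pt y s) P); last exact: cP.
  apply: (@ct_comp _ _ _ (fun y => (y, s)) (fun yz => pt yz.1 yz.2)); last exact: continuous_pt.
  by apply: ct_pair; [exact: cvg_id|exact: ct_cst].
have H := periodicv_unif p1 c1 e0.
apply: (near_sub H) => z hz; rewrite /slmean -meanB //.
apply: mean_norm_le; first exact: cperB.
by move=> y; rewrite distrC ltW.
Qed.

Lemma tauN0 : (tau : R) != 0. Proof. by rewrite gt_eqF // tau_gt0. Qed.

Variables (mu : {measure set (borel (cyl R n)) -> \bar R}).
Hypothesis mu_box : forall c (a b : 'rV[R]_n.+1), fatlas B c ->
  (forall i, a 0 i <= b 0 i) -> box a b `<=` cod c ->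
  mu (bwd c @` box a b) = (\prod_i (b 0 i - a 0 i))%:E.
Hypothesis mu_boundary : mu (~` atlas_interior (fatlas B)) = 0%E.
Local Notation M := (cylM uB mu_box mu_boundary).

Lemma cpt_proj (y : 'rV[R]_n) z : proj B (pt y z) = cpt y z.
Proof. exact: proj_mkpt. Qed.

Section Analysis.
Variables (phi : M -> R) (lam : R).
Hypothesis hphi : dirichlet_eigenspace lam phi.
Let P x := phi (proj B x).

Lemma eig_continuous : continuous P.
Proof.
have [cphi _ _ _] := hphi.
by move=> x; apply: (ct_comp (@continuous_proj _ _ B x)); exact: cphi.
Qed.

Lemma eig_latper : latper B P.
Proof. exact: latper_proj. Qed.

Lemma eig_slabper : slabper B P.
Proof. by split; [exact: eig_latper|move=> x _; exact: eig_continuous]. Qed.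

Lemma eig_C2 : Ck_on 2 slab P.
Proof. by have [_ c2 _ _] := hphi; exact: (C2_interior_elim c2). Qed.

Lemma eig_d1 i x : slab x -> derivable P x (basis_vec i).
Proof. by have [_ /(_ i) [h _]] := eig_C2; exact: h. Qed.

Lemma eig_c1 i x : slab x -> {for x, continuous ('D_(basis_vec i) P)}.
Proof. by move=> sx; have [_ /(_ i) [_ [h _]]] := eig_C2; apply: h; rewrite inE. Qed.

Lemma eig_d2 i x : slab x -> derivable ('D_(basis_vec i) P) x (basis_vec i).
Proof. by have [_ /(_ i) [_ [_ /(_ i) [h _]]]] := eig_C2; exact: h. Qed.

Lemma eig_c2 i x : slab x -> {for x, continuous ('D_(basis_vec i) ('D_(basis_vec i) P))}.
Proof. by move=> sx; have [_ /(_ i) [_ [_ /(_ i) [_ h]]]] := eig_C2; apply: h; rewrite inE. Qed.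

Definition coeff m z : R := slmean (fun x => P x * wave m x) z.

(** Separation of variables: projecting the eigenvalue equation onto [wave m] leaves an ordinary
    differential equation in the height, with the horizontal part of the Laplacian reduced to the
    number [energy m]. *)
Lemma coeff_ode m :
  let a' := slmean (fun x => 'D_(basis_vec ord_max) P x * wave m x) in
  (forall z : R, 0 < z < 1 -> is_derive z 1 (coeff m) (a' z)) /\
  (forall z : R, 0 < z < 1 -> is_derive z 1 a' (- (lam - energy m) * coeff m z)).
Proof.
move=> a'.
have sD := slabper_derive eig_slabper (@eig_c1 ord_max).
split=> z z01.
  have := @slmean_vert _ _ B (fun x => P x * wave m x) z (slabper_wave eig_slabper m) _ _ z01.
  move=> H; have {H} := H (fun x sx => let: DeriveDef d _ := is_derive_mul_wave m (@eig_d1 ord_max) sx in d)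
    (fun x sx => derive_mul_wave_cont eig_slabper (@eig_d1 ord_max) (@eig_c1 ord_max) sx).
  rewrite (slmean_derive_mul_wave m eig_slabper (@eig_d1 ord_max) (@eig_c1 ord_max) z01).
  by rewrite freq_max mulr0 mul0r addr0.
have := @slmean_vert _ _ B (fun x => 'D_(basis_vec ord_max) P x * wave m x) z (slabper_wave sD m) _ _ z01.
move=> H; have {H} := H (fun x sx => let: DeriveDef d _ := is_derive_mul_wave m (@eig_d2 ord_max) sx in d)
    (fun x sx => derive_mul_wave_cont sD (@eig_d2 ord_max) (@eig_c2 ord_max) sx).
rewrite (slmean_derive_mul_wave m sD (@eig_d2 ord_max) (@eig_c2 ord_max) z01).
rewrite freq_max mulr0 mul0r addr0; congr (is_derive _ _ _ _).
have [_ _ lapM _] := hphi.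
have lap x : slab x -> \sum_i 'D_(basis_vec i) ('D_(basis_vec i) P) x = - (lam * P x).
  by move=> sx; have := laplacianM_elim lapM sx; rewrite laplacianE -/P => <-; rewrite opprK.
have sDD i := slabper_derive (slabper_derive eig_slabper (@eig_c1 i)) (@eig_c2 i).
have cDD i := slice_cper (slabper_wave (sDD i) m) z01.
have cP := slice_cper (slabper_wave eig_slabper m) z01.
have sumE : \sum_i slmean (fun x => 'D_(basis_vec i) ('D_(basis_vec i) P) x * wave m x) z = - lam * coeff m z.
  rewrite /coeff /slmean -meanZ //.
  have [_ <-] := mean_sum (index_enum 'I_n.+1) cDD.
  congr mean; apply/funext => y.
  have sy : slab (pt y z) by rewrite /slab /= ver_mkpt.
  rewrite -mulr_suml lap //; ring.
rewrite big_ord_recr /= in sumE.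
(* The horizontal summands are evaluated by two integrations by parts; the remaining summand of
   [sumE] is the vertical second derivative of the coefficient. *)
have e2 : \sum_(i < n) slmean (fun x => 'D_(basis_vec (widen_ord (leqnSn n) i)) ('D_(basis_vec (widen_ord (leqnSn n) i)) P) x * wave m x) z
  = - energy m * coeff m z.
  rewrite /energy big_ord_recr /= freq_max mulr0 expr0n addr0 -sumrN mulr_suml.
  apply: eq_bigr => i _.
  have -> : widen_ord (leqnSn n) i = lift ord_max i.
    by apply: ord_inj; rewrite lift_max.
  rewrite (slmean_laplace m eig_slabper) //.
  - exact: eig_d1.
  - exact: eig_c1.
  - exact: eig_d2.
  - exact: eig_c2.
by move: sumE; rewrite e2 => e3; lra.
Qed.

Lemma coeff_bd m z : z = 0 \/ z = 1 -> coeff m z = 0.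
Proof.
move=> hz; rewrite /coeff /slmean -[RHS](mean_cst (n := n)); congr mean.
apply/funext => y; have [_ _ _ bd] := hphi.
rewrite /P cpt_proj bd ?mul0r //; apply/boundaryME; rewrite cht_cpt.
by case: hz => ->; [left|right]; rewrite clampE // ?lexx ?ler01.
Qed.

Lemma continuous_coeff m : continuous (coeff m).
Proof.
apply: continuous_slmean; first by apply: latperM; [exact: eig_latper|exact: latper_wave].
by move=> x; apply: ctM; [exact: eig_continuous|exact: continuous_wave].
Qed.

Lemma coeffP m :
  (forall k : nat, (0 < k)%N -> lam = energy m + (k%:R * pi) ^+ 2 ->
    exists c, forall z, 0 <= z <= 1 -> coeff m z = c * sin (k%:R * pi * z)) /\
  ((forall k : nat, (0 < k)%N -> lam <> energy m + (k%:R * pi) ^+ 2) ->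
    forall z, 0 <= z <= 1 -> coeff m z = 0).
Proof.
have [h1 h2] := coeff_ode m.
have [k1 k2] := dirichlet_ode h1 h2 (@continuous_coeff m _) (@continuous_coeff m _)
  (coeff_bd m (or_introl erefl)) (coeff_bd m (or_intror erefl)).
split=> [k k0 e|hk]; first by apply: (k1 k k0); rewrite e addrC addKr.
by apply: k2 => k k0 e; apply: (hk k k0); rewrite -e addrC subrK.
Qed.

End Analysis.
End Eigenfunctions.

(** * Product eigenfunctions and dimensions of eigenspaces *)

Section Modes.
Context {R : realType} {n : nat}.
Implicit Types (m : 'rV[int]_n) (p : cyl R n).

Definition yrep p : 'rV[R]_n := xget 0 [set y | p = cpt y (cht p)].

Lemma yrepP p : p = cpt (yrep p) (cht p).
Proof.
rewrite /yrep; case: xgetP => [y -> //|H]; exfalso.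
have [y [z [z01 E]]] := cpt_surj p.
by apply: (H y); rewrite /= {1}E {1}E cht_cpt clampE.
Qed.

Definition modefun m (k : nat) p : R := casm m (yrep p) * sin (k%:R * pi * cht p).

Lemma modefunE m k y z : modefun m k (cpt y z) = casm m y * sin (k%:R * pi * clamp z).
Proof.
rewrite /modefun cht_cpt; congr (_ * _).
have := yrepP (cpt y z); rewrite cht_cpt; move: (yrep _) => y' /cpt_eq [_ [m' ->]].
by rewrite (cper_casm m).2.
Qed.

Lemma continuous_modefun m k : continuous (modefun m k).
Proof.
apply: cyl_continuous_intro => y z _.
rewrite (_ : (fun yz => _) = fun yz : 'rV[R]_n * R => casm m yz.1 * sin (k%:R * pi * clamp yz.2)); last first.
  by apply/funext => -[y' z']; rewrite modefunE.
apply: ctM; first by apply: (ct_comp (f := fst) (g := casm m)); [exact: cvg_fst|exact: (cper_casm m).1].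
apply: (@ct_comp _ _ _ (fun yz : 'rV[R]_n * R => k%:R * pi * clamp yz.2) sin); last exact: continuous_sin.
apply: ctM; first exact: ct_cst.
by apply: (@ct_comp _ _ _ snd (@clamp R)); [exact: cvg_snd|exact: continuous_clamp].
Qed.

Lemma sin_npi (k : nat) : sin (k%:R * pi) = 0 :> R.
Proof.
elim: k => [|k IH]; first by rewrite mul0r sin0.
by rewrite -addn1 natrD mulrDl mul1r sinDpi IH oppr0.
Qed.

Lemma modefun_cper m k z : cper (fun y => modefun m k (cpt y z)).
Proof.
under eq_fun do rewrite modefunE mulrC; exact: cperZ (cper_casm m).
Qed.

Lemma mean_modefun m m' k z :
  mean (fun y => modefun m k (cpt y z) * casm m' y) = (m == m')%:R * sin (k%:R * pi * clamp z).
Proof.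
rewrite -mean_casm mulrC -meanZ; last by apply: cperM; exact: cper_casm.
by congr mean; apply/funext => y; rewrite modefunE mulrAC mulrC mulrA.
Qed.

End Modes.

Section EigenBasis.
Context {R : realType} {n : nat} (B : 'M[R]_n) (uB : B \in unitmx).
Local Notation W := 'rV[R]_n.+1.
Local Notation wave := (wave B).
Local Notation freq := (freq B).
Local Notation energy := (energy B).
Implicit Types (x v : W).

Variables (m : 'rV[int]_n) (k : nat) (s : R).
Let w : R := k%:R * pi.
Let c j : R := tau * freq m j.
Let d (j : 'I_n.+1) : R := w * (j == ord_max)%:R.
Let S x : R := sin (w * ver x).
Let C x : R := cos (w * ver x).

Lemma is_derive_S x j : is_derive x (basis_vec j) S (d j * C x).
Proof.
apply/is_derive_lineP; set a := d j; set b := w * ver x.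
have E : (fun t : R => S (t *: basis_vec j + x)) = (fun t => sin (a * t + b)).
  apply/funext => t; rewrite /S linearD linearZ /= ver_basis mulrDr mulrCA.
  by rewrite (mulrC t).
rewrite E.
have := @is_derive1_comp _ sin (fun t => a * t + b) 0 _ _ (is_derive_sin (a * 0 + b)) (is_derive_affine a b 0).
by congr (is_derive _ _ _ _); rewrite mulr0 add0r mulrC.
Qed.

Lemma is_derive_C x j : is_derive x (basis_vec j) C (- (d j * S x)).
Proof.
apply/is_derive_lineP; set a := d j; set b := w * ver x.
have E : (fun t : R => C (t *: basis_vec j + x)) = (fun t => cos (a * t + b)).
  apply/funext => t; rewrite /C linearD linearZ /= ver_basis mulrDr mulrCA.
  by rewrite (mulrC t).
rewrite E.
have := @is_derive1_comp _ cos (fun t => a * t + b) 0 _ _ (is_derive_cos (a * 0 + b)) (is_derive_affine a b 0).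
by congr (is_derive _ _ _ _); rewrite mulr0 add0r mulNr mulrC.
Qed.

Lemma continuous_S : continuous S.
Proof.
move=> x; apply: (@ct_comp _ _ _ (fun x : W => w * ver x) sin); last exact: continuous_sin.
by apply: ctM; [exact: ct_cst|exact: continuous_ver].
Qed.

Lemma continuous_C : continuous C.
Proof.
move=> x; apply: (@ct_comp _ _ _ (fun x : W => w * ver x) cos); last exact: continuous_cos.
by apply: ctM; [exact: ct_cst|exact: continuous_ver].
Qed.

Lemma cont_comb (t a b : R) (u v : W -> R) (x : W) : {for x, continuous u} -> {for x, continuous v} ->
  {for x, continuous (fun x => t * (a * u x + b * v x))}.
Proof.
move=> cu cv.
exact: (cvgM (cvg_cst t) (cvgD (cvgM (cvg_cst a) cu) (cvgM (cvg_cst b) cv))).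
Qed.

Lemma mode_C2 (f : W -> R) : (forall x, slab x -> f x = s * (wave m x * S x)) ->
  Ck_on 2 slab f /\ forall x, slab x -> laplacian f x = (energy m + w ^+ 2) * f x.
Proof.
move=> fE.
pose df i x := s * (c i * (wave (- m) x * S x) + d i * (wave m x * C x)).
pose ddf i j x := s * (c i * (- (c j * (wave m x * S x)) + d j * (wave (- m) x * C x)) +
                       d i * (c j * (wave (- m) x * C x) - d j * (wave m x * S x))).
have cw m' := @continuous_wave R n B m'; have cS := continuous_S; have cC := continuous_C.
have h0 x i : is_derive x (basis_vec i) (fun x => s * (wave m x * S x)) (df i x).
  have e1 := is_derive_wave B m x i; have e2 := is_derive_S x i.
  have := is_deriveZ s (is_deriveM e1 e2); congr (is_derive _ _ _ _).
  by rewrite /df /c /d /GRing.scale /=; ring.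
have h1 x i j : is_derive x (basis_vec j) (df i) (ddf i j x).
  have e1 := is_derive_wave B m x j; have e2 := is_derive_S x j.
  have e3 := is_derive_wave B (- m) x j; have e4 := is_derive_C x j.
  have := is_deriveZ s (is_deriveD (is_deriveZ (c i) (is_deriveM e3 e2)) (is_deriveZ (d i) (is_deriveM e1 e4))).
  congr (is_derive _ _ _ _).
  by rewrite /ddf /c opprK freqN /GRing.scale /=; ring.
have H1 : {in slab, continuous f}.
  move=> x; rewrite inE => sx; apply: (@ct_eq _ _ (fun x => s * (wave m x * S x))).
    by apply: near_open (@slab_open R n) sx _ => y sy; rewrite fE.
  by apply: ctM; [exact: ct_cst|apply: ctM; [exact: cw|exact: cS]].
have cWS m' x : {for x, continuous (fun x => wave m' x * S x)} by exact: (ctM (@cw m' x) (@cS x)).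
have cWC m' x : {for x, continuous (fun x => wave m' x * C x)} by exact: (ctM (@cw m' x) (@cC x)).
have H2 i : {in slab, continuous (df i)}.
  suff H (x : W) : {for x, continuous (df i)} by move=> x _; exact: H.
  exact: (@cont_comb s (c i) (d i) _ _ x (@cWS (- m) x) (@cWC m x)).
have H3 i j : {in slab, continuous (ddf i j)}.
  suff H (x : W) : {for x, continuous (ddf i j)} by move=> x _; exact: H.
  apply: (@cont_comb s (c i) (d i) (fun x => - (c j * (wave m x * S x)) + d j * (wave (- m) x * C x)) (fun x => c j * (wave (- m) x * C x) - d j * (wave m x * S x)) x).
    exact: (cvgD (cvgN (cvgM (cvg_cst (c j)) (@cWS m x))) (cvgM (cvg_cst (d j)) (@cWC (- m) x))).
  exact: (cvgB (cvgM (cvg_cst (c j)) (@cWC (- m) x)) (cvgM (cvg_cst (d j)) (@cWS m x))).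
have H4 i x : slab x -> is_derive x (basis_vec i) f (df i x).
  move=> sx; apply: near_eq_is_derive (h0 x i).
  by apply: near_open (@slab_open R n) sx _ => y sy; rewrite fE.
have H5 i j x : slab x -> is_derive x (basis_vec j) (df i) (ddf i j x).
  by move=> _; exact: h1.
have [h2 h3] := C2_intro (@slab_open R n) H1 H2 H3 H4 H5.
split => // x sx; rewrite h3 // fE //.
have E i : ddf i i x = - ((c i) ^+ 2 + (d i) ^+ 2) * (s * (wave m x * S x)).
  (* The wave has no vertical frequency and the sine factor no horizontal one, so the mixed terms of
     the second derivative vanish. *)
  have cd : c i * d i = 0.
    by rewrite /c /d; case: eqVneq => [->|_]; rewrite ?freq_max ?mulr0 ?mul0r.
  rewrite /ddf.
  transitivity (- (c i ^+ 2 + d i ^+ 2) * (s * (wave m x * S x)) + (c i * d i) * (2 * s * (wave (- m) x * C x))).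
    by ring.
  by rewrite cd mul0r addr0.
under eq_bigr do rewrite E.
rewrite -mulr_suml sumrN mulNr opprK; congr (_ * _).
rewrite big_split /=; congr (_ + _).
rewrite (bigD1 ord_max) //= /d eqxx mulr1 big1 ?addr0 // => i /negbTE ->.
by rewrite mulr0 expr0n.
Qed.

End EigenBasis.

Section Dimension.
Context {R : realType} {n : nat} (B : 'M[R]_n) (uB : B \in unitmx).
Variables (mu : {measure set (borel (cyl R n)) -> \bar R}).
Hypothesis mu_box : forall c (a b : 'rV[R]_n.+1), fatlas B c ->
  (forall i, a 0 i <= b 0 i) -> box a b `<=` cod c ->
  mu (bwd c @` box a b) = (\prod_i (b 0 i - a 0 i))%:E.
Hypothesis mu_boundary : mu (~` atlas_interior (fatlas B)) = 0%E.
Local Notation M := (cylM uB mu_box mu_boundary).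
Implicit Types (m : 'rV[int]_n).

(** The index [k] stands for the vertical mode [k.+1], so that all pairs of an integer vector and a
    natural number occur exactly once. *)
Definition modeval (mk : 'rV[int]_n * nat) : R := energy B mk.1 + (mk.2.+1%:R * pi) ^+ 2.

Lemma modefun_eig m k :
  dirichlet_eigenspace (modeval (m, k)) (modefun m k.+1 : M -> R).
Proof.
have [|h1 h2] := @C2_laplacian_intro _ _ _ uB _ mu_box mu_boundary (modefun m k.+1)
  (fun p => modeval (m, k) * modefun m k.+1 p).
  move=> b.
  (* As [sin (k.+1%:R * pi) = 0], replacing [z] by [1 - z] multiplies the vertical factor by this
     constant. *)
  pose s : R := if b then - cos (k.+1%:R * pi) else 1.
  have E x : slab x -> modefun m k.+1 (proj B (flipb b x)) = s * (wave B m x * sin (k.+1%:R * pi * ver x)).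
    move=> /andP[/ltW x0 /ltW x1].
    rewrite modefunE /unitc hor_flipb -/(unitc B x) -/(wave B m x) ver_flipb /s; clear s; case: b.
      rewrite clampE; last by lra.
      by rewrite mulrBr mulr1 sinB sin_npi mul0r sub0r; ring.
    by rewrite clampE ?x0 // mul1r.
  have [c1 c2] := mode_C2 E; split => //.
split => //; first exact: continuous_modefun.
move=> p /boundaryME; rewrite /modefun => -[] ->.
  by rewrite mulr0 sin0 mulr0.
by rewrite mulr1 sin_npi mulr0.
Qed.

Lemma modeval_inj m k k' : modeval (m, k) = modeval (m, k') -> k = k'.
Proof.
rewrite /modeval /= => /addrI /eqP.
rewrite eqrXn2 ?mulr_ge0 ?ler0n ?pi_ge0 // => /eqP /(mulIf (lt0r_neq0 (@pi_gt0 R))) /eqP.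
by rewrite eqr_nat => /eqP [].
Qed.

(** The modes listed in [L] form a basis. Independence is tested on one well-chosen slice per mode.
    For spanning, [coeffP] fixes the Fourier coefficients on every slice, and [casm_unique] recovers
    the function from them. *)
Theorem eigenspace_dim lam (L : seq ('rV[int]_n * nat)) : uniq L ->
  (forall mk, mk \in L <-> modeval mk = lam) ->
  has_dim (dirichlet_eigenspace (M := M) lam) (size L).
Proof.
move=> uL hL.
pose N := size L.
pose mk (j : 'I_N) := nth (0, 0%N) L j.
have mkL j : modeval (mk j) = lam by apply/hL/mem_nth.
have mk_inj : injective mk.
  by move=> i j /eqP; rewrite nth_uniq // => /eqP /val_inj.
(* For a given eigenvalue the horizontal frequency determines the vertical mode, so distinct modes
   of [L] have distinct, hence orthogonal, horizontal parts. *)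
have mk1_inj i j : ((mk i).1 == (mk j).1) = (i == j).
  apply/eqP/eqP => [e|-> //]; apply: mk_inj.
  have := mkL i; rewrite -(mkL j); move: e.
  case: (mk i) (mk j) => [m k] [m' k'] /= -> /modeval_inj ->; by [].
exists (fun j => modefun (mk j).1 (mk j).2.+1); split.
- by move=> j; rewrite -(mkL j); case: (mk j) => m k; exact: modefun_eig.
- move=> a ha i.
  (* At this height the vertical factor of mode [i] is [sin (pi / 2) = 1]. *)
  pose ki := (mk i).2.+1; pose z : R := (2 * ki%:R)^-1.
  have kgt : 0 < ki%:R :> R by rewrite ltr0n.
  have z01 : 0 <= z <= 1.
    rewrite invr_ge0 mulr_ge0 ?ler0n //= invf_le1 ?mulr_gt0 //.
    by rewrite -natrM ler1n muln_gt0.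
  have cm j : cper (fun y => a j * (modefun (mk j).1 (mk j).2.+1 (cpt y z : cyl R n) * casm (mk i).1 y)).
    by apply: cperZ; apply: cperM; [exact: modefun_cper|exact: cper_casm].
  have [_ e] := mean_sum (index_enum 'I_N) cm.
  have : mean (fun y => \sum_j a j * (modefun (mk j).1 (mk j).2.+1 (cpt y z : cyl R n) * casm (mk i).1 y)) = 0.
    rewrite -[RHS](mean_cst (n := n)); congr mean; apply/funext => y.
    have := ha (cpt y z) => e1.
    by under eq_bigr do rewrite mulrA; rewrite -mulr_suml e1 mul0r.
  rewrite e (bigD1 i) //= big1 => [|j ji].
    rewrite addr0 meanZ; last by apply: cperM; [exact: modefun_cper|exact: cper_casm].
    rewrite mean_modefun eqxx mul1r clampE //.
    have -> : (mk i).2.+1%:R * pi * z = pi / 2 :> R.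
      by rewrite /z -/ki; field; rewrite gt_eqF.
    by rewrite sin_pihalf mulr1.
  rewrite meanZ; last by apply: cperM; [exact: modefun_cper|exact: cper_casm].
  by rewrite mean_modefun mk1_inj (negbTE ji) mul0r mulr0.
- move=> phi hphi.
  have cE m z : coeff phi m z = mean (fun y => phi (cpt y z) * casm m y).
    by rewrite /coeff /slmean; congr mean; apply/funext => y; rewrite cpt_proj // wave_pt.
  have H j : exists a : R, forall z, 0 <= z <= 1 -> coeff phi (mk j).1 z = a * sin ((mk j).2.+1%:R * pi * z).
    have [h1 _] := coeffP hphi (mk j).1; apply: h1 => //.
    by rewrite -(mkL j); case: (mk j).
  have [a ha] := choice H.
  exists a => p.
  have [y0 [z [z01 ->]]] := cpt_surj p.
  have cphi : cper (fun y => phi (cpt y z)).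
    split; last by move=> y m; congr phi; apply/cpt_eq; split => //; exists m.
    have [c1 _ _ _] := hphi.
    move=> y; apply: (@ct_comp _ _ _ (fun y => cpt y z) phi); last exact: c1.
    by apply: (@continuous_cpt _ _ _ id (fun=> z)); [exact: cvg_id|exact: ct_cst].
  have cj j : cper (fun y => a j * modefun (mk j).1 (mk j).2.+1 (cpt y z : cyl R n)).
    by apply: cperZ; exact: modefun_cper.
  have [cs _] := mean_sum (index_enum 'I_N) cj.
  (* The error on the slice through the given point; all its Fourier coefficients are shown to
     vanish, first for frequencies occurring in [L], then for the others. *)
  pose f y := phi (cpt y z) - \sum_j a j * modefun (mk j).1 (mk j).2.+1 (cpt y z : cyl R n).
  suff : f y0 = 0 by move/eqP; rewrite subr_eq0 => /eqP.
  apply: casm_unique; first exact: cperB.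
  move=> m; rewrite /f.
  have cjm j : cper (fun y => a j * (modefun (mk j).1 (mk j).2.+1 (cpt y z : cyl R n) * casm m y)).
    by apply: cperZ; apply: cperM; [exact: modefun_cper|exact: cper_casm].
  have [csm esm] := mean_sum (index_enum 'I_N) cjm.
  have -> : mean (fun y => (phi (cpt y z) - \sum_j a j * modefun (mk j).1 (mk j).2.+1 (cpt y z : cyl R n)) * casm m y) =
      mean (fun y => phi (cpt y z) * casm m y - \sum_j a j * (modefun (mk j).1 (mk j).2.+1 (cpt y z : cyl R n) * casm m y)).
    congr mean; apply/funext => y; rewrite mulrBl; congr (_ - _).
    by rewrite mulr_suml; apply: eq_bigr => j _; rewrite mulrA.
  rewrite meanB //; last by apply: cperM => //; exact: cper_casm.
  rewrite esm -cE.
  have [[j hj]|nj] := pselect (exists j, (mk j).1 = m).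
    rewrite (bigD1 j) //= big1 ?addr0 => [|i ij].
      rewrite -hj ha // meanZ; last by apply: cperM; [exact: modefun_cper|exact: cper_casm].
      by rewrite mean_modefun eqxx mul1r clampE // subrr.
    rewrite meanZ; last by apply: cperM; [exact: modefun_cper|exact: cper_casm].
    by rewrite mean_modefun -hj mk1_inj (negbTE ij) mul0r mulr0.
  rewrite big1 ?subr0 => [|j _].
    (* [coeffP] counts vertical modes from 1 and [L] from 0: a resonance at mode [k.+1] would put
       [(m, k)] into [L]. *)
    have [_ h2] := coeffP hphi m; apply: h2 => // -[//|k] _ e; apply: nj.
    have : (m, k) \in L by apply/hL; rewrite /modeval /= e.
    move=> mL; have ij : (index (m, k) L < N)%N by rewrite index_mem.
    by exists (Ordinal ij); rewrite /mk /= nth_index.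
  rewrite meanZ; last by apply: cperM; [exact: modefun_cper|exact: cper_casm].
  rewrite mean_modefun; case: eqP => [e|_]; last by rewrite mul0r mulr0.
  by exfalso; apply: nj; exists j.
Qed.

End Dimension.

(** * Enumeration in nondecreasing order under finite sublevel sets *)

Section SortedEnumeration.
Context {R : realType} {T : choiceType} (f : T -> R) (t0 : T).
Hypothesis finite_sublevel : forall c, exists L : seq T, forall t, f t <= c -> t \in L.
Hypothesis infinite_T : forall L : seq T, exists t, t \notin L.

Lemma argmin_notin (L : seq T) :
  exists t, t \notin L /\ forall t', t' \notin L -> f t <= f t'.
Proof.
have [t1 ht1] := infinite_T L; have [L1 hL1] := finite_sublevel (f t1).
pose C := [seq t <- L1 | t \notin L].
have t1C : t1 \in C by rewrite mem_filter ht1 hL1.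
have [i /= _ hi] : exists2 i : 'I_(size C), true & forall j : 'I_(size C), f (nth t1 C i) <= f (nth t1 C j).
  have h : (index t1 C < size C)%N by rewrite index_mem.
  by case: (@arg_minP _ _ _ (Ordinal h) xpredT (fun i : 'I_(size C) => f (nth t1 C i)) isT) => i _ hi; exists i => // j; exact: hi.
have iC : nth t1 C i \in C by exact: mem_nth.
exists (nth t1 C i); split; first by move: iC; rewrite mem_filter => /andP[].
have h2 t : t \in C -> f (nth t1 C i) <= f t.
  move=> tC; have h : (index t C < size C)%N by rewrite index_mem.
  by have := hi (Ordinal h); rewrite /= nth_index.
move=> t' ht'; have [h|/ltW h] := lerP (f t') (f t1); last by apply: le_trans h; exact: h2.
by apply: h2; rewrite mem_filter ht' hL1.
Qed.

(* [xget] returns the junk value [t0] if no minimum exists outside [L]. *)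
Definition next_min (L : seq T) : T :=
  xget t0 [set t | t \notin L /\ forall t', t' \notin L -> f t <= f t'].

Fixpoint enum_prefix (k : nat) : seq T :=
  if k is k'.+1 then rcons (enum_prefix k') (next_min (enum_prefix k')) else [::].

Definition sorted_enum k : T := next_min (enum_prefix k).

Lemma sorted_enumP k : sorted_enum k \notin enum_prefix k /\
  forall t, t \notin enum_prefix k -> f (sorted_enum k) <= f t.
Proof.
rewrite /sorted_enum /next_min; case: xgetP => [t _ //|H]; exfalso.
by have [t ht] := argmin_notin (enum_prefix k); exact: (H t).
Qed.

Lemma mem_enum_prefix k t : t \in enum_prefix k <-> exists2 i, (i < k)%N & t = sorted_enum i.
Proof.
elim: k => [|k IH] /=; first by split => // -[].
rewrite mem_rcons inE; split.
  move=> /orP[/eqP ->|/IH [i ik ->]]; first by exists k.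
  by exists i => //; exact: ltnW.
move=> [i]; rewrite ltnS leq_eqVlt => /orP[/eqP -> ->|ik e]; first by rewrite eqxx.
by apply/orP; right; apply/IH; exists i.
Qed.

Lemma sorted_enum_inj : injective sorted_enum.
Proof.
suff H i j : (i < j)%N -> sorted_enum i <> sorted_enum j.
  by move=> i j e; case: (ltngtP i j) => [/H|/H|] // h; case: h.
move=> ij e; have [/negP h _] := sorted_enumP j; apply: h.
by apply/mem_enum_prefix; exists i.
Qed.

Lemma sorted_enum_homo : {homo f \o sorted_enum : i j / (i <= j)%N >-> i <= j}.
Proof.
apply: homo_leq => [x|x y z|k]; [exact: lexx|exact: le_trans|].
apply: (sorted_enumP k).2; apply/negP => /mem_enum_prefix [i ik e].
by have := sorted_enum_inj e => e'; move: ik; rewrite -e' ltnNge leqnSn.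
Qed.

(** An element that is never chosen stays a candidate, so every chosen element has value at most
    [f t]; but there are infinitely many chosen elements and the sublevel set is finite. *)
Lemma sorted_enum_surj t : exists k, sorted_enum k = t.
Proof.
apply: contrapT => H; have [L hL] := finite_sublevel (f t).
have sub k : sorted_enum k \in L.
  apply: hL; apply: (sorted_enumP k).2; apply/negP => /mem_enum_prefix [i _ e].
  by apply: H; exists i.
have : (size (map sorted_enum (iota 0 (size L).+1)) <= size L)%N.
  apply: uniq_leq_size; first by rewrite map_inj_uniq ?iota_uniq //; exact: sorted_enum_inj.
  by move=> _ /mapP [k _ ->]; exact: sub.
by rewrite size_map size_iota ltnn.
Qed.

End SortedEnumeration.

(** * The sequence of eigenvalues and isospectrality *)

Section Spectrum.
Context {R : realType} {n : nat}.
Implicit Types (m : 'rV[int]_n) (B : 'M[R]_n).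

Lemma energy_ge0 B m : 0 <= energy B m.
Proof. by apply: sumr_ge0 => j _; exact: sqr_ge0. Qed.

(** Pairing the dual vector of [m] with row [j] of [B] returns the integer coordinate, so that a
    bound on the energy bounds [m]. *)
Lemma intv_coord_sum B m j : B \in unitmx ->
  (m 0 j)%:~R = \sum_i (mkpt (delta_mx 0 j *m B) 0 : 'rV[R]_n.+1) 0 i * freq B m i.
Proof.
move=> uB; set x := mkpt _ _.
have -> : (m 0 j)%:~R = dotz m (unitc B x).
  rewrite unitc_mkpt // /dotz (bigD1 j) //= !mxE !eqxx mulr1 big1 ?addr0 // => i /negbTE ij.
  by rewrite !mxE ij andbF mulr0.
rewrite {1}(row_sum_delta x).
rewrite (_ : unitc B _ = \sum_i x 0 i *: unitc B (basis_vec i)); last first.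
  have h0 : unitc B 0 = 0 by rewrite -(scale0r 0) unitcZ scale0r.
  elim/big_ind2 : _ => [//|a b c d e1 e2|i _]; first by rewrite unitcD e1 e2.
  by rewrite unitcZ.
have hd : forall s : seq 'I_n.+1, dotz m (\sum_(i <- s) x 0 i *: unitc B (basis_vec i)) = \sum_(i <- s) x 0 i * freq B m i.
  elim=> [|i s IH]; first by rewrite !big_nil /dotz big1 // => i _; rewrite mxE mulr0.
  by rewrite !big_cons dotzD dotzZ IH.
exact: hd.
Qed.

Lemma finite_int_box (N : nat) : exists L : seq 'rV[int]_n,
  forall m, (forall j, `|m 0 j| <= N%:Z) -> m \in L.
Proof.
exists [seq \row_i ((g i : nat)%:Z - N%:Z) | g : {ffun 'I_n -> 'I_(N + N).+1}].
move=> m hm; apply/mapP.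
exists [ffun i => inord (absz (m 0 i + N%:Z)%R)]; first by rewrite mem_enum.
apply/rowP => i; rewrite mxE ffunE.
have := hm i; rewrite ler_norml => /andP[h1 h2].
rewrite inordK; last by lia.
by rewrite gez0_abs ?addrK // -lerBlDr sub0r.
Qed.

Lemma modeval_sublevel B : B \in unitmx -> forall c : R,
  exists L : seq ('rV[int]_n * nat), forall mk, modeval B mk <= c -> mk \in L.
Proof.
move=> uB c.
pose X j : 'rV[R]_n.+1 := mkpt (delta_mx 0 j *m B) 0.
(* The square of each [|freq|] is at most [|c|], hence [|freq| <= 1 + |c|]; by [intv_coord_sum], [K]
   then bounds every coordinate of [m]. *)
pose K := \sum_j \sum_i `|X j 0 i| * (1 + `|c|).
have K0 : 0 <= K by apply: sumr_ge0 => j _; apply: sumr_ge0 => i _; rewrite mulr_ge0 // addr_ge0.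
have [N hN] : exists N : nat, `|c| + K < N%:R.
  by exists (Num.truncn (`|c| + K)).+1; have := Num.Theory.truncnS_gt (`|c| + K).
have [L hL] := finite_int_box N.
exists [seq (m, k) | m <- L, k <- iota 0 N] => -[m k] h; move: h; rewrite {1}/modeval [(m, k).1]/= [(m, k).2]/= => h.
have e0 := energy_ge0 B m.
have pi1 : 1 <= pi :> R by have := @pi_ge2 R; lra.
have tau1 : 1 <= tau :> R by rewrite /tau mulr2n; lra.
have hk : (k.+1%:R * pi) ^+ 2 <= `|c| :> R by have := ler_norm c; lra.
apply/allpairsP; exists (m, k); split => //=.
  apply: hL => j.
  have : `|(m 0 j)%:~R : R| <= N%:R.
    apply: (@le_trans _ _ K); last by rewrite ltW // (le_lt_trans _ hN) // lerDr.
    rewrite (intv_coord_sum m j uB).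
    apply: (le_trans (ler_norm_sum _ _ _)).
    apply: (@le_trans _ _ (\sum_i `|X j 0 i| * (1 + `|c|))); last first.
      rewrite /K (bigD1 j) //= lerDl; apply: sumr_ge0 => j' _; apply: sumr_ge0 => i _.
      by rewrite mulr_ge0 // addr_ge0.
    apply: ler_sum => i _; rewrite normrM ler_wpM2l //.
    have : (tau * freq B m i) ^+ 2 <= `|c|.
      apply: (@le_trans _ _ (energy B m)); last by have := sqr_ge0 (k.+1%:R * pi : R); have := ler_norm c; lra.
      by rewrite /energy (bigD1 i) //= lerDl; apply: sumr_ge0 => j' _; exact: sqr_ge0.
    rewrite exprMn => h1.
    have : `|freq B m i| ^+ 2 <= `|c|.
      apply: le_trans h1; rewrite real_normK ?num_real // ler_peMl ?sqr_ge0 //.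
      by rewrite exprn_ege1.
    set a := `|freq B m i|; have : 0 <= a by exact: normr_ge0.
    by have := normr_ge0 c; nra.
  by rewrite -intr_norm -[N%:R]/(N%:Z%:~R) ler_int.
rewrite mem_iota add0n /=.
rewrite -(ltr_nat R); apply: le_lt_trans hN; apply: (@le_trans _ _ `|c|); last by rewrite lerDl.
apply: le_trans hk; have : 0 <= k%:R :> R by exact: ler0n.
rewrite -natr1; set a := k%:R => a0.
have : 1 <= (a + 1) * pi by nra.
have : a <= (a + 1) * pi by nra.
set b := _ * pi; nra.
Qed.

Section OneLattice.
Variables (B : 'M[R]_n) (uB : B \in unitmx).
Variables (mu : {measure set (borel (cyl R n)) -> \bar R}).
Hypothesis mu_box : forall c (a b : 'rV[R]_n.+1), fatlas B c ->
  (forall i, a 0 i <= b 0 i) -> box a b `<=` cod c ->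
  mu (bwd c @` box a b) = (\prod_i (b 0 i - a 0 i))%:E.
Hypothesis mu_boundary : mu (~` atlas_interior (fatlas B)) = 0%E.
Local Notation M := (cylM uB mu_box mu_boundary).

Lemma is_dirichlet_spectrum_modeval (e : nat -> 'rV[int]_n * nat) : bijective e ->
  {homo modeval B \o e : i j / (i <= j)%N >-> i <= j} ->
  is_dirichlet_spectrum M (modeval B \o e).
Proof.
move=> [e' eK e'K] he; split => // lam.
have [L0 hL0] := modeval_sublevel uB lam.
pose L := undup [seq t <- L0 | modeval B t == lam].
have hL t : t \in L <-> modeval B t = lam.
  rewrite mem_undup mem_filter; split; first by move=> /andP[/eqP].
  by move=> h; rewrite h eqxx hL0 // h.
have uL : uniq L by exact: undup_uniq.
exists (size L); split; first exact: eigenspace_dim.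
apply/card_set_bijP; exists (fun k => index (e k) L); split.
- by move=> k /= h; rewrite index_mem; apply/hL.
- move=> i j; rewrite !inE /= => hi hj /(congr1 (nth (e i) L)).
  rewrite !nth_index; [|exact/hL|exact/hL].
  exact: (can_inj eK).
- move=> i /= iL; exists (e' (nth (e 0%N) L i)) => /=.
    by rewrite e'K; apply/hL; exact: mem_nth.
  by rewrite e'K index_uniq.
Qed.

End OneLattice.

(** Since [beta] preserves energies, a sorted enumeration of the modes of the first cylinder,
    transported by [beta], enumerates the modes of the second with the same sequence of values. *)
Theorem cylM_isospectral B1 B2 (uB1 : B1 \in unitmx) (uB2 : B2 \in unitmx)
  (mu1 mu2 : {measure set (borel (cyl R n)) -> \bar R})
  (mu_box1 : forall c (a b : 'rV[R]_n.+1), fatlas B1 c ->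
    (forall i, a 0 i <= b 0 i) -> box a b `<=` cod c ->
    mu1 (bwd c @` box a b) = (\prod_i (b 0 i - a 0 i))%:E)
  (mu_boundary1 : mu1 (~` atlas_interior (fatlas B1)) = 0%E)
  (mu_box2 : forall c (a b : 'rV[R]_n.+1), fatlas B2 c ->
    (forall i, a 0 i <= b 0 i) -> box a b `<=` cod c ->
    mu2 (bwd c @` box a b) = (\prod_i (b 0 i - a 0 i))%:E)
  (mu_boundary2 : mu2 (~` atlas_interior (fatlas B2)) = 0%E)
  (beta : 'rV[int]_n -> 'rV[int]_n) :
  bijective beta -> (forall m, energy B2 (beta m) = energy B1 m) ->
  dirichlet_isospectral (cylM uB1 mu_box1 mu_boundary1) (cylM uB2 mu_box2 mu_boundary2).
Proof.
move=> [beta' bK b'K] hb.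
have fin := modeval_sublevel uB1.
have inf (L : seq ('rV[int]_n * nat)) : exists t, t \notin L.
  pose g (k : nat) : 'rV[int]_n * nat := (0, k).
  apply: contrapT => H.
  have sub k : (0 : 'rV[int]_n, k) \in L by apply/negPn/negP => h; apply: H; exists (0, k).
  have : (size (map g (iota 0 (size L).+1)) <= size L)%N.
    apply: uniq_leq_size; first by rewrite map_inj_uniq ?iota_uniq // => i j [].
    by move=> _ /mapP [k _ ->]; exact: sub.
  by rewrite size_map size_iota ltnn.
pose e := sorted_enum (modeval B1) (0 : 'rV[int]_n, 0%N).
have e_inj : injective e := sorted_enum_inj fin inf.
have [e' e'K] := choice (sorted_enum_surj (0 : 'rV[int]_n, 0%N) fin inf).
have eK : cancel e e' by move=> k; apply: e_inj; rewrite /e e'K.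
have eb : bijective e by exists e'.
have eh := sorted_enum_homo (0 : 'rV[int]_n, 0%N) fin inf.
exists (modeval B1 \o e); split; first exact: is_dirichlet_spectrum_modeval.
pose e2 k := (beta (e k).1, (e k).2).
have E : modeval B1 \o e = modeval B2 \o e2.
  by apply/funext => k; rewrite /= /modeval /= hb.
rewrite E; apply: is_dirichlet_spectrum_modeval; last by rewrite -E.
exists (fun t => e' (beta' t.1, t.2)) => [k|[m k]]; rewrite /e2 /=.
  by rewrite bK -surjective_pairing eK.
by rewrite /e e'K /= b'K.
Qed.

End Spectrum.

(** * Isometries *)

Section Dot.
Context {R : realType} {N : nat}.
Implicit Types (u v w : 'rV[R]_N) (A : 'M[R]_N).

Definition dot u v : R := \sum_i u 0 i * v 0 i.

Lemma dotE u v : dot u v = (u *m v^T) 0 0.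
Proof. by rewrite /dot mxE; apply: eq_bigr => i _; rewrite mxE. Qed.

Lemma dotC u v : dot u v = dot v u.
Proof. by apply: eq_bigr => i _; rewrite mulrC. Qed.

Lemma dotDl u v w : dot (u + v) w = dot u w + dot v w.
Proof. by rewrite -big_split; apply: eq_bigr => i _; rewrite mxE mulrDl. Qed.

Lemma dotZl (a : R) u w : dot (a *: u) w = a * dot u w.
Proof. by rewrite mulr_sumr; apply: eq_bigr => i _; rewrite mxE mulrA. Qed.

Lemma dotNl u w : dot (- u) w = - dot u w.
Proof. by rewrite -scaleN1r dotZl mulN1r. Qed.

Lemma dotBl u v w : dot (u - v) w = dot u w - dot v w.
Proof. by rewrite dotDl dotNl. Qed.

Lemma dotBr u v w : dot w (u - v) = dot w u - dot w v.
Proof. by rewrite ![dot w _]dotC dotBl. Qed.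

Lemma dotZr (a : R) u w : dot w (a *: u) = a * dot w u.
Proof. by rewrite ![dot w _]dotC dotZl. Qed.

Lemma dot_mulmx A u v : dot (u *m A) v = dot u (v *m A^T).
Proof. by rewrite !dotE trmx_mul trmxK mulmxA. Qed.

Lemma dot_orth A u v : orthogonal_mx A -> dot (u *m A) (v *m A) = dot u v.
Proof. by move=> oA; rewrite dot_mulmx -mulmxA oA mulmx1. Qed.

Lemma dot_ge0 u : 0 <= dot u u.
Proof. by apply: sumr_ge0 => i _; rewrite -expr2 sqr_ge0. Qed.

Lemma coord_le_norm u i : `|u 0 i| <= `|u|.
Proof.
rewrite [leRHS]mx_normrE.
exact: (le_bigmax _ (fun ij : 'I_1 * 'I_N => `|u ij.1 ij.2|) (0, i)).
Qed.

Lemma norm_le_coord u (c : R) : 0 <= c -> (forall i, `|u 0 i| <= c) -> `|u| <= c.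
Proof.
by move=> c0 h; rewrite [leLHS]mx_normrE; apply: bigmax_le => // -[a i] _ /=; rewrite ord1.
Qed.

Lemma dot_norm u v : `|dot u v| <= N%:R * `|u| * `|v|.
Proof.
apply: (le_trans (ler_norm_sum _ _ _)).
have : \sum_(i < N) `|u 0 i * v 0 i| <= \sum_(i < N) `|u| * `|v|.
  by apply: ler_sum => i _; rewrite normrM ler_pM // coord_le_norm.
move=> h; apply: (le_trans h).
by rewrite sumr_const card_ord -[leLHS]mulr_natl mulrA.
Qed.

Lemma dot_delta u i : dot u (basis_vec i) = u 0 i.
Proof.
rewrite /dot (bigD1 i) //= mxE !eqxx mulr1 big1 ?addr0 // => j /negbTE ji.
by rewrite mxE ji andbF mulr0.
Qed.

Lemma continuous_dotl w : continuous (fun u => dot u w).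
Proof.
move=> u; apply: (@cvg_sumr _ _ (nbhs u) _) => i _.
by apply: cvgMr_tmp; exact: coord_continuous.
Qed.

Lemma is_derive_dot (F : R -> 'rV[R]_N) (t : R) d w : is_derive t 1 F d ->
  is_derive t 1 (fun s => dot (F s) w) (dot d w).
Proof.
move=> [/cvg_ex[d' h] dE].
have {dE}e : d' = d by rewrite -dE; apply/esym; exact: cvg_lim h.
rewrite e in h.
suff K : (h^-1 *: (dot (F (h%:A + t)) w - dot (F t) w) @[h --> 0^']) --> dot d w.
  by split; [apply/cvg_ex; exists (dot d w)|exact: (cvg_lim _ K)].
have := cvg_comp _ _ h (@continuous_dotl w d).
suff -> : (dot^~ w \o (fun h0 : R => h0^-1 *: ((F \o shift t) h0%:A - F t))) =
  (fun h0 : R => h0^-1 *: (dot (F (h0%:A + t)) w - dot (F t) w)) by [].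
by apply/funext => h0 /=; rewrite dotZl dotBl.
Qed.

Lemma mulmx_norm_le A : exists2 C : R, 0 < C & forall u, `|u *m A| <= C * `|u|.
Proof.
exists (1 + \sum_k \sum_j `|A k j|).
  by rewrite ltr_wpDr //; apply: sumr_ge0 => k _; apply: sumr_ge0.
move=> u; apply: norm_le_coord => [|j].
  by rewrite mulr_ge0 // addr_ge0 //; apply: sumr_ge0 => k _; apply: sumr_ge0.
rewrite mxE; apply: (le_trans (ler_norm_sum _ _ _)).
rewrite mulrDl mul1r mulr_suml; apply: ler_wpDl => //; apply: ler_sum => k _.
rewrite normrM mulrC ler_pM ?coord_le_norm // (bigD1 j) //= lerDl.
exact: sumr_ge0.
Qed.

End Dot.

(** * Local rigidity of maps with orthogonal Jacobian *)

Section LocalRigidity.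
Context {R : realType} {N : nat}.
Local Notation W := 'rV[R]_N.
Implicit Types (x y h k u : W).

Lemma differentiable_eps (F : W -> W) x : differentiable F x ->
  forall e : R, 0 < e -> \forall x' \near x, `|F x' - F x - (x' - x) *m 'J F x| <= e * `|x' - x|.
Proof.
move=> dF e e0.
have /eqaddoP /(_ e e0) h := diff_locally dF.
have c : (x' - x) @[x' --> x] --> (0 : W).
  by rewrite -(subrr x); apply: (cvgB cvg_id (cvg_cst x)).
have h' : \forall x' \near x, `|(F \o shift x - (cst (F x) + 'd F x)) (x' - x)| <= e * `|x' - x| by exact: c _ h.
apply: (near_sub h') => x' /=.
rewrite -[(F \o _ - _) _]/(F (x' - x + x) - (F x + 'd F x (x' - x))) subrK opprD addrA.
by rewrite /jacobian mul_rV_lin1.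
Qed.

Lemma is_derive_seg (F : W -> W) x h (s : R) : differentiable F (s *: h + x) ->
  is_derive s 1 (fun s => F (s *: h + x)) (h *m 'J F (s *: h + x)).
Proof.
move=> dF; apply/is_derive_lineP.
have -> : (fun t : R => F ((t *: 1 + s) *: h + x)) = (fun t : R => F (t *: h + (s *: h + x))).
  by apply/funext => t; rewrite addrA -scalerDl [t *: 1]mulr1.
apply/(@is_derive_lineP _ _ _ F (s *: h + x) h).
by apply: DeriveDef; [exact: diff_derivable|exact: deriveEjacobian].
Qed.

Lemma mvt01 (f f' : R -> R) : (forall s : R, 0 <= s <= 1 -> is_derive s 1 f (f' s)) ->
  exists2 s : R, 0 <= s <= 1 & f 1 - f 0 = f' s.
Proof.
move=> df; have [||s /itvP hs] := @MVT_segment R f f' 0 1 ler01.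
- by move=> t /itvP ht; apply: df; rewrite !ht.
- apply: continuous_in_subspaceT => t /set_mem /= /itvP ht.
  by apply: (@is_derive1_continuous _ _ _ (f' t)); apply: df; rewrite !ht.
by rewrite subr0 mulr1 => e; exists s => //; rewrite !hs.
Qed.

Definition convexW (C : set W) := forall x h (s : R), C x -> C (h + x) -> 0 <= s <= 1 -> C (s *: h + x).

Lemma orth_nonexpansive (F : W -> W) (C : set W) : convexW C ->
  (forall x, C x -> differentiable F x /\ orthogonal_mx ('J F x)) ->
  forall x x', C x -> C x' -> dot (F x' - F x) (F x' - F x) <= dot (x' - x) (x' - x).
Proof.
move=> cC hF x x' Cx Cx'.
pose u := F x' - F x; pose h := x' - x.
have seg (s : R) : 0 <= s <= 1 -> C (s *: h + x) by apply: cC => //; rewrite subrK.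
have [s hs] := @mvt01 (fun s => dot (F (s *: h + x)) u) (fun s => dot (h *m 'J F (s *: h + x)) u)
  (fun s hs => is_derive_dot u (is_derive_seg (hF _ (seg s hs)).1)).
rewrite scale1r scale0r add0r subrK -dotBl -/u => e.
have [_ o] := hF _ (seg s hs).
have := dot_ge0 (h *m 'J F (s *: h + x) - u).
rewrite !(dotBl _ u, dotBr _ u) (dot_orth _ _ o) (dotC u (_ *m _)) -e -/h; lra.
Qed.

(** The inverse [H] is only known to be continuous. Its derivative along the segment is obtained by
    hand from the differentiability of [F] at [H y]; then the argument of [orth_nonexpansive]
    applies. *)
Lemma inv_nonexpansive (F H : W -> W) (C : set W) : open C -> convexW C ->
  (forall y, C y -> [/\ {for y, continuous H}, F (H y) = y, differentiable F (H y) &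
     orthogonal_mx ('J F (H y))]) ->
  forall y y', C y -> C y' -> dot (H y' - H y) (H y' - H y) <= dot (y' - y) (y' - y).
Proof.
move=> oC cC hH y y' Cy Cy'.
pose u := H y' - H y; pose k := y' - y.
have seg (s : R) : 0 <= s <= 1 -> C (s *: k + y) by apply: cC => //; rewrite subrK.
pose A s := 'J F (H (s *: k + y)).
have D (s : R) : 0 <= s <= 1 -> is_derive s 1 (fun s => dot (H (s *: k + y)) u) (dot k (u *m A s)).
  move=> hs; set ys := s *: k + y; have Cs : C ys := seg s hs.
  have [cH FH dF oA] := hH _ Cs; rewrite -/(A s) in oA.
  set xs := H ys in dF oA FH.
  apply: is_derive_eps => e e0.
  have [C0 C0gt hC0] := mulmx_norm_le (A s)^T.
  have nu0 : 0 <= `|u *m A s| by [].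
  (* [D] collects the constants of the final estimate, with 1 added to be positive. Of the two
     bounds on [e1], the first absorbs the increment of [H] into the left-hand side, the second
     makes the error at most [e]. *)
  pose D := N%:R * (2 * C0 * `|k|) * `|u *m A s| + 1.
  have D0 : 0 < D by rewrite ltr_wpDl // !mulr_ge0 // ltW.
  pose e1 := Num.min ((2 * C0)^-1) (e / D).
  have e10 : 0 < e1 by rewrite lt_min invr_gt0 divr_gt0 // mulr_gt0.
  have e1C : e1 * C0 <= 2^-1.
    by rewrite -ler_pdivlMr // -invfM ge_min lexx.
  have e1D : e1 * D <= e by rewrite -ler_pdivlMr // ge_min lexx orbT.
  have cs : {for (0 : R), continuous (fun h : R => (h + s) *: k + y)}.
    by apply: ctD; [apply: ctZ; [exact: (cvgD cvg_id (cvg_cst s))|exact: ct_cst]|exact: ct_cst].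
  have cs0 : (h + s) *: k + y @[h --> (0 : R)] --> ys by rewrite /ys -{2}(add0r s).
  have near1 : \forall h \near (0 : R), C ((h + s) *: k + y).
    by apply: cs0; apply: open_nbhs_nbhs.
  have near2 := cvg_comp _ _ cs0 cH _ (differentiable_eps dF e10).
  near=> h.
  have Ch : C ((h + s) *: k + y) by near: h.
  have [_ FH' _ _] := hH _ Ch.
  have : `|F (H ((h + s) *: k + y)) - F xs - (H ((h + s) *: k + y) - xs) *m 'J F xs|
    <= e1 * `|H ((h + s) *: k + y) - xs| by near: h.
  rewrite FH' FH -/(A s) -dotBl; set Dx := H _ - xs.
  rewrite (_ : (h + s) *: k + y - ys = h *: k); last first.
    by rewrite /ys scalerDl -(addrA (h *: k)) addrK.
  set rho := h *: k - _ => hr.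
  have E : h * dot k (u *m A s) = dot Dx u + dot rho (u *m A s).
    by rewrite -dotZl -(dot_orth Dx u oA) -dotDl /rho addrC subrK.
  rewrite E opprD addrA subrr sub0r normrN; apply: (le_trans (dot_norm _ _)).
  have hD : `|Dx| <= 2 * C0 * `|k| * `|h|.
    have h1 : `|Dx *m A s| <= `|h| * `|k| + e1 * `|Dx|.
      rewrite -normrZ (_ : Dx *m A s = h *: k - rho); last by rewrite /rho opprB addrC subrK.
      by apply: (le_trans (ler_normB _ _)); rewrite lerD2l.
    have h2 : `|Dx| <= C0 * `|Dx *m A s|.
      by have := hC0 (Dx *m A s); rewrite -mulmxA oA mulmx1.
    have h3 : e1 * C0 * `|Dx| <= 2^-1 * `|Dx| by rewrite ler_wpM2r.
    have h4 : C0 * `|Dx *m A s| <= C0 * (`|h| * `|k| + e1 * `|Dx|) by rewrite ler_pM2l.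
    lra.
  apply: (@le_trans _ _ (N%:R * (e1 * (2 * C0 * `|k| * `|h|)) * `|u *m A s|)).
    apply: ler_wpM2r => //; apply: ler_wpM2l => //; apply: (le_trans hr).
    by rewrite ler_pM2l.
  apply: (@le_trans _ _ (e1 * D * `|h|)); last exact: ler_wpM2r.
  have : 0 <= e1 * `|h| by rewrite mulr_ge0 // ltW.
  rewrite /D; lra.
have [s hs] := mvt01 D.
rewrite scale1r scale0r add0r subrK -dotBl -/u => e.
have [_ _ _ o] := hH _ (seg s hs); rewrite -/(A s) in o.
have := dot_ge0 (k - u *m A s).
rewrite !(dotBl k, dotBr k) (dot_orth _ _ o) (dotC (_ *m _) k) -e -/k; lra.
Unshelve. all: by end_near. Qed.

(** Polarisation: preserved distances and [G 0 = 0] give preserved inner products, and these with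
    the images of a basis determine every value of [G]. *)
Lemma isometry_affine (G : W -> W) (r : R) : 0 < r -> G 0 = 0 ->
  (forall h h', `|h| <= r -> `|h'| <= r -> dot (G h' - G h) (G h' - G h) = dot (h' - h) (h' - h)) ->
  exists2 A, orthogonal_mx A & forall h, `|h| <= r -> G h = h *m A.
Proof.
move=> r0 G0 hG.
have n0 : `|0 : W| <= r by rewrite normr0 ltW.
have nG h : `|h| <= r -> dot (G h) (G h) = dot h h.
  by move=> hr; have := hG 0 h n0 hr; rewrite G0 !subr0.
have dG h h' : `|h| <= r -> `|h'| <= r -> dot (G h) (G h') = dot h h'.
  move=> hr hr'; have := hG h h' hr hr'; rewrite !(dotBl, dotBr) !nG // (dotC (G h') (G h)) (dotC h' h).
  lra.
have nb i : `|r *: basis_vec i : W| <= r.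
  rewrite normrZ gtr0_norm // ler_piMr //; first exact: ltW.
  by apply: norm_le_coord => // j; rewrite mxE; case: (_ && _); rewrite ?normr1 ?normr0.
(* The basis vectors are scaled by [r] since [G] is controlled only on the ball of that radius. *)
pose A : 'M[R]_N := \matrix_i (r^-1 *: G (r *: basis_vec i)).
have rowA i : row i A = r^-1 *: G (r *: basis_vec i) by rewrite rowK.
have AAT u i : (u *m A^T) 0 i = dot u (row i A).
  by rewrite /dot mxE; apply: eq_bigr => j _; rewrite !mxE.
have oA : orthogonal_mx A.
  apply/row_matrixP => i; apply/rowP => j; rewrite row_mul AAT !rowA dotZl dotZr dG //.
  rewrite dotZl dotZr dot_delta !mxE eqxx /= (eq_sym j); field.
  by rewrite gt_eqF.
exists A => // h hr.
have e : G h *m A^T = h.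
  apply/rowP => i; rewrite AAT rowA dotZr dG // dotZr dot_delta mulKf //.
  by rewrite gt_eqF.
by rewrite -{2}e -mulmxA (mulmx1C oA) mulmx1.
Qed.

Lemma convexW_ball x (e : R) : convexW [set x' | `|x' - x| < e].
Proof.
move=> x1 h s /= h1 h2 /andP[s0 s1].
have -> : s *: h + x1 - x = s *: (h + x1 - x) + (1 - s) *: (x1 - x).
  by apply/rowP => i; rewrite !mxE; ring.
apply: (le_lt_trans (ler_normD _ _)); rewrite !normrZ !ger0_norm ?subr_ge0 //.
have [->|sN0] := eqVneq s 0; first by rewrite mul0r add0r subr0 mul1r.
have s0' : 0 < s by rewrite lt_def sN0.
have : s * `|h + x1 - x| < s * e by rewrite ltr_pM2l.
have : (1 - s) * `|x1 - x| <= (1 - s) * e by rewrite ler_wpM2l ?subr_ge0 // ltW.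
lra.
Qed.

Lemma near_ballE x (P : W -> Prop) : (\forall x' \near x, P x') ->
  exists2 e : R, 0 < e & forall x', `|x' - x| < e -> P x'.
Proof.
move=> /nbhs_ballP [e /= e0 he]; exists e => // x' hx'; apply: he.
by rewrite mx_norm_ball /ball_ /= distrC.
Qed.

Lemma near_ballI x (e : R) : 0 < e -> \forall x' \near x, `|x' - x| < e.
Proof.
move=> e0; apply/nbhs_ballP; exists e => // x'.
by rewrite mx_norm_ball /ball_ /= distrC.
Qed.

Lemma open_ballW x (e : R) : open [set x' : W | `|x' - x| < e].
Proof.
rewrite openE => x' /= hx'; have : 0 < e - `|x' - x| by rewrite subr_gt0.
move=> /(near_ballI x') K; apply: (@near_sub _ x' _ [set x' | `|x' - x| < e] K) => x'' /= h.
by rewrite -(subrKA x') (le_lt_trans (ler_normD _ _)) // -ltrBrDr.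
Qed.

(* F and its local inverse H are 1-Lipschitz near x0 and F x0 by the mean value
   theorem, so F preserves distances, hence inner products. *)
Theorem local_rigid (F H : W -> W) x0 :
  (\forall x \near x0, differentiable F x /\ orthogonal_mx ('J F x)) ->
  (\forall y \near F x0, {for y, continuous H}) ->
  (\forall y \near F x0, F (H y) = y) ->
  (\forall x \near x0, H (F x) = x) ->
  exists A b, orthogonal_mx A /\ \forall x \near x0, F x = x *m A + b.
Proof.
move=> dF cH FH HF.
have [e1 e10 h1] := near_ballE dF; have [e2 e20 h2] := near_ballE HF.
pose e3 := Num.min e1 e2; have e30 : 0 < e3 by rewrite lt_min e10.
have HFx0 := nbhs_singleton HF.
have cHy : H y @[y --> F x0] --> x0 by rewrite -{2}HFx0; exact: nbhs_singleton cH.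
have nH := cHy _ (near_ballI x0 e30).
have nI : \forall y \near F x0, [/\ {for y, continuous H}, F (H y) = y & `|H y - x0| < e3].
  by near=> y; split; near: y.
have [e4 e40 h4] := near_ballE nI.
have cF := differentiable_continuous (nbhs_singleton dF).1.
have [e5 e50 h5] := near_ballE (cF _ (near_ballI (F x0) e40)).
pose e6 := Num.min e3 e5; have e60 : 0 < e6 by rewrite lt_min e30.
have ge6 x : `|x - x0| < e6 -> [/\ `|x - x0| < e1, `|x - x0| < e2 & `|x - x0| < e5].
  by rewrite !lt_min -andbA => /and3P.
pose r := e6 / 2; have r0 : 0 < r by rewrite divr_gt0.
pose G h := F (h + x0) - F x0.
have small h : `|h| <= r -> `|h + x0 - x0| < e6.
  by move=> hr; rewrite addrK (le_lt_trans hr) // /r ltr_pdivrMr // mulr2n; lra.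
have G0 : G 0 = 0 by rewrite /G add0r subrr.
have hG h h' : `|h| <= r -> `|h'| <= r -> dot (G h' - G h) (G h' - G h) = dot (h' - h) (h' - h).
  move=> /small s1 /small s2.
  have eG : G h' - G h = F (h' + x0) - F (h + x0) by rewrite /G opprB addrA subrK.
  have eh : h' - h = (h' + x0) - (h + x0) by rewrite opprD addrACA subrr addr0.
  have [a1 a2 a3] := ge6 _ s1; have [b1 b2 b3] := ge6 _ s2.
  apply/eqP; rewrite eG eh eq_le; apply/andP; split.
    by apply: (@orth_nonexpansive F [set x | `|x - x0| < e1]) => //; exact: convexW_ball.
  rewrite -{1 2}(h2 _ a2) -{1 2}(h2 _ b2).
  apply: (@inv_nonexpansive F H [set y | `|y - F x0| < e4]); try exact: h5.
  - exact: open_ballW.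
  - exact: convexW_ball.
  move=> y /= hy; have [c1 c2 c3] := h4 _ hy.
  by move: c3; rewrite lt_min => /andP[/h1 [d1 d2] _]; split.
have [A oA hA] := isometry_affine r0 G0 hG.
exists A, (F x0 - x0 *m A); split => //.
have K := near_ballI x0 r0; apply: (@near_sub _ x0 _ _ K) => x hx.
have := hA (x - x0) (ltW hx); rewrite /G subrK mulmxBl => e.
by rewrite -[LHS](subrK (F x0)) e -addrA [- _ + _]addrC.
Unshelve. all: by end_near. Qed.

End LocalRigidity.

Section ChartLemmas.
Context {R : realType} {n : nat} (B : 'M[R]_n) (uB : B \in unitmx).
Local Notation W := 'rV[R]_n.+1.
Implicit Types (x : W) (y : 'rV[R]_n).

Lemma fchartKV y x : near_unitc B y x -> slab x -> fwd (fchart B y false) (proj B x) = x.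
Proof.
move=> hx /andP[/ltW x0 /ltW x1] /=.
by rewrite ver_proj ?x0 // locy_cpt // mkpt_unitc.
Qed.

Lemma fchart_dom_proj y x : near_unitc B y x -> slab x -> dom (fchart B y false) (proj B x).
Proof.
move=> hx /andP[x0 x1] /=; split; first exact: in_arcs_cpt.
by rewrite ver_proj // ltW // ltW.
Qed.

Lemma continuous_fwd y b p : dom (fchart B y b) p -> {for p, continuous (fwd (fchart B y b))}.
Proof.
move=> [h _]; apply: (@ct_comp _ _ _ _ (flipb b)); last exact: continuous_flipb.
apply: continuous_mkpt; last exact: continuous_cht.
by apply: (@ct_comp _ _ _ (locy y) (fun v => v *m B)); [exact: continuous_locy|exact: continuous_mulmx].
Qed.

Lemma near_unitc_self x : near_unitc B (unitc B x) x.
Proof. by move=> i; rewrite subrr normr0 invr_gt0. Qed.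

Lemma clamp_open (z : R) : 0 < clamp z < 1 -> clamp z = z.
Proof. have [h _|] := boolP (0 <= z <= 1); first by rewrite clampE.
rewrite negb_and -!ltNge => /orP[] h; rewrite /clamp.
  by rewrite min_r ?max_l ?ltxx //; lra.
by rewrite min_l ?max_r ?ltxx ?andbF //; lra. Qed.

(** An identity principle: near [x1] the two affine maps differ by lattice vectors. The lattice is
    discrete, so the difference is locally constant, and being affine it is one lattice vector
    everywhere. *)
Lemma proj_affine_eq (A A1 : 'M[R]_n.+1) (b b1 : W) x1 :
  (\forall x \near x1, proj B (x *m A + b) = proj B (x *m A1 + b1) /\ slab (x *m A1 + b1)) ->
  forall x, proj B (x *m A + b) = proj B (x *m A1 + b1).
Proof.
move=> h; pose D (x : W) := x *m (A - A1) + (b - b1).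
have DE x : x *m A + b = x *m A1 + b1 + D x.
  by rewrite /D mulmxBr [RHS]addrACA !subrKC.
have hD x : proj B (x *m A + b) = proj B (x *m A1 + b1) -> slab (x *m A1 + b1) ->
    ver (D x) = 0 /\ exists m, hor (D x) = intv R m *m B.
  move=> /(proj_eq uB) [e1 [m e2]] s1; split.
    have : clamp (ver (x *m A + b)) = ver (x *m A + b).
      by apply: clamp_open; rewrite e1 clampE //; move: s1; rewrite /slab /= => /andP[/ltW -> /ltW ->].
    rewrite e1 clampE; last by move: s1; rewrite /slab /= => /andP[/ltW -> /ltW ->].
    by rewrite DE [in RHS]linearD /= -[LHS]addr0 => /addrI.
  by exists m; apply: (addrI (hor (x *m A1 + b1))); rewrite -e2 DE [RHS]linearD.
have cD : continuous D.
  move=> x; apply: (@ctD _ _ _ (fun x : W => x *m (A - A1)) (fun=> b - b1) x); last exact: ct_cst.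
  exact: continuous_mulmx.
have Dconst : \forall x \near x1, D x = D x1.
  have Hi i : \forall x \near x1, unitc B (D x) 0 i = unitc B (D x1) 0 i.
    apply: (int_near_cst uB (f := fun x : W => unitc B (D x) 0 i)).
      apply: ct_coord; apply: (@ct_comp _ _ _ D (unitc B)); [exact: cD|exact: continuous_unitc].
    apply: (near_sub h) => x [e s1]; have [_ [m hm]] := hD _ e s1.
    by exists (m 0 i); rewrite /unitc hm mulmxK // mxE.
  have HI : \forall x \near x1, forall i, unitc B (D x) 0 i = unitc B (D x1) 0 i.
    exact: (@filter_forall _ _ _ (nbhs x1) _).
  near=> x; have [e s1] : proj B (x *m A + b) = proj B (x *m A1 + b1) /\ slab (x *m A1 + b1) by near: x.
  have [v0 _] := hD _ e s1.
  have [e' s1'] := nbhs_singleton h; have [v0' _] := hD _ e' s1'.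
  rewrite -(mkpt_unitc uB (D x)) -(mkpt_unitc uB (D x1)) v0 v0'; congr (mkpt (_ *m _) _).
  by apply/rowP; near: x.
have [e e0 he] := near_ballE Dconst.
have AA : A - A1 = 0.
  apply/row_matrixP => i; rewrite row0.
  have : D ((e / 2) *: basis_vec i + x1) = D x1.
    apply: he; rewrite addrK normrZ ger0_norm; last by rewrite divr_ge0 // ltW.
    apply: (@le_lt_trans _ _ (e / 2 * 1)); last by rewrite mulr1 ltr_pdivrMr // mulr2n; lra.
    rewrite ler_wpM2l ?divr_ge0 ?(ltW e0) //.
    by apply: norm_le_coord => // j; rewrite mxE; case: (_ && _); rewrite ?normr1 ?normr0.
  rewrite /D => /addIr; rewrite mulmxDl -[RHS]add0r => /addIr /eqP.
  rewrite -scalemxAl scaler_eq0 mulf_eq0 invr_eq0 gt_eqF //= (_ : 2 == 0 = false) //=; last by apply/eqP; lra.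
  by rewrite -rowE => /eqP.
move=> x; apply/(proj_eq uB); have [e1 s1] := nbhs_singleton h; have [v0 [m hm]] := hD _ e1 s1.
have Dx : D x = D x1 by rewrite /D AA !mulmx0.
rewrite DE Dx; set z := x *m A1 + b1; split; first by rewrite linearD /= v0 addr0.
by exists m; rewrite linearD /= hm.
Unshelve. all: by end_near. Qed.

End ChartLemmas.

(** * Isometries of the cylinders are affine *)

Section Isometry.
Context {R : realType} {n : nat} (B1 B2 : 'M[R]_n) (uB1 : B1 \in unitmx) (uB2 : B2 \in unitmx).
Local Notation W := 'rV[R]_n.+1.
Variables (f g : cyl R n -> cyl R n).
Hypotheses (cf : continuous f) (cg : continuous g) (fgK : cancel f g) (gfK : cancel g f).
Hypothesis f_orth : forall c d, fatlas B1 c -> fatlas B2 d ->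
  forall x, (cod c)° x -> dom d (f (bwd c x)) ->
    let F := fwd d \o f \o bwd c in differentiable F x /\ orthogonal_mx ('J F x).
Implicit Types (x v : W).

Let chartf y b := fwd (fchart B2 y b) \o f \o proj B1.

Lemma chartf_orth x y b : slab x -> dom (fchart B2 y b) (f (proj B1 x)) ->
  differentiable (chartf y b) x /\ orthogonal_mx ('J (chartf y b) x).
Proof.
move=> sx hd; apply: (@f_orth (fchart B1 (unitc B1 x) false) (fchart B2 y b)) => //.
- by exists (unitc B1 x), false.
- by exists y, b.
by rewrite (fchart_int uB1); split => //; exact: near_unitc_self.
Qed.

Lemma ver_chartf x y b : ver (chartf y b x) = if b then 1 - cht (f (proj B1 x)) else cht (f (proj B1 x)).
Proof. by rewrite /chartf /= ver_flipb ver_mkpt. Qed.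

Lemma cht_itv (p : cyl R n) : 0 <= cht p <= 1.
Proof. by have [y [z [_ ->]]] := cpt_surj p; rewrite cht_cpt clamp_ge0 clamp_le1. Qed.

Lemma in_arcs_ex (p : cyl R n) : exists y, in_arcs y p.
Proof.
have [y [z [_ ->]]] := cpt_surj p; exists y; apply: in_arcs_cpt => i.
by rewrite subrr normr0 invr_gt0.
Qed.

(** Interior points go to interior points: if the image of [x] lay on the boundary, its height above
    that boundary would have a minimum at [x], but an invertible Jacobian lets it decrease to first
    order. *)
Lemma isometry_slab x : slab x -> 0 < cht (f (proj B1 x)) < 1.
Proof.
move=> sx; apply: contrapT => hN.
set q := f (proj B1 x) in hN; have q01 := cht_itv q.
(* A boundary point has height 0 or 1; this choice of [b] selects the chart that places the boundary
   component of [q] on the floor. *)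
pose b := (0 < cht q); have [y hy] := in_arcs_ex q.
have hd : dom (fchart B2 y b) q.
  by split => //; rewrite /b; case: ltP => //; lra.
have v0 : ver (chartf y b x) = 0.
  rewrite ver_chartf -/q /b; case: ltP => h; last lra.
  by apply/eqP; rewrite subr_eq0 eq_sym; apply/eqP; apply: contrapT => /eqP h1; apply: hN; lra.
have vge x' : 0 <= ver (chartf y b x').
  by rewrite ver_chartf; have := cht_itv (f (proj B1 x')); case: (b); lra.
have [dF oA] := chartf_orth sx hd; set A := 'J _ _ in oA.
have dge v : 0 <= ver (v *m A).
  have dF0 : differentiable (chartf y b) (0 *: v + x) by rewrite scale0r add0r.
  have := is_derive_dot (basis_vec ord_max) (is_derive_seg dF0).
  rewrite scale0r add0r -/A.
  under eq_fun do rewrite dot_delta; rewrite dot_delta -/(ver _) => -[/cvg_ex[l hl] dl].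
  have {dl} el : l = ver (v *m A) by rewrite -dl; apply/esym; exact: cvg_lim hl.
  rewrite -el leNgt; apply/negP => l0.
  have := cvgr_lt _ hl _ l0; rewrite near_withinE => K.
  have [e /= e0 he] := (nbhs_ballP _ _).1 (K _).
  have e2 : 0 < e / 2 by rewrite divr_gt0.
  have e2N : (e / 2 : R) != 0 by rewrite gt_eqF.
  have eb : ball (0 : R) e (e / 2).
    by rewrite /ball /= sub0r normrN gtr0_norm // ltr_pdivrMr // mulr2n; lra.
  have := he (e / 2) eb e2N.
  rewrite scale0r add0r -[X in _ - X]/(ver _) v0 subr0 -[_ 0 ord_max]/(ver _) /GRing.scale /=.
  by rewrite pmulr_rlt0 ?invr_gt0 // ltNge vge.
(* The orthogonal matrix [A] maps this vector to the downward unit vector, contradicting [dge]. *)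
have h2 := dge (- basis_vec ord_max *m A^T).
by move: h2; rewrite -mulmxA (mulmx1C oA) mulmx1 linearN /= ver_basis eqxx oppr_ge0 ler10.
Qed.

(** Read in charts around [x0] and its image, [f] becomes [F] and its inverse [g] becomes [H], and
    [local_rigid] applies. *)
Lemma isometry_local_affine x0 : slab x0 -> exists A b, orthogonal_mx A /\
  \forall x \near x0, f (proj B1 x) = proj B2 (x *m A + b) /\ slab (x *m A + b).
Proof.
move=> sx0; set q0 := f (proj B1 x0).
have q01 : 0 < cht q0 < 1 := isometry_slab sx0.
have [y hy] := in_arcs_ex q0.
pose F := chartf y false; pose c := fchart B1 (unitc B1 x0) false; pose d := fchart B2 y false.
pose H z := fwd c (g (proj B2 z)).
have cfp x : {for x, continuous (fun x : W => f (proj B1 x))}.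
  exact: (@ct_comp W (cyl R n) (cyl R n) (proj B1) f x (@continuous_proj R n B1 x) (@cf _)).
have cgp x : {for x, continuous (fun x : W => g (proj B2 x))}.
  exact: (@ct_comp W (cyl R n) (cyl R n) (proj B2) g x (@continuous_proj R n B2 x) (@cg _)).
have d0 : dom d q0 by split => //; lra.
have domd : \forall x \near x0, dom d (f (proj B1 x)).
  by apply: (cfp x0); apply: open_nbhs_nbhs; split => //; exact: fchart_dom_open.
have slabn : \forall x \near x0, slab x by apply: open_nbhs_nbhs; split => //; exact: slab_open.
have FE x : dom d (f (proj B1 x)) -> proj B2 (F x) = f (proj B1 x).
  by move=> hd; exact: (@fchartK R n B2 uB2 y false _ hd).
have c0 : dom c (g (proj B2 (F x0))).
  by rewrite FE // fgK; exact: (fchart_dom_proj (@near_unitc_self _ _ B1 x0) sx0).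
have domc : \forall z \near F x0, dom c (g (proj B2 z)).
  by apply: (cgp (F x0)); apply: open_nbhs_nbhs; split => //; exact: fchart_dom_open.
have HE z : dom c (g (proj B2 z)) -> proj B1 (H z) = g (proj B2 z).
  by move=> hd; exact: (@fchartK R n B1 uB1 _ false _ hd).
have goodz : \forall z \near F x0, near_unitc B2 y z /\ slab z.
  have : cod d (F x0) by exists q0.
  rewrite /d fchart_cod // => -[h1 _].
  have h2 : slab (F x0) by rewrite /slab /= ver_chartf.
  near=> z; split; near: z.
    by apply: open_nbhs_nbhs; split => //; exact: near_unitc_open.
  by apply: open_nbhs_nbhs; split => //; exact: slab_open.
have [|||| A [b [oA hA]]] := @local_rigid R n.+1 F H x0.
- by near=> x; apply: chartf_orth; near: x.
- suff cH z : dom c (g (proj B2 z)) -> {for z, continuous H} by exact: (near_sub domc cH).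
  move=> hz; have K := @continuous_fwd R n B1 (unitc B1 x0) false _ hz.
  have K2 := @ct_comp W (cyl R n) W (fun x => g (proj B2 x)) (fwd c) z (@cgp z) K.
  exact: K2.
- near=> z; have hz : dom c (g (proj B2 z)) by near: z.
  have [h1 h2] : near_unitc B2 y z /\ slab z by near: z.
  by rewrite -[LHS]/(fwd d (f (proj B1 (H z)))) HE // gfK (fchartKV uB2).
- have nu : \forall x \near x0, near_unitc B1 (unitc B1 x0) x.
    by apply: open_nbhs_nbhs; split; [exact: near_unitc_open|exact: near_unitc_self].
  near=> x; have hd : dom d (f (proj B1 x)) by near: x.
  rewrite -[LHS]/(fwd c (g (proj B2 (F x)))) FE // fgK (fchartKV uB1) //; near: x => //.
exists A, b; split => //; near=> x.
have hd : dom d (f (proj B1 x)) by near: x.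
have sx : slab x by near: x.
have <- : F x = x *m A + b by near: x.
by split; [rewrite FE|rewrite /slab /= ver_chartf; exact: isometry_slab].
Unshelve. all: by end_near. Qed.

Lemma mid_segment (s v : R) : 0 <= s <= 1 -> 0 < v < 1 -> 0 < s * (v - 2^-1) + 2^-1 < 1.
Proof.
move=> s01 v01; have sv : 0 <= s * v by rewrite mulr_ge0; lra.
have sv' : 0 <= s * (1 - v) by rewrite mulr_ge0; lra.
have [s1|s1] := eqVneq s 1; first by rewrite s1; lra.
have : s < 1 by rewrite lt_neqAle s1; lra.
lra.
Qed.

(** Continuation along segments of the convex slab: the set of points near which the map has the
    affine form found at the centre is open and closed in the slab. *)
Lemma isometry_global_affine : exists A b, orthogonal_mx A /\
  forall x, slab x -> f (proj B1 x) = proj B2 (x *m A + b).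
Proof.
pose x0 : W := mkpt 0 2^-1.
have sx0 : slab x0 by rewrite /slab /= ver_mkpt; lra.
have [A [b [oA hA]]] := isometry_local_affine sx0.
exists A, b; split => // x sx.
pose Q x := \forall x' \near x, f (proj B1 x') = proj B2 (x' *m A + b).
have Qx0 : Q x0 by apply: (near_sub hA) => x' [].
suff : Q x by exact: nbhs_singleton.
(* A whole ball around [x1] carries one affine form. If it agrees with the given form near one point
   of the ball, [proj_affine_eq] makes them agree throughout; otherwise they agree near no point of
   it. *)
have Qloc x1 : slab x1 -> (\forall x' \near x1, Q x') \/ (\forall x' \near x1, ~ Q x').
  move=> sx1; have [A1 [b1 [_ h1]]] := isometry_local_affine sx1.
  have [e e0 he] := near_ballE h1.
  have [[x2 [hx2 Qx2]]|hN] := pselect (exists x2, `|x2 - x1| < e /\ Q x2); last first.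
    by right; apply: (near_sub (near_ballI x1 e0)) => x' hx' Qx'; apply: hN; exists x'.
  left.
  have h2 : \forall x' \near x2, `|x' - x1| < e.
    by apply: open_nbhs_nbhs; split => //; exact: open_ballW.
  have E : forall x', proj B2 (x' *m A + b) = proj B2 (x' *m A1 + b1).
    apply: (@proj_affine_eq _ _ _ uB2 _ _ _ _ x2); near=> x'.
    have [e1 e2] : f (proj B1 x') = proj B2 (x' *m A1 + b1) /\ slab (x' *m A1 + b1).
      by apply: he; near: x'.
    by split => //; rewrite -e1; apply/esym; near: x'.
  apply: (near_sub (near_ballI x1 e0)) => x' hx'.
  have h3 : \forall x'' \near x', `|x'' - x1| < e.
    by apply: open_nbhs_nbhs; split => //; exact: open_ballW.
  by apply: (near_sub h3) => x'' /he [-> _]; rewrite E.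
(* The indicator of [Q] along the segment is locally constant, so it has derivative zero, and the
   mean value theorem equates its two end values. *)
pose phi (s : R) : R := if `[< Q (s *: (x - x0) + x0) >] then 1 else 0.
have phi1 s : Q (s *: (x - x0) + x0) -> phi s = 1.
  by move=> h; rewrite /phi (asboolT h).
have phi0 s : ~ Q (s *: (x - x0) + x0) -> phi s = 0.
  by move=> h; rewrite /phi (asboolF h).
have sseg (s : R) : 0 <= s <= 1 -> slab (s *: (x - x0) + x0).
  move=> s01; have : ver (s *: (x - x0) + x0) = s * (ver x - 2^-1) + 2^-1.
    by rewrite linearD linearZ linearB /= ver_mkpt.
  by move: sx; rewrite /slab /= => h ->; exact: mid_segment.
have dphi (s : R) : 0 <= s <= 1 -> is_derive s 1 phi ((fun=> 0) s).
  move=> s01; apply: is_derive_eps => e e0.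
  have cs : (h + s) *: (x - x0) + x0 @[h --> (0 : R)] --> s *: (x - x0) + x0.
    rewrite -{2}(add0r s).
    by apply: (@ctD R R W (fun h : R => (h + s) *: (x - x0)) (fun=> x0) 0); [apply: ctZ; [exact: (cvgD cvg_id (cvg_cst s))|exact: ct_cst]|exact: ct_cst].
  have K : \forall h \near (0 : R), phi (h + s) = phi s.
    have [hq|hq] := Qloc _ (sseg s s01).
      have q0 := nbhs_singleton hq.
      by apply: (near_sub (cs _ hq)) => h hh; rewrite (phi1 _ hh) (phi1 _ q0).
    have q0 := nbhs_singleton hq.
    by apply: (near_sub (cs _ hq)) => h hh; rewrite (phi0 _ hh) (phi0 _ q0).
  by apply: (near_sub K) => h ->; rewrite subrr mulr0 subrr normr0 mulr_ge0 // ltW.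
have [s _] := mvt01 dphi.
have Q0 : Q (0 *: (x - x0) + x0) by rewrite scale0r add0r.
rewrite (phi1 _ Q0); have [//|nQ] := pselect (Q x).
have nQ1 : ~ Q (1 *: (x - x0) + x0) by rewrite scale1r subrK.
by rewrite (phi0 _ nQ1) => /eqP; rewrite sub0r oppr_eq0 oner_eq0.
Unshelve. all: by end_near. Qed.

(** Points that differ by a vector of the first lattice have the same projection, so their affine
    images also have the same projection, hence differ by a vector of the second lattice. *)
Theorem isometry_lattice : exists A : 'M[R]_n.+1, orthogonal_mx A /\
  forall m, exists m', mkpt (intv R m *m B1) 0 *m A = mkpt (intv R m' *m B2) 0.
Proof.
have [A [b [oA hA]]] := isometry_global_affine; exists A; split => // m.
pose x0 : W := mkpt 0 2^-1; set v : W := mkpt _ 0.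
have sx0 : slab x0 by rewrite /slab /= ver_mkpt; lra.
have sx1 : slab (x0 + v) by rewrite /slab /= linearD /= !ver_mkpt addr0; lra.
have e : proj B1 (x0 + v) = proj B1 x0.
  by apply/(proj_eq uB1); rewrite !linearD /= /v ver_mkpt hor_mkpt addr0; split => //; exists m.
have i0 := isometry_slab sx0; have i1 := isometry_slab sx1.
have := hA _ sx1; rewrite e hA // => /esym /(proj_eq uB2) [].
rewrite hA // cht_cpt in i0; rewrite hA // cht_cpt in i1.
rewrite !(clamp_open i0) !(clamp_open i1) mulmxDl addrAC => e1 [m' e2]; exists m'.
apply/mkptP; rewrite ?hor_mkpt ?ver_mkpt.
  by move: e2; rewrite linearD /= => /addrI.
by move: e1; rewrite linearD /= -[RHS]addr0 => /addrI.
Qed.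

End Isometry.

(** * The Riemannian measure *)

Section CountableUnions.
Context d (T : measurableType d) (R : realType) (mu : {measure set T -> \bar R}).

Lemma measure_bigcup_count (I : countType) (E : I -> set T) : (forall i, measurable (E i)) ->
  (forall i j t, E i t -> E j t -> i = j) ->
  mu (\bigcup_i E i) = (\sum_(k <oo) mu (oapp E set0 (@pickle_inv I k)))%E.
Proof.
move=> mE dE; have -> : \bigcup_i E i = \bigcup_k oapp E set0 (@pickle_inv I k).
  apply/seteqP; split => [t [i _ Eit]|t [k _]].
    by exists (pickle i) => //; rewrite pickleK_inv.
  by case: (@pickle_inv I k) => //= i; exists i.
have mS k : measurable (oapp E set0 (@pickle_inv I k)) by case: pickle_inv => //= i; exact: mE.
rewrite measure_semi_bigcup //; last exact: bigcupT_measurable.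
apply/trivIsetP => k k' _ _ kk'; apply/seteqP; split => // t [].
case ek : (@pickle_inv I k) => [i|//]; case ek' : (@pickle_inv I k') => [j|//] /= h1 h2.
have ij := dE _ _ _ h1 h2; move: kk'.
have h k0 i0 : @pickle_inv I k0 = Some i0 -> k0 = pickle i0.
  by move=> e; have := @pickle_invK I k0; rewrite e.
by rewrite (h _ _ ek) (h _ _ ek') ij eqxx.
Qed.

Lemma measure_bigcup_eq (I : countType) (E E' : I -> set T) :
  (forall i, measurable (E i)) -> (forall i, measurable (E' i)) ->
  (forall i j t, E i t -> E j t -> i = j) -> (forall i j t, E' i t -> E' j t -> i = j) ->
  (forall i, mu (E i) = mu (E' i)) -> mu (\bigcup_i E i) = mu (\bigcup_i E' i).
Proof.
move=> mE mE' dE dE' h; rewrite !measure_bigcup_count //.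
by apply: eq_eseriesr => k _; case: pickle_inv.
Qed.

End CountableUnions.

Section LebesgueCoordinates.
Context (R : realType).

(* A carrier for n-dimensional Lebesgue measure, as an iterated product. *)
Lemma lebesgue_coords (N : nat) :
  exists (d : measure_display) (T : measurableType d)
    (nu : {measure set T -> \bar R}) (x : T -> 'rV[R]_N),
  (forall i, measurable_fun setT (fun t => x t 0 i)) /\
  (forall (A : 'I_N -> set R) (a : 'I_N -> R), (forall i, measurable (A i)) ->
    (forall i, lebesgue_measure (A i) = (a i)%:E) ->
    nu [set t | forall i, A i (x t 0 i)] = (\prod_i a i)%:E).
Proof.
elim: N => [|N [d [T [nu [x [mx hx]]]]]].
  exists _, unit, (dirac tt), (fun=> 0); split; first by case.
  move=> A a _ _; rewrite big_ord0 (_ : [set t | _] = setT); first by rewrite /= diracE in_setT.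
  by apply/seteqP; split => // t _ /= [].
exists _, (T * measurableTypeR R)%type, (nu \x @lebesgue_measure R)%E.
exists (fun tr => mkpt (x tr.1) tr.2); split.
  move=> i; case: (unliftP ord_max i) => [j|] ->.
    under eq_fun do rewrite mkpt_lift; exact: measurableT_comp (mx j) measurable_fst.
  under eq_fun do rewrite mkpt_max; exact: measurable_snd.
move=> A a mA hA.
have -> : [set t : T * measurableTypeR R | forall i, A i (mkpt (x t.1) t.2 0 i)] =
    [set t | forall i, A (lift ord_max i) (x t 0 i)] `*` A ord_max.
  apply/seteqP; split => [[t r] /= h|[t r] [/= h1 h2] i].
    split => /= [i|]; first by have := h (lift ord_max i); rewrite mkpt_lift.
    by have := h ord_max; rewrite mkpt_max.
  by case: (unliftP ord_max i) => [j|] ->; rewrite ?mkpt_lift ?mkpt_max.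
have mX : measurable [set t | forall i, A (lift ord_max i) (x t 0 i)].
  have -> : [set t | forall i, A (lift ord_max i) (x t 0 i)] =
    \bigcap_(i in [set: 'I_N]) ((fun t => x t 0 i) @^-1` A (lift ord_max i)).
    by apply/seteqP; split => [t h i _|t h i]; [exact: h|exact: (h i I)].
  apply: fin_bigcap_measurable => // i _.
  by rewrite -[X in measurable X]setTI; exact: mx.
apply: (etrans (@product_measure1E _ _ T (measurableTypeR R) R nu (@lebesgue_measure R) _ _ mX (mA _))).
have e := hx (fun i => A (lift ord_max i)) (fun i => a (lift ord_max i)) (fun=> mA _) (fun=> hA _).
apply: (etrans (congr2 (fun u v => (u * v)%E) e (hA ord_max))); rewrite -EFinM big_ord_recr /=; congr (_ * _)%:E.
by apply: eq_bigr => i _; congr a; apply/val_inj; rewrite [LHS]lift_max.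
Qed.

Lemma lebesgue_itvI (a b c e : R) :
  lebesgue_measure [set r : R | a <= r <= b /\ c <= r < e] =
    (Num.max 0 (Num.min b e - Num.max a c))%:E.
Proof.
have [be|eb] := ltP b e.
  rewrite (_ : [set r | _] = `[Num.max a c, b]%classic); last first.
    apply/seteqP; split => r /=; rewrite in_itv /= ge_max => h; first by lra.
    by move: h => /andP[/andP[h1 h2] h3]; lra.
  rewrite lebesgue_measure_itv /= lte_fin; case: ltP => h.
    by rewrite -EFinD; congr _%:E; rewrite [RHS]max_r // subr_ge0 ltW.
  by rewrite [Num.max 0 _]max_l // subr_le0.
rewrite (_ : [set r | _] = `[Num.max a c, e[%classic); last first.
  apply/seteqP; split => r /=; rewrite in_itv /= ge_max => h; first by lra.
  by move: h => /andP[/andP[h1 h2] h3]; lra.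
rewrite lebesgue_measure_itv /= lte_fin; case: ltP => h.
  by rewrite -EFinD; congr _%:E; rewrite [RHS]max_r // subr_ge0 ltW.
by rewrite [Num.max 0 _]max_l // subr_le0.
Qed.

End LebesgueCoordinates.

(** * Fundamental cell of a triangular lattice basis *)

Section LatticeReduction.
Context {R : realType} {n : nat} (B : 'M[R]_n).
Hypothesis tB : forall i j : 'I_n, (i < j)%N -> B i j = 0.
Hypothesis dB : forall i, 0 < B i i.
Implicit Types (m : 'rV[int]_n) (y : 'rV[R]_n).

(** Coordinates are reduced from the last to the first: a multiple of row [i] changes no coordinate
    after [i], so earlier reductions survive. *)
Lemma lattice_reduce y : exists m, forall j, 0 <= (y + intv R m *m B) 0 j < B j j.
Proof.
suff H k : exists m, forall j : 'I_n, (n - k <= j)%N -> 0 <= (y + intv R m *m B) 0 j < B j j.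
  by have [m hm] := H n; exists m => j; apply: hm; rewrite subnn.
elim: k => [|k [m hm]].
  by exists 0 => j; rewrite subn0 leqNgt ltn_ord.
have [kn|nk] := ltnP k n; last first.
  by exists m => j hj; apply: hm; lia.
have hi : (n - k.+1 < n)%N by lia.
pose i := Ordinal hi; pose q := (y + intv R m *m B) 0 i / B i i.
exists (m - Num.floor q *: delta_mx 0 i) => j hj.
have E : (y + intv R (m - Num.floor q *: delta_mx 0 i) *m B) 0 j =
    (y + intv R m *m B) 0 j - (Num.floor q)%:~R * B i j.
  rewrite !mxE -addrA; congr (_ + _).
  rewrite [X in _ = _ - X](_ : _ = \sum_k (Num.floor q * (k == i)%:Z)%:~R * B k j); last first.
    rewrite (bigD1 i) //= eqxx mulr1 big1 ?addr0 // => k' /negbTE ->.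
    by rewrite mulr0 mul0r.
  rewrite -sumrB; apply: eq_bigr => k' _.
  by rewrite !mxE eqxx /= intrD mulrDl mulrNz mulNr; congr (_ - _%:~R * _); rewrite natz.
rewrite E; have [ij|ji|/val_inj ij] := ltngtP i j.
- by rewrite tB // mulr0 subr0; apply: hm; rewrite /= in ij *; lia.
- by move: ji; rewrite /= => ji; lia.
rewrite -ij; have -> : (y + intv R m *m B) 0 i = q * B i i.
  by rewrite /q divfK // gt_eqF.
have := Num.Theory.floor_itv q; move=> /andP[h1 h2].
have := dB i; rewrite intrD in h2; nra.
Qed.

(** Again from the last coordinate: once the later coefficients vanish, coordinate [j] is an integer
    multiple of [B j j] smaller than [B j j]. *)
Lemma lattice_reduce_uniq m : (forall j, `|(intv R m *m B) 0 j| < B j j) -> m = 0.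
Proof.
move=> h.
suff H k : forall j : 'I_n, (n - k <= j)%N -> m 0 j = 0.
  by apply/rowP => j; rewrite mxE; apply: (H n); rewrite subnn.
elim: k => [j|k IH j hj]; first by rewrite subn0 leqNgt ltn_ord.
have := h j; rewrite mxE (bigD1 j) //= big1 ?addr0 => [|i ij].
  rewrite mxE normrM (gtr0_norm (dB j)) gtr_pMl // -intr_norm -[1]/(1%:~R) ltr_int.
  by lia.
have [ij'|ji|/val_inj e] := ltngtP i j; last by rewrite e eqxx in ij.
  by rewrite tB // mulr0.
by rewrite !mxE IH ?mul0r //; lia.
Qed.

End LatticeReduction.

Lemma intvN (R : realType) n (m : 'rV[int]_n) : intv R (- m) = - intv R m.
Proof. by apply/rowP => i; rewrite !mxE mulrNz. Qed.

Lemma intvB (R : realType) n (m m' : 'rV[int]_n) : intv R (m - m') = intv R m - intv R m'.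
Proof. by apply/rowP => i; rewrite !mxE intrB. Qed.

(** * The volume of the cylinder *)

Section Volume.
Context {R : realType} {n : nat} (B : 'M[R]_n) (uB : B \in unitmx).
Hypothesis tB : forall i j : 'I_n, (i < j)%N -> B i j = 0.
Hypothesis dB : forall i, 0 < B i i.
Context d (T : measurableType d) (nu : {measure set T -> \bar R})
  (x : T -> 'rV[R]_n.+1).
Hypothesis mx : forall i, measurable_fun setT (fun t => x t 0 i).
Hypothesis nu_box : forall (A : 'I_n.+1 -> set R) (a : 'I_n.+1 -> R), (forall i, measurable (A i)) ->
    (forall i, lebesgue_measure (A i) = (a i)%:E) ->
    nu [set t | forall i, A i (x t 0 i)] = (\prod_i a i)%:E.
Local Notation W := 'rV[R]_n.+1.

Lemma measurable_coord_box (A : 'I_n.+1 -> set R) : (forall i, measurable (A i)) ->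
  measurable [set t | forall i, A i (x t 0 i)].
Proof.
move=> mA; have -> : [set t | forall i, A i (x t 0 i)] =
    \bigcap_(i in [set: 'I_n.+1]) ((fun t => x t 0 i) @^-1` A i).
  by apply/seteqP; split => [t h i _|t h i]; [exact: h|exact: (h i I)].
apply: fin_bigcap_measurable => // i _.
by rewrite -[X in measurable X]setTI; exact: mx.
Qed.

(* An open set is the union of the countably many rational cubes that it contains. *)
Lemma measurable_coord_open (V : set W) : open V -> measurable (x @^-1` V).
Proof.
move=> oV.
pose cube (qr : 'rV[rat]_n.+1 * rat) : set W := [set w | forall i, `|w 0 i - ratr (qr.1 0 i)| < ratr qr.2].
pose E (qr : 'rV[rat]_n.+1 * rat) : set T := [set t | cube qr `<=` V /\ cube qr (x t)].
have -> : x @^-1` V = \bigcup_qr E qr.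
  apply/seteqP; split => [t Vt|t [qr _ [h1 h2]]]; last exact: h1.
  have /near_ballE [e e0 he] : \forall w \near x t, V w by apply: open_nbhs_nbhs.
  have e4 : 0 < e / 4 by rewrite divr_gt0.
  have [r hr] : exists r : rat, e / 4 < ratr r < e / 2.
    have : e / 4 < e / 2 by lra.
    by move=> /rat_in_itvoo [r]; rewrite in_itv /= => h; exists r.
  have hq i : exists q : rat, `|x t 0 i - ratr q| < e / 4.
    have : x t 0 i - e / 4 < x t 0 i + e / 4 by lra.
    move=> /rat_in_itvoo [q]; rewrite in_itv /= => /andP[h1 h2]; exists q.
    by rewrite ltr_norml; lra.
  have [q hq'] := choice hq.
  have qE i : (\row_i q i) 0 i = q i by rewrite mxE.
  exists (\row_i q i, r) => //; split => [w hw|i] /=.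
    apply: he; apply: (@le_lt_trans _ _ (e * (3 / 4))); last by lra.
    apply: norm_le_coord => [|i]; first by rewrite mulr_ge0 // ltW.
    have := hw i; rewrite /= qE !mxE => h1; have := hq' i => h2.
    have := ler_normD (w 0 i - ratr (q i)) (ratr (q i) - x t 0 i).
    by rewrite addrA subrK [`|ratr _ - _|]distrC; lra.
  by rewrite qE (lt_trans (hq' i)) //; lra.
apply: countable_bigcupT_measurable; first exact: countableP.
move=> qr; have [h|h] := pselect (cube qr `<=` V); last first.
  by rewrite (_ : E qr = set0) //; apply/seteqP; split => // t [].
rewrite (_ : E qr = [set t | forall i, [set r : R | `|r - ratr (qr.1 0 i)| < ratr qr.2] (x t 0 i)]).
  apply: (@measurable_coord_box (fun i => [set r : R | `|r - ratr (qr.1 0 i)| < ratr qr.2])) => i.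
  rewrite (_ : [set r | _] = `]ratr (qr.1 0 i) - ratr qr.2, ratr (qr.1 0 i) + ratr qr.2[%classic) //.
  by apply/seteqP; split => r /=; rewrite in_itv /= ltr_norml; lra.
by apply/seteqP; split => [t []|t].
Qed.

Definition cell_side (i : 'I_n.+1) : set R :=
  if unlift ord_max i is Some j then [set r | 0 <= r < B j j] else [set r | 0 <= r <= 1].

Definition cell : set T := [set t | forall i, cell_side i (x t 0 i)].

Lemma cell_side_lift j : cell_side (lift ord_max j) = [set r | 0 <= r < B j j].
Proof. by rewrite /cell_side liftK. Qed.

Lemma cell_side_max : cell_side ord_max = [set r | 0 <= r <= 1].
Proof. by rewrite /cell_side unlift_none. Qed.

Lemma itv_coE (e : R) : [set r | 0 <= r < e] = `[0, e[%classic.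
Proof. by apply/seteqP; split => r /=; rewrite in_itv. Qed.

Lemma itv_ccE (a b : R) : [set r | a <= r <= b] = `[a, b]%classic.
Proof. by apply/seteqP; split => r /=; rewrite in_itv. Qed.

Lemma measurable_cell_side i : measurable (cell_side i).
Proof.
case: (unliftP ord_max i) => [j|] ->; first by rewrite cell_side_lift itv_coE.
by rewrite cell_side_max itv_ccE.
Qed.

Lemma measurable_cell : measurable cell.
Proof. exact: (@measurable_coord_box cell_side measurable_cell_side). Qed.

Lemma nu_cell : nu cell = (\prod_i B i i)%:E.
Proof.
rewrite (nu_box (a := fun i => if unlift ord_max i is Some j then B j j else 1)).
- rewrite big_ord_recr /= unlift_none mulr1; congr _%:E; apply: eq_bigr => j _.
  by rewrite (_ : widen_ord _ j = lift ord_max j) ?liftK //; apply/val_inj; rewrite [RHS]lift_max.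
- exact: measurable_cell_side.
move=> i; case: (unliftP ord_max i) => [j|] ->.
  by rewrite cell_side_lift itv_coE lebesgue_measure_itv /= lte_fin dB -EFinD subr0.
by rewrite cell_side_max itv_ccE lebesgue_measure_itv /= lte_fin ltr01 -EFinD subr0.
Qed.

Definition pcell (t : T) : borel (cyl R n) := proj B (x t).

Lemma measurable_pcell : measurable_fun setT pcell.
Proof.
apply: (@measurability _ _ T (borel (cyl R n)) setT pcell (@open (cyl R n))) => // _ [V oV <-]; rewrite setTI.
apply: (measurable_coord_open (V := proj B @^-1` V)).
by apply: open_comp => // y _; exact: continuous_proj.
Qed.

(** The image under the covering projection of Lebesgue measure restricted to a fundamental cell. *)
Definition cyl_volume : {measure set (borel (cyl R n)) -> \bar R} :=
  @measure_function_pushforward__canonical__measure_function_Measure _ _ _ _ R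
    (mrestr nu measurable_cell) pcell measurable_pcell.

Lemma cyl_volumeE A : cyl_volume A = nu (pcell @^-1` A `&` cell).
Proof. by []. Qed.

Let lam (m : 'rV[int]_n) : W := mkpt (intv R m *m B) 0.

Lemma lebesgue_shift_itv (a b c l : R) :
  lebesgue_measure [set r : R | a <= r - l <= b /\ 0 <= r < c] =
  lebesgue_measure [set r : R | a <= r <= b /\ 0 <= r + l < c].
Proof.
rewrite (_ : [set r | _] = [set r | a + l <= r <= b + l /\ 0 <= r < c]); last first.
  by apply/seteqP; split => r /=; lra.
rewrite (_ : [set r | a <= r <= b /\ _] = [set r | a <= r <= b /\ - l <= r < c - l]); last first.
  by apply/seteqP; split => r /=; lra.
rewrite !lebesgue_itvI; congr (Num.max 0 _)%:E.
rewrite /Num.min /Num.max; case: (ltP (b + l) c); case: (ltP (a + l) 0); case: (ltP b (c - l)); case: (ltP a (- l)); lra.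
Qed.

(** Cut and paste: the preimage of the projected box in the cell consists of pieces of lattice
    translates of the box, and moving the pieces back reassembles the box. *)
Lemma cyl_volume_box (y : 'rV[R]_n) (a b : W) : (forall i, a 0 i <= b 0 i) ->
  (forall w, box a b w -> near_unitc B y w /\ 0 <= ver w <= 1) ->
  cyl_volume (proj B @` box a b) = (\prod_i (b 0 i - a 0 i))%:E.
Proof.
move=> ab hQ; rewrite cyl_volumeE.
have aQ : box a b a by move=> i; rewrite lexx ab.
have bQ : box a b b by move=> i; rewrite lexx ab.
have [[_ /andP[a0 _]] [_ /andP[_ b1]]] := (hQ _ aQ, hQ _ bQ).
(* [E1 m] is the part of the cell inside the box translated by [lam m]; [E2 m] is the same piece
   moved back into the box. Both are products of intervals with equal side lengths, so [nu_box]
   gives them equal measure. *)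
pose S1 m i : set R := [set r | a 0 i <= r - lam m 0 i <= b 0 i /\ cell_side i r].
pose S2 m i : set R := [set r | a 0 i <= r <= b 0 i /\ cell_side i (r + lam m 0 i)].
pose E1 m : set T := [set t | forall i, S1 m i (x t 0 i)].
pose E2 m : set T := [set t | forall i, S2 m i (x t 0 i)].
have subE m t i : (x t - lam m) 0 i = x t 0 i - lam m 0 i by rewrite mxE; congr (_ + _); rewrite mxE.
have lam_max m : lam m 0 ord_max = 0 by rewrite mkpt_max.
have S1max m : S1 m ord_max = `[a 0 ord_max, b 0 ord_max]%classic.
  rewrite /S1 lam_max cell_side_max -itv_ccE; apply/seteqP; split => r /=; rewrite subr0; first by case.
  by rewrite /ver in a0 b1; lra.
have S2max m : S2 m ord_max = `[a 0 ord_max, b 0 ord_max]%classic.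
  rewrite /S2 lam_max cell_side_max -itv_ccE; apply/seteqP; split => r /=; rewrite addr0; first by case.
  by rewrite /ver in a0 b1; lra.
have mS1 m i : measurable (S1 m i).
  rewrite (_ : S1 m i = `[a 0 i + lam m 0 i, b 0 i + lam m 0 i]%classic `&` cell_side i).
    exact: (measurableI _ _ (measurable_itv _) (measurable_cell_side i)).
  rewrite -itv_ccE; apply/seteqP; split => r /= [h1 h2]; split => //; lra.
have mS2 m i : measurable (S2 m i).
  case: (unliftP ord_max i) => [j|] ->; last by rewrite S2max.
  rewrite (_ : S2 m _ = `[a 0 (lift ord_max j), b 0 (lift ord_max j)]%classic `&`
    `[- lam m 0 (lift ord_max j), B j j - lam m 0 (lift ord_max j)[%classic).
    exact: (measurableI _ _ (measurable_itv _) (measurable_itv _)).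
  rewrite /S2 cell_side_lift; apply/seteqP; split => r /=; rewrite !in_itv /= => -[h1 h2]; split => //; lra.
have S12 m i : lebesgue_measure (S1 m i) = lebesgue_measure (S2 m i).
  case: (unliftP ord_max i) => [j|] ->; last by rewrite S1max S2max.
  by rewrite /S1 /S2 cell_side_lift lebesgue_shift_itv.
have fS2 m i : exists e : R, lebesgue_measure (S2 m i) = e%:E.
  case: (unliftP ord_max i) => [j|] ->.
    rewrite -S12 /S1 cell_side_lift lebesgue_shift_itv.
    rewrite (_ : [set r | _] = [set r | a 0 (lift ord_max j) <= r <= b 0 (lift ord_max j) /\
      - lam m 0 (lift ord_max j) <= r < B j j - lam m 0 (lift ord_max j)]).
      by rewrite lebesgue_itvI; eexists.
    by apply/seteqP; split => r /=; lra.
  rewrite S2max lebesgue_measure_itv /= lte_fin; case: ifP => _; last by exists 0.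
  by rewrite -EFinD; eexists.
have E12 m : nu (E1 m) = nu (E2 m).
  have [e he] := choice (fS2 m).
  by rewrite (nu_box (a := e)) // ?(nu_box (a := e)) // => i; rewrite S12.
have -> : pcell @^-1` (proj B @` box a b) `&` cell = \bigcup_m E1 m.
  apply/seteqP; split => [t [[w Qw e] ct]|t [m _ ht]].
    have [e1 [m e2]] := (proj_eq uB w (x t)).1 e.
    have [nw w01] := hQ _ Qw.
    have vx : 0 <= ver (x t) <= 1 by have := ct ord_max; rewrite cell_side_max.
    rewrite !clampE // in e1.
    have xw : x t = w + lam (- m).
      apply/mkptP; rewrite linearD /= /lam ?hor_mkpt ?ver_mkpt ?addr0 //.
      by rewrite e2 intvN mulNmx addrK.
    exists (- m) => // i; rewrite /S1 /= {1 2}xw mxE addrK; split; [exact: Qw|exact: ct].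
  have ct : cell t by move=> i; have [] := ht i.
  split => //; exists (x t - lam m) => [i|].
    by have [h _] := ht i; rewrite subE.
  apply/(proj_eq uB); rewrite linearB /= /lam ver_mkpt subr0; split => //.
  by exists (- m); rewrite linearB /= hor_mkpt intvN mulNmx.
(* The pieces [E1] are disjoint because the box spans less than a period in each lattice direction,
   the pieces [E2] because reduction to the cell is unique. *)
rewrite (measure_bigcup_eq (E' := E2)) //; last 4 first.
- by move=> m; exact: measurable_coord_box.
- by move=> m; exact: measurable_coord_box.
- move=> m m' t h1 h2.
  have [n1 _] : near_unitc B y (x t - lam m) /\ 0 <= ver (x t - lam m) <= 1.
    by apply: hQ => i; rewrite subE; have [] := h1 i.
  have [n2 _] : near_unitc B y (x t - lam m') /\ 0 <= ver (x t - lam m') <= 1.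
    by apply: hQ => i; rewrite subE; have [] := h2 i.
  apply/rowP => i; apply/eqP; rewrite -(eqr_int R) -subr_eq0.
  have := n1 i; have := n2 i.
  have uE m0 : unitc B (x t - lam m0) 0 i = unitc B (x t) 0 i - (m0 0 i)%:~R.
    by rewrite /unitc linearB /= mulmxBl /lam hor_mkpt mulmxK // !mxE.
  rewrite !uE => h3 h4.
  rewrite -intrB intr_eq0; have : `|(m 0 i - m' 0 i)%:~R : R| < 1.
    rewrite intrB; move: h3 h4; rewrite !ltr_norml; lra.
  by rewrite -intr_norm -[1]/(1%:~R) ltr_int; lia.
- move=> m m' t h1 h2; apply/eqP; rewrite -subr_eq0; apply/eqP.
  apply: (lattice_reduce_uniq tB dB) => j.
  have [_] := h1 (lift ord_max j); have [_] := h2 (lift ord_max j).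
  rewrite cell_side_lift /= /lam !mkpt_lift => h3 h4.
  have -> : (intv R (m - m') *m B) 0 j = (intv R m *m B) 0 j - (intv R m' *m B) 0 j.
    by rewrite intvB mulmxBl mxE; congr (_ + _); rewrite mxE.
  by rewrite ltr_norml; lra.
(* Every point of the box can be reduced to the cell, so the pieces [E2] fill the box. *)
have <- : [set t | forall i, `[a 0 i, b 0 i]%classic (x t 0 i)] = \bigcup_m E2 m.
  apply/seteqP; split => [t ht|t [m _ ht] i]; last first.
    by have [h _] := ht i; rewrite /= in_itv.
  have [m hm] := lattice_reduce tB dB (hor (x t)).
  exists m => // i; have := ht i; rewrite /= in_itv /= => h; split => //.
  case: (unliftP ord_max i) h => [j|] -> h.
    rewrite cell_side_lift /= /lam mkpt_lift; have := hm j.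
    by rewrite mxE horE.
  rewrite cell_side_max /= /lam mkpt_max addr0; move: h a0 b1; rewrite /ver; lra.
apply: (etrans (nu_box (A := fun i => `[a 0 i, b 0 i]%classic) (a := fun i => b 0 i - a 0 i) _ _)) => // i.
rewrite lebesgue_measure_itv /= lte_fin; case: ltP => h; first by rewrite -EFinD.
by congr _%:E; have := ab i; lra.
Qed.

Lemma flipb_box b (a1 b1 : W) : (forall i, a1 0 i <= b1 0 i) -> exists a2 b2 : W,
  [/\ (forall i, a2 0 i <= b2 0 i), flipb b @` box a1 b1 = box a2 b2 &
    \prod_i (b2 0 i - a2 0 i) = \prod_i (b1 0 i - a1 0 i)].
Proof.
case: b => ab; last by exists a1, b1; split => //; rewrite image_id.
exists (mkpt (hor a1) (1 - ver b1)), (mkpt (hor b1) (1 - ver a1)); split.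
- move=> i; case: (unliftP ord_max i) => [j|] ->; rewrite ?mkpt_lift ?mkpt_max ?horE //.
  by rewrite lerD2l lerN2; exact: ab.
- have boxE a3 b3 w : box a3 b3 w <-> (forall j, hor a3 0 j <= hor w 0 j <= hor b3 0 j) /\ ver a3 <= ver w <= ver b3.
    split => [h|[h1 h2] i]; first by split => [j|]; [rewrite !horE|]; exact: h.
    by case: (unliftP ord_max i) => [j|] -> //; have := h1 j; rewrite !horE.
  apply/seteqP; split => [_ [w /boxE [h1 h2] <-]|w /boxE [h1 h2]].
    by apply/boxE; rewrite !hor_mkpt !ver_mkpt; split => //; lra.
  exists (flip w); last by rewrite /= flipK.
  by move: h1 h2; rewrite !hor_mkpt !ver_mkpt => h1 h2; apply/boxE; rewrite hor_mkpt ver_mkpt; split => //; lra.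
apply: eq_bigr => i _; case: (unliftP ord_max i) => [j|] ->; rewrite ?mkpt_lift ?mkpt_max ?horE //.
by rewrite /ver opprB addrC addrA subrK.
Qed.

Lemma cyl_volume_chart c (a b : W) : fatlas B c ->
  (forall i, a 0 i <= b 0 i) -> box a b `<=` cod c ->
  cyl_volume (bwd c @` box a b) = (\prod_i (b 0 i - a 0 i))%:E.
Proof.
move=> [y [fl ->]] ab; rewrite fchart_cod // => hc.
have [a2 [b2 [ab2 e1 <-]]] := flipb_box fl ab.
rewrite (_ : bwd _ @` _ = proj B @` box a2 b2); last first.
  by rewrite -e1 image_comp.
apply: (@cyl_volume_box y) => // w; rewrite -e1 => -[w' /hc [h1 h2] <-].
rewrite ver_flipb; split; last by case: fl {e1}; lra.
by move=> i; rewrite /unitc hor_flipb; exact: h1.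
Qed.

Lemma nu_cell_face (z : R) : 0 <= z <= 1 ->
  measurable [set t | cell t /\ ver (x t) = z] /\ nu [set t | cell t /\ ver (x t) = z] = 0%E.
Proof.
move=> z01; pose A (i : 'I_n.+1) := if unlift ord_max i is Some j then `[0, B j j[%classic else `[z, z]%classic.
pose a (i : 'I_n.+1) := if unlift ord_max i is Some j then B j j else 0.
have mA i : measurable (A i) by rewrite /A; case: unliftP.
have hA i : lebesgue_measure (A i) = (a i)%:E.
  rewrite /A /a; case: unliftP => [j _|_]; rewrite lebesgue_measure_itv /= lte_fin ?dB ?ltxx //.
  by rewrite -EFinD subr0.
have -> : [set t | cell t /\ ver (x t) = z] = [set t | forall i, A i (x t 0 i)].
  apply/seteqP; split => [t [ct vt] i|t ht].
    rewrite /A; case: unliftP (ct i) => [j|] ->; last by rewrite -/(ver _) vt /= in_itv /= lexx.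
    by rewrite cell_side_lift /= in_itv.
  have vt : ver (x t) = z.
    have := ht ord_max; rewrite /A unlift_none /= in_itv /= => h; apply/eqP.
    by rewrite eq_le andbC.
  split => // i; have := ht i; rewrite /A; case: unliftP => [j|] ->.
    by rewrite cell_side_lift /= in_itv.
  by rewrite cell_side_max /= -/(ver _) vt.
split; first exact: measurable_coord_box.
rewrite (nu_box mA hA) (bigD1 ord_max) //= /a unlift_none mul0r //.
Qed.

Lemma cyl_volume_boundary : cyl_volume (~` atlas_interior (fatlas B)) = 0%E.
Proof.
rewrite fatlas_interior // cyl_volumeE.
have [m0 h0] : measurable [set t | cell t /\ ver (x t) = 0] /\ nu [set t | cell t /\ ver (x t) = 0] = 0%E.
  by apply: nu_cell_face; lra.
have [m1 h1] : measurable [set t | cell t /\ ver (x t) = 1] /\ nu [set t | cell t /\ ver (x t) = 1] = 0%E.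
  by apply: nu_cell_face; lra.
have -> : pcell @^-1` (~` [set p | 0 < cht p < 1]) `&` cell =
    [set t | cell t /\ ver (x t) = 0] `|` [set t | cell t /\ ver (x t) = 1].
  have chtE t : cell t -> cht (pcell t) = ver (x t) /\ 0 <= ver (x t) <= 1.
    by move=> /(_ ord_max); rewrite cell_side_max /= => h; rewrite /pcell ver_proj.
  apply/seteqP; split => [t [h ct]|t].
    have [e /andP[v0 v1]] := chtE _ ct; rewrite /= e in h.
    have [v0'|v0'] := eqVneq (ver (x t)) 0; first by left.
    right; split => //; apply: contrapT => /eqP v1'; apply: h.
    by rewrite !lt_def v0' v0 eq_sym v1'.
  by move=> [] [ct e]; have [e1 _] := chtE _ ct; split => //=; rewrite e1 e ltxx ?andbF.
by rewrite (measureU0 m0 m1).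
Qed.

Lemma cyl_volume_lty : (cyl_volume setT < +oo)%E.
Proof. by rewrite cyl_volumeE preimage_setT setTI nu_cell ltry. Qed.

Lemma continuous_measurable_borel (f : cyl R n -> R) : continuous f ->
  measurable_fun [set: borel (cyl R n)] (f : borel (cyl R n) -> R).
Proof.
move=> cf; apply: (@measurability _ _ (borel (cyl R n)) (measurableTypeR R) setT f (@RGenOpens.G R)).
  exact: RGenOpens.measurableE.
move=> _ [_ [a [b ->]] <-]; rewrite setTI; apply: sub_sigma_algebra; apply: open_comp; last exact: interval_open.
by move=> p _; exact: cf.
Qed.

Lemma cyl_volume_integral (f : cyl R n -> R) (C : R) : continuous f -> (forall p, `|f p| <= C) ->
  (\int[cyl_volume]_p (f p)%:E = \int[mrestr nu measurable_cell]_t (f (proj B (x t)))%:E)%E.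
Proof.
move=> cf fC; have mf := continuous_measurable_borel cf.
apply: (etrans (integral_pushforward measurable_pcell (mu := mrestr nu measurable_cell) (D := setT) (f := EFin \o f) _ _ _)) => //.
  exact/measurable_EFinP.
rewrite preimage_setT; apply: (measurable_bounded_integrable (f := f \o pcell)) => //.
- by rewrite /= /mrestr setTI nu_cell ltry.
- exact: measurableT_comp mf measurable_pcell.
by exists C; split; rewrite ?num_real // => y Cy t _; exact: le_trans (fC _) (ltW Cy).
Qed.

End Volume.

(** * The heat flow *)

Section Antiderivative.
Context {R : realType}.
Variables (f : R -> R).
Hypothesis cf : continuous f.

Let G (A y : R) : R := (\int[lebesgue_measure]_(t in `[- A, y]) f t)%R.

Let dG A (y : R) : - A < y -> is_derive y 1 (G A) (f y).
Proof.
move=> Ay; have yy : y < y + 1 by rewrite ltrDl.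
have fi : lebesgue_measure.-integrable `[- A, y + 1] (EFin \o f).
  apply: continuous_compact_integrable; first exact: segment_compact.
  by apply: continuous_subspaceT => z; exact: cf.
have [h1 h2] := continuous_FTC1_closed yy fi Ay (@cf y).
by rewrite derive1E in h2; exact: (DeriveDef h1 h2).
Qed.

(** The integrals from [- A] are antiderivatives only to the right of [- A]; their increments from 0
    do not depend on [A], so they glue to a function on the whole line. *)
Lemma antiderivative : exists F : R -> R, forall y : R, is_derive y 1 F (f y).
Proof.
pose D A y := G A y - G A 0.
have indep A A' y : `|y| < A -> `|y| < A' -> D A y = D A' y.
  move=> yA yA'; pose m := Num.min A A'.
  have ym : `|y| < m by rewrite lt_min yA.
  have [mA mA'] : m <= A /\ m <= A' by rewrite /m !ge_min !lexx ?orbT.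
  have := @itv_const R (fun y => G A y - G A' y) (- m) m.
  have dd (z : R) : - m < z < m -> is_derive z 1 (fun y => G A y - G A' y) 0.
    move=> /andP[z1 _]; rewrite -(subrr (f z)).
    apply: (is_deriveB (dG _) (dG _)); apply: le_lt_trans z1; rewrite lerN2 //.
  move=> /(_ dd y 0); rewrite -ltr_norml -ltr_norml normr0 => /(_ ym (le_lt_trans (normr_ge0 _) ym)).
  rewrite /D; lra.
exists (fun y => D (`|y| + 1) y) => y.
have E : \forall z \near y, D (`|y| + 2) z = D (`|z| + 1) z.
  have n1 : \forall z \near y, `|y - z| < 1.
    by apply/nbhs_ballP; exists 1 => //=.
  apply: (near_sub n1) => z hz; have := ler_dist_dist y z; have := ler_norm (`|z| - `|y|).
  by rewrite (distrC `|z|) => h1 h2; apply: indep; lra.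
apply: (near_eq_is_derive E).
have h := dG (A := `|y| + 2) (y := y); have h' : - (`|y| + 2) < y by have := ler_norm (- y); rewrite normrN; lra.
have := is_deriveB (h h') (is_derive_cst (G (`|y| + 2) 0) y 1).
by rewrite subr0.
Qed.

End Antiderivative.

Section ComplementaryError.
Context {R : realType}.

(** Gaussian decay is weakened to exponential decay, which makes all the image sums below comparable
    to geometric series. *)
Lemma expR_sqr_le (y : R) : expR (- y ^+ 2) <= expR 1 * expR (- y).
Proof. by rewrite -expRD ler_expR; nra. Qed.

Lemma mul_expR_sqr_le (y : R) : `|y| * expR (- y ^+ 2) <= expR 1 * expR (- y).
Proof.
have h1 : `|y| <= expR (y ^+ 2 / 2).
  apply: le_trans (expR_ge1Dx _); have := real_normK (num_real y).
  by set a := `|y| => <-; nra.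
apply: (@le_trans _ _ (expR (y ^+ 2 / 2) * expR (- y ^+ 2))); first by rewrite ler_wpM2r // expR_ge0.
by rewrite -!expRD ler_expR; nra.
Qed.

(* The complementary error function [2 / sqrt pi * \int_y^oo exp (- s ^ 2) ds];
   the normalising constant does not matter. *)
Lemma erfc_ex : exists (F : R -> R) (c C : R),
  [/\ F 0 = 1, 0 < C, (forall y, `|F y| <= C * expR (- y)) &
      forall y : R, is_derive y 1 F (- c * expR (- y ^+ 2))].
Proof.
have ce : continuous (fun y : R => expR (- y ^+ 2)).
  move=> y; apply: (@ct_comp _ _ _ (fun y : R => - y ^+ 2) expR); last exact: continuous_expR.
  by apply: cvgN; exact: (cvgM cvg_id cvg_id).
have [G dG] := antiderivative ce.
have mono (F F' : R -> R) : (forall y : R, is_derive y 1 F (F' y)) -> (forall y, 0 <= F' y) ->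
    forall y z, y <= z -> F y <= F z.
  move=> dF F'0 y z yz.
  have [|s hs] := @MVT_segment R F F' y z yz.
    by apply: continuous_in_subspaceT => t _; exact: (is_derive1_continuous (dF t)).
  by move=> e; rewrite -subr_ge0 e mulr_ge0 // subr_ge0.
have Gmono := mono _ _ dG (fun y => expR_ge0 _).
(* [K] is nondecreasing by [expR_sqr_le], so [G] never exceeds [G y + expR 1 * expR (- y)]; this
   bounds the supremum [L] and the tail [L - G y] at once. *)
pose K y := - (G y + expR 1 * expR (- y)).
have dK (y : R) : is_derive y 1 K (expR 1 * expR (- y) - expR (- y ^+ 2)).
  have d1 : is_derive y 1 (fun y : R => expR (- y)) (- expR (- y)).
    have := is_derive1_comp (is_derive_expR (- y)) (is_deriveN (is_derive_id y 1)).
    by congr is_derive; rewrite mulrN1.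
  have := is_deriveN (is_deriveD (dG y) (is_deriveZ (expR 1) d1)).
  by congr is_derive; rewrite /GRing.scale /=; ring.
have Kmono := mono _ _ dK (fun y => ltac:(rewrite subr_ge0; exact: expR_sqr_le)).
pose A := range G.
have ubA : has_ubound A.
  exists (G 0 + expR 1 * expR 0) => _ [y _ <-].
  have [y0|/ltW y0] := lerP y 0.
    by rewrite (le_trans (Gmono _ _ y0)) // lerDl mulr_ge0 ?expR_ge0.
  have := Kmono _ _ y0; rewrite /K oppr0 lerN2; apply: le_trans.
  by rewrite lerDl mulr_ge0 ?expR_ge0.
have supA : has_sup A by split => //; exists (G 0), 0.
pose L := sup A.
have GL y : G y <= L by apply: ub_le_sup => //; exists y.
have LK y : L <= G y + expR 1 * expR (- y).
  apply: ge_sup; first by exists (G 0), 0.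
  move=> _ [z _ <-]; have [zy|/ltW yz] := lerP z y.
    by rewrite (le_trans (Gmono _ _ zy)) // lerDl mulr_ge0 ?expR_ge0.
  have := Kmono _ _ yz; rewrite /K lerN2; apply: le_trans.
  by rewrite lerDl mulr_ge0 ?expR_ge0.
have G01 : G 0 < L.
  apply: (@lt_le_trans _ _ (G 1)) => //.
  have [|s hs] := @MVT_segment R G _ 0 1 ler01 (fun t _ => dG t).
    by apply: continuous_in_subspaceT => t _; exact: (is_derive1_continuous (dG t)).
  by move=> e; rewrite -subr_gt0 e subr0 mulr1 expR_gt0.
have LG : 0 < L - G 0 by rewrite subr_gt0.
exists (fun y => (L - G 0)^-1 * (L - G y)), ((L - G 0)^-1), ((L - G 0)^-1 * expR 1); split.
- by rewrite mulVf // gt_eqF.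
- by rewrite mulr_gt0 ?invr_gt0 // expR_gt0.
- move=> y; rewrite normrM ger0_norm ?invr_ge0 ?(ltW LG) // -mulrA ler_pM2l ?invr_gt0 //.
  by rewrite ger0_norm ?subr_ge0 // lerBlDl.
move=> y; have := is_deriveZ (L - G 0)^-1 (is_deriveB (is_derive_cst L y 1) (dG y)).
by congr is_derive; rewrite /GRing.scale /= sub0r mulNr mulrN.
Qed.

End ComplementaryError.

Definition ssum (R : realType) (f : nat -> R) : R := limn (series f).

(** * Series dominated by a geometric series *)

Section DominatedTail.
Context {R : realType}.
Variables (K q : R).
Hypotheses (K0 : 0 <= K) (q01 : 0 <= q < 1).

Let q0 : 0 <= q. Proof. by case/andP: q01. Qed.
Let q1 : `|q| < 1. Proof. by rewrite ger0_norm //; case/andP: q01. Qed.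
Let q1' : 0 < 1 - q. Proof. by rewrite subr_gt0; case/andP: q01. Qed.

Lemma geo_dominated_tail (f : nat -> R) N : (forall j, `|f j| <= K * q ^+ j) ->
  cvgn (series f) /\ `|ssum f - series f N| <= K * q ^+ N / (1 - q).
Proof.
move=> hf.
have cg := is_cvg_geometric_series (a := K) q1.
have cn : cvgn [normed series f].
  apply: (series_le_cvg _ _ _ cg) => n //=; first [exact: hf|by rewrite mulr_ge0 // exprn_ge0].
have cf := normed_cvg cn; split => //.
suff H M : (N <= M)%N -> `|series f M - series f N| <= K * q ^+ N / (1 - q).
  have c : (`|series f M - series f N| @[M --> \oo]) --> `|ssum f - series f N|.
    by apply: cvg_norm; apply: cvgB; [exact: cf|exact: cvg_cst].
  rewrite -(cvg_lim _ c) //; apply: limr_le; first by apply/cvg_ex; eexists; exact: c.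
  by exists N => // M /= /H.
move=> NM; rewrite sub_series_geq //.
apply: (le_trans (ler_norm_sum _ _ _)).
apply: (@le_trans _ _ (\sum_(N <= k < M) K * q ^+ k)); first by apply: ler_sum => k _.
rewrite -mulr_sumr -mulrA ler_wpM2l //.
have -> : \sum_(N <= k < M) q ^+ k = (q ^+ N - q ^+ M) / (1 - q).
  elim: M NM => [|M IH]; first by rewrite leqn0 => /eqP ->; rewrite big_nil subrr mul0r.
  rewrite leq_eqVlt => /orP[/eqP ->|NM]; first by rewrite big_geq // subrr mul0r.
  by rewrite big_nat_recr //= IH // exprS; field; rewrite gt_eqF.
by rewrite ler_pM2r ?invr_gt0 // lerBlDr lerDl exprn_ge0.
Qed.

Lemma geo_small (e : R) : 0 < e -> exists N, K * q ^+ N / (1 - q) < e.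
Proof.
move=> e0.
have : (K * q ^+ N / (1 - q)) @[N --> \oo] --> (0 : R).
  have := cvgM (cvgM (cvg_cst K) (cvg_expr q1)) (cvg_cst (1 - q)^-1).
  by rewrite mulr0 mul0r; apply.
move=> /cvgrPdist_lt /(_ e e0) [N _ /(_ N (leqnn N))] /=.
by rewrite sub0r normrN => h; exists N; apply: le_lt_trans h; exact: ler_norm.
Qed.

End DominatedTail.

Section DominatedSeries.
Context {R : realType}.

Lemma is_derive_epsP (F : R -> R) (t d : R) : is_derive t 1 F d ->
  forall e, 0 < e -> \forall h \near (0 : R), `|F (h + t) - F t - h * d| <= e * `|h|.
Proof.
move=> [/cvg_ex[d' hd] dE] e e0.
have {dE} e' : d' = d by rewrite -dE; apply/esym; exact: cvg_lim hd.
rewrite {}e' in hd.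
have H : \forall h \near (0 : R), h != 0 -> `|d - h^-1 *: ((F \o shift t) h%:A - F t)| <= e.
  by have := cvgr_dist_le _ _ hd _ e0; rewrite near_withinE; apply.
apply: (near_sub H) => h hh; have [->|hN] := eqVneq h 0.
  by rewrite add0r subrr mul0r subr0 normr0 mulr0.
have := hh hN; rewrite /= [h%:A]mulr1 /GRing.scale /= => h1.
have -> : F (h + t) - F t - h * d = - (h * (d - h^-1 * (F (h + t) - F t))).
  by field.
by rewrite normrN normrM mulrC ler_wpM2r.
Qed.

Lemma is_derive_shift (F : R -> R) (s t d : R) : is_derive (s + t) 1 F d ->
  is_derive s 1 (fun s => F (s + t)) d.
Proof.
move=> dF; have := @is_derive1_comp _ F (fun s => s + t) s _ _ dF (is_deriveD (is_derive_id s 1) (is_derive_cst t s 1)).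
by congr is_derive; rewrite addr0 mulr1.
Qed.

Variables (K q : R).
Hypotheses (K0 : 0 <= K) (q01 : 0 <= q < 1).

Lemma ssum_continuous (T : topologicalType) (f : nat -> T -> R) (t : T) :
  (forall j, {for t, continuous (f j)}) ->
  (\forall s \near t, forall j, `|f j s| <= K * q ^+ j) ->
  {for t, continuous (fun s => ssum (fun j => f j s))}.
Proof.
move=> cf hf; apply/cvgrPdist_lt => e e0.
have e3 : 0 < e / 3 by rewrite divr_gt0.
have [N hN] := geo_small K q01 e3.
have cN : {for t, continuous (fun s => series (fun j => f j s) N)}.
  by rewrite /series /=; apply: (@cvg_sumr _ _ (nbhs t) _) => j _; exact: cf.
have nN : \forall s \near t, `|series (fun j => f j t) N - series (fun j => f j s) N| < e / 3.
  exact: (cvgr_dist_lt _ _ cN _ e3).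
near=> s.
have [_ h1] := geo_dominated_tail K0 q01 N (nbhs_singleton hf).
have hs : forall j, `|f j s| <= K * q ^+ j by near: s.
have [_ h2] := @geo_dominated_tail _ K q K0 q01 (fun j => f j s) N hs.
have : `|series (fun j => f j t) N - series (fun j => f j s) N| < e / 3 by near: s.
move: h1 h2; set a := ssum _; set b := ssum _; set a' := series _ _; set b' := series _ _ => h1 h2 h3.
move: (le_lt_trans h1 hN) (le_lt_trans h2 hN) h3; rewrite !ltr_norml; lra.
Unshelve. all: by end_near. Qed.

(** Termwise differentiation. The remainders [D j h] are at most [2 * K * |h| * q ^+ j] by the mean
    value theorem, which controls the tail; the finitely many other terms are differentiable. *)
Lemma ssum_is_derive (f f' : nat -> R -> R) (t d : R) : 0 < d ->
  (forall j (s : R), `|s - t| < d -> is_derive s 1 (f j) (f' j s)) ->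
  (forall j s, `|s - t| < d -> `|f j s| <= K * q ^+ j) ->
  (forall j s, `|s - t| < d -> `|f' j s| <= K * q ^+ j) ->
  is_derive t 1 (fun s => ssum (fun j => f j s)) (ssum (fun j => f' j t)).
Proof.
move=> d0 df bf bf'; apply: is_derive_eps => e e0.
have tt : `|t - t| < d by rewrite subrr normr0.
pose D j h := f j (h + t) - f j t - h * f' j t.
have e2 : 0 < e / 2 by rewrite divr_gt0.
have [N hN] := geo_small (2 * K) q01 e2.
have nN e' : 0 < e' -> \forall h \near (0 : R), `|series (fun j => D j h) N| <= e' * `|h|.
  elim: N {hN} e' => [|N IH] e' e'0.
    by near=> h; rewrite /series /= big_geq // normr0 mulr_ge0 // ltW.
  have e'2 : 0 < e' / 2 by rewrite divr_gt0.
  have n1 := IH _ e'2; have n2 := is_derive_epsP (df N t tt) e'2.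
  near=> h.
  have h1 : `|series (fun j => D j h) N| <= e' / 2 * `|h| by near: h.
  have h2 : `|D N h| <= e' / 2 * `|h| by near: h.
  rewrite seriesSr; apply: (le_trans (ler_normD _ _)).
  lra.
have n1 := nN _ e2; have n2 : \forall h \near (0 : R), `|h| < d by exact: nbhs0_lt.
near=> h.
have hd : `|h| < d by near: h.
have htd : `|h + t - t| < d by rewrite addrK.
have bD j : `|D j h| <= 2 * K * `|h| * q ^+ j.
  have dj (s : R) : `|s| < d -> is_derive s 1 (fun s => f j (s + t)) (f' j (s + t)).
    by move=> sd; apply: is_derive_shift; apply: df; rewrite addrK.
  have [s hs e1] := mvt_near0 dj hd.
  have sd : `|s + t - t| < d by rewrite addrK (le_lt_trans hs).
  rewrite add0r in e1.
  rewrite /D e1 (mulrC h) -mulrBl normrM.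
  have := ler_normB (f' j (s + t)) (f' j t); have := bf' j _ sd; have := bf' j _ tt.
  set A := `|_ - _|; have := normr_ge0 h; set B := K * q ^+ j; set H := `|h| => H0 b1 b2 b3.
  have -> : 2 * K * H * q ^+ j = 2 * B * H by rewrite /B; ring.
  by apply: ler_wpM2r => //; lra.
have KK : 0 <= 2 * K * `|h| by rewrite !mulr_ge0.
have [_ hT] := geo_dominated_tail KK q01 N bD.
have [c1 _] := geo_dominated_tail K0 q01 0 (fun j => bf j _ htd).
have [c2 _] := geo_dominated_tail K0 q01 0 (fun j => bf j _ tt).
have [c3 _] := geo_dominated_tail K0 q01 0 (fun j => bf' j _ tt).
have E : ssum (fun j => f j (h + t)) - ssum (fun j => f j t) - h * ssum (fun j => f' j t) = ssum (fun j => D j h).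
  apply/esym; apply: cvg_lim => //.
  rewrite (_ : series (fun j => D j h) = fun M => series (fun j => f j (h + t)) M - series (fun j => f j t) M - h * series (fun j => f' j t) M).
    exact: (cvgB (cvgB c1 c2) (cvgM (cvg_cst h) c3)).
  by apply/funext => M; rewrite /series /= mulr_sumr -!sumrB.
rewrite E.
have h1 : `|series (fun j => D j h) N| <= e / 2 * `|h| by near: h.
have h2 : 2 * K * `|h| * q ^+ N / (1 - q) <= e / 2 * `|h|.
  have -> : 2 * K * `|h| * q ^+ N / (1 - q) = 2 * K * q ^+ N / (1 - q) * `|h| by ring.
  by apply: ler_wpM2r => //; exact: ltW.
move: hT h1; set a := ssum _; set b := series _ _ => h3 h4.
have := ler_normD (a - b) b; rewrite subrK; lra.
Unshelve. all: by end_near. Qed.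

End DominatedSeries.

(** * Alternating image sums *)

Section ThetaSeries.
Context {R : realType}.
Implicit Types (r x t z : R) (h : R -> R).

(** A bound on the whole line that decays only towards [+oo], the direction in which the image sums
    run. *)
Definition exp_decay (C : R) h : Prop := 0 <= C /\ forall y, `|h y| <= C * expR (- y).

(** Contributions of image sources at unit spacing with alternating signs; the scale [r] will be
    [1 / (2 * sqrt t)]. *)
Definition theta h r x : R := ssum (fun j => (-1) ^+ j * h ((j%:R + x) * r)).

Lemma expRN_lt1 r : 0 < r -> 0 <= expR (- r) < 1.
Proof. by move=> r0; rewrite expR_ge0 -expR0 ltr_expR oppr_lt0. Qed.

Lemma theta_term_bound C h r x r1 r2 A j : exp_decay C h -> 0 < r1 -> r1 <= r -> r <= r2 -> `|x| <= A ->
  `|(-1) ^+ j * h ((j%:R + x) * r)| <= C * expR (A * r2) * expR (- r1) ^+ j.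
Proof.
move=> [C0 hC] r10 r1r rr2 xA; rewrite normrM normrX normrN1 expr1n mul1r.
apply: (le_trans (hC _)); rewrite -mulrA ler_wpM2l // -expRM_natl -expRD ler_expR.
have j0 : 0 <= j%:R :> R by exact: ler0n.
have h1 : j%:R * r1 <= j%:R * r by rewrite ler_wpM2l.
have h2 : - (x * r) <= A * r2.
  apply: (le_trans (ler_norm _)); rewrite normrN normrM ler_pM // ger0_norm //.
  by rewrite (le_trans (ltW r10)).
by rewrite mulrDl mulrN; lra.
Qed.

Lemma theta_cvg C h r x : exp_decay C h -> 0 < r ->
  cvgn (series (fun j => (-1) ^+ j * h ((j%:R + x) * r))) /\
  `|theta h r x| <= C * expR (- (x * r)) / (1 - expR (- r)).
Proof.
move=> [C0 hC] r0; have K0 : 0 <= C * expR (- (x * r)) by rewrite mulr_ge0 // expR_ge0.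
have hb j : `|(-1) ^+ j * h ((j%:R + x) * r)| <= C * expR (- (x * r)) * expR (- r) ^+ j.
  rewrite normrM normrX normrN1 expr1n mul1r.
  apply: (le_trans (hC _)); rewrite -mulrA ler_wpM2l // -expRM_natl -expRD ler_expR; lra.
have [h1 h2] := geo_dominated_tail K0 (expRN_lt1 r0) 0 hb.
by split => //; move: h2; rewrite /series /= big_geq // subr0 expr0 mulr1.
Qed.

Lemma theta_scale C h (a : R) r x : exp_decay C h -> 0 < r ->
  theta (fun y => a * h y) r x = a * theta h r x.
Proof.
move=> hd r0; have [c _] := theta_cvg x hd r0; apply: cvg_lim => //.
rewrite (_ : series _ = fun N => a * series (fun j => (-1) ^+ j * h ((j%:R + x) * r)) N).
  exact: (cvgM (cvg_cst a) c).
by apply/funext => N; rewrite /series /= mulr_sumr; apply: eq_bigr => j _; rewrite mulrCA.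
Qed.

(** Removing the first term of the alternating sum shifts the argument by 1 and reverses the
    sign. *)
Lemma theta_shift C h r x : exp_decay C h -> 0 < r -> theta h r x = h (x * r) - theta h r (1 + x).
Proof.
move=> hd r0; have [c _] := theta_cvg (1 + x) hd r0.
apply: cvg_lim => //; rewrite -cvg_shiftS /=.
rewrite (_ : (fun N => _) = fun N => h (x * r) - series (fun j => (-1) ^+ j * h ((j%:R + (1 + x)) * r)) N).
  exact: (cvgB (cvg_cst _) c).
apply/funext => N; rewrite /series /= big_nat_recl // expr0 mul1r add0r; congr (_ + _).
by rewrite -sumrN; apply: eq_bigr => j _; rewrite exprS mulN1r mulNr addrA natr1.
Qed.

Lemma theta_continuous C h r x : exp_decay C h -> continuous h -> 0 < r ->
  {for (r, x), continuous (fun rx : R * R => theta h rx.1 rx.2)}.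
Proof.
move=> hd ch r0; have r2 : 0 < r / 2 by rewrite divr_gt0.
have K0 : 0 <= C * expR ((`|x| + 1) * (r + 1)) by rewrite mulr_ge0 ?expR_ge0 //; case: hd.
apply: (ssum_continuous K0 (expRN_lt1 r2) (f := fun j (rx : R * R) => (-1) ^+ j * h ((j%:R + rx.2) * rx.1))).
  move=> j; apply: ctM; first exact: ct_cst.
  apply: (@ct_comp _ _ _ (fun rx : R * R => (j%:R + rx.2) * rx.1) h); last exact: ch.
  apply: ctM; last exact: cvg_fst.
  by apply: ctD; [exact: ct_cst|exact: cvg_snd].
have c1 : {for (r, x), continuous (fun rx : R * R => rx.1)} by exact: cvg_fst.
have c2 : {for (r, x), continuous (fun rx : R * R => `|rx.2|)} by apply: cvg_norm; exact: cvg_snd.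
have n1 : \forall rx \near ((r, x) : R * R), r / 2 < rx.1.
  by apply: (cvgr_gt _ c1); rewrite ltr_pdivrMr // mulr2n /=; lra.
have n2 : \forall rx \near ((r, x) : R * R), rx.1 < r + 1.
  by apply: (cvgr_lt _ c1); rewrite ltrDl.
have n3 : \forall rx \near ((r, x) : R * R), `|rx.2| < `|x| + 1.
  by apply: (cvgr_lt _ c2); rewrite ltrDl.
near=> rx => j; apply: theta_term_bound => //; apply/ltW; near: rx => //.
Unshelve. all: by end_near. Qed.

Lemma theta_dx C C' h h' r x : exp_decay C h -> exp_decay C' h' ->
  (forall y : R, is_derive y 1 h (h' y)) -> 0 < r ->
  is_derive x 1 (theta h r) (r * theta h' r x).
Proof.
move=> hd hd' dh r0.
have [c _] := theta_cvg x hd' r0.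
have -> : r * theta h' r x = ssum (fun j => (-1) ^+ j * (r * h' ((j%:R + x) * r))).
  apply/esym/cvg_lim => //.
  rewrite (_ : series _ = fun N => r * series (fun j => (-1) ^+ j * h' ((j%:R + x) * r)) N).
    exact: (cvgM (cvg_cst r) c).
  by apply/funext => N; rewrite /series /= mulr_sumr; apply: eq_bigr => j _; rewrite mulrCA.
have [C0 _] := hd; have [C'0 _] := hd'.
pose E := expR ((`|x| + 1) * r); have E0 : 0 <= E by exact: expR_ge0.
pose K := C * E + r * (C' * E).
have K0 : 0 <= K by rewrite addr_ge0 ?mulr_ge0 // ltW.
have xb (s : R) : `|s - x| < 1 -> `|s| <= `|x| + 1.
  by move=> h1; have := ler_normD (s - x) x; rewrite subrK; lra.
apply: (@ssum_is_derive _ K (expR (- r)) K0 (expRN_lt1 r0) (fun j s => (-1) ^+ j * h ((j%:R + s) * r))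
  (fun j s => (-1) ^+ j * (r * h' ((j%:R + s) * r))) x 1 ltr01).
- move=> j s _; have d1 : is_derive s 1 (fun s => (j%:R + s) * r) r.
    have := is_derive_affine r (j%:R * r) s; congr is_derive.
    by apply/funext => s'; rewrite mulrDl [RHS]addrC (mulrC r).
  have := is_deriveZ ((-1) ^+ j) (@is_derive1_comp _ h _ s _ _ (dh _) d1).
  by congr is_derive; rewrite /GRing.scale /= (mulrC r).
- move=> j s /xb hs; apply: (le_trans (theta_term_bound j hd r0 (lexx r) (lexx r) hs)).
  by rewrite ler_wpM2r ?exprn_ge0 ?expR_ge0 // /K lerDl !mulr_ge0 // ltW.
move=> j s /xb hs; rewrite mulrCA normrM (gtr0_norm r0).
apply: (@le_trans _ _ (r * (C' * E * expR (- r) ^+ j))).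
  by rewrite ler_pM2l //; exact: theta_term_bound hd' r0 _ _ hs.
by rewrite mulrA ler_wpM2r ?exprn_ge0 ?expR_ge0 // /K lerDr mulr_ge0.
Qed.

(** Differentiating in [r] produces the unbounded factor [j%:R + x]; it equals the argument divided
    by [r], hence the decay hypothesis on [y * h' y]. *)
Lemma theta_dr C C' h h' r x : exp_decay C h -> exp_decay C' (fun y => y * h' y) ->
  (forall y : R, is_derive y 1 h (h' y)) -> 0 < r ->
  is_derive r 1 (fun r => theta h r x) (r^-1 * theta (fun y => y * h' y) r x).
Proof.
move=> hd hd' dh r0.
pose k y := y * h' y.
have [c _] := theta_cvg x hd' r0.
have kE j (s : R) : 0 < s -> (j%:R + x) * h' ((j%:R + x) * s) = s^-1 * k ((j%:R + x) * s).
  by move=> s0; rewrite /k; field; rewrite gt_eqF.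
have -> : r^-1 * theta k r x = ssum (fun j => (-1) ^+ j * ((j%:R + x) * h' ((j%:R + x) * r))).
  apply/esym/cvg_lim => //.
  rewrite (_ : series _ = fun N => r^-1 * series (fun j => (-1) ^+ j * k ((j%:R + x) * r)) N).
    exact: (cvgM (cvg_cst r^-1) c).
  by apply/funext => N; rewrite /series /= mulr_sumr; apply: eq_bigr => j _; rewrite kE // mulrCA.
have [C0 _] := hd; have [C'0 _] := hd'.
have r2 : 0 < r / 2 by rewrite divr_gt0.
pose E := expR (`|x| * (r * 2)); have E0 : 0 <= E by exact: expR_ge0.
pose K := C * E + (r / 2)^-1 * (C' * E).
have K0 : 0 <= K by rewrite addr_ge0 ?mulr_ge0 // invr_ge0 ltW.
have rb (s : R) : `|s - r| < r / 2 -> r / 2 <= s /\ s <= r * 2.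
  by rewrite ltr_norml => /andP[h1 h2]; split; lra.
apply: (@ssum_is_derive _ K (expR (- (r / 2))) K0 (expRN_lt1 r2) (fun j s => (-1) ^+ j * h ((j%:R + x) * s))
  (fun j s => (-1) ^+ j * ((j%:R + x) * h' ((j%:R + x) * s))) r (r / 2) r2).
- move=> j s _; have d1 : is_derive s 1 (fun s => (j%:R + x) * s) (j%:R + x).
    have := is_derive_affine (j%:R + x) 0 s; congr is_derive.
    by apply/funext => s'; rewrite addr0.
  have := is_deriveZ ((-1) ^+ j) (@is_derive1_comp _ h _ s _ _ (dh _) d1).
  by congr is_derive; rewrite /GRing.scale /= (mulrC (h' _)).
- move=> j s /rb [s1 s2]; apply: (le_trans (theta_term_bound j hd r2 s1 s2 (lexx _))).
  by rewrite ler_wpM2r ?exprn_ge0 ?expR_ge0 // /K lerDl !mulr_ge0 // invr_ge0 ltW.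
move=> j s /rb [s1 s2]; have s0 : 0 < s by exact: lt_le_trans s1.
rewrite kE // mulrCA normrM gtr0_norm ?invr_gt0 //.
apply: (@le_trans _ _ ((r / 2)^-1 * (C' * E * expR (- (r / 2)) ^+ j))).
  apply: ler_pM => //; first by rewrite invr_ge0 ltW.
    by rewrite lef_pV2 // posrE.
  exact: theta_term_bound hd' r2 s1 s2 _.
by rewrite mulrA ler_wpM2r ?exprn_ge0 ?expR_ge0 // /K lerDr mulr_ge0.
Qed.

End ThetaSeries.

(** * The heat flow on the unit interval *)

Section HeatKernel.
Context {R : realType} (F : R -> R) (c C : R).
Hypotheses (F0 : F 0 = 1) (C0 : 0 < C) (Fb : forall y, `|F y| <= C * expR (- y))
  (dF : forall y : R, is_derive y 1 F (- c * expR (- y ^+ 2))).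
Implicit Types (t z r : R).

Let F1 (y : R) : R := - c * expR (- y ^+ 2).
Let F2 (y : R) : R := y * F1 y.
Let C1 : R := `|c| * expR 1.

Let decayF : exp_decay C F. Proof. by split => //; exact: ltW. Qed.

Let C10 : 0 <= C1. Proof. by rewrite mulr_ge0 // expR_ge0. Qed.

Let decayF1 : exp_decay C1 F1.
Proof.
split => // y; rewrite /F1 normrM normrN ger0_norm ?expR_ge0 // /C1 -mulrA.
by rewrite ler_wpM2l // expR_sqr_le.
Qed.

Let decayF2 : exp_decay C1 F2.
Proof.
split => // y; rewrite /F2 /F1 mulrCA normrM normrN normrM [`|expR _|]ger0_norm ?expR_ge0 // /C1 -mulrA.
by rewrite ler_wpM2l // mul_expR_sqr_le.
Qed.

Let decayF1' : exp_decay (2 * C1) (fun y => - 2 * F2 y).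
Proof.
split => [|y]; first by rewrite mulr_ge0.
rewrite normrM; have -> : `|- 2 : R| = 2 by rewrite normrN ger0_norm.
by rewrite -mulrA ler_wpM2l //; case: decayF2.
Qed.

Let dF1 (y : R) : is_derive y 1 F1 (- 2 * F2 y).
Proof.
have d1 : is_derive y 1 (fun y : R => - y ^+ 2) (- (2 * y)).
  have := is_deriveN (is_deriveM (is_derive_id y 1) (is_derive_id y 1)).
  congr is_derive; rewrite /GRing.scale /=; ring.
have := is_deriveZ (- c) (@is_derive1_comp _ expR (fun y => - y ^+ 2) y _ _ (is_derive_expR (- y ^+ 2)) d1).
by congr is_derive; rewrite /F2 /F1 /GRing.scale /=; ring.
Qed.

Let cF1 : continuous F1. Proof. by move=> y; exact: (is_derive1_continuous (dF1 y)). Qed.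
Let cF2 : continuous F2. Proof. by move=> y; exact: (cvgM cvg_id (@cF1 y)). Qed.
Let cF : continuous F. Proof. by move=> y; exact: (is_derive1_continuous (dF y)). Qed.

(* [rt t = 1 / (2 sqrt t)] *)
Definition rt t : R := 2^-1 * expR (- 2^-1 * ln t).

Lemma rt_gt0 t : 0 < rt t. Proof. by rewrite mulr_gt0 // expR_gt0. Qed.

Lemma rt_sqr t : 0 < t -> rt t ^+ 2 = (4 * t)^-1.
Proof.
move=> t0; rewrite /rt expr2 mulrACA -expRD.
have -> : - 2^-1 * ln t + - 2^-1 * ln t = - ln t by field.
by rewrite expRN lnK ?posrE //; field; rewrite gt_eqF.
Qed.

Lemma is_derive_rt t : 0 < t -> is_derive t 1 rt (- 2 * rt t ^+ 3).
Proof.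
move=> t0; have d1 : is_derive t 1 (fun t => - 2^-1 * ln t) (- 2^-1 * t^-1).
  by have := is_deriveZ (- 2^-1) (is_derive1_ln t0).
have := is_deriveZ 2^-1 (@is_derive1_comp _ expR (fun t => - 2^-1 * ln t) t _ _ (is_derive_expR _) d1).
congr is_derive; rewrite exprS rt_sqr // /rt /GRing.scale /=; field.
by rewrite gt_eqF.
Qed.

(* Method of images: both boundary values 1 are cancelled by alternating images. *)
Definition heatv t z : R := if 0 < t then 1 - theta F (rt t) z - theta F (rt t) (1 - z) else 1.

Definition heatv_z t z : R := - (rt t * theta F1 (rt t) z) + rt t * theta F1 (rt t) (1 - z).

Definition heatv_zz t z : R := 2 * rt t ^+ 2 * (theta F2 (rt t) z + theta F2 (rt t) (1 - z)).

Lemma heatv_sym t z : heatv t (1 - z) = heatv t z.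
Proof. by rewrite /heatv subKr addrAC. Qed.

(** At height 0 the two sums have arguments 0 and 1, so by [theta_shift] they add up to [F 0 = 1];
    symmetry gives the other end. *)
Lemma heatv_boundary t : 0 < t -> heatv t 0 = 0 /\ heatv t 1 = 0.
Proof.
move=> t0; suff h : heatv t 0 = 0 by split => //; rewrite -h -(heatv_sym t 0) subr0.
rewrite /heatv t0 (theta_shift 0 decayF (rt_gt0 t)) mul0r F0 addr0 subr0; ring.
Qed.

Let der_1subr z : is_derive z 1 (fun z => 1 - z) (-1).
Proof.
have := is_derive_affine (-1) 1 z; congr is_derive.
by apply/funext => s; rewrite mulN1r addrC.
Qed.

Lemma is_derive_heatv_z t z : 0 < t -> is_derive z 1 (heatv t) (heatv_z t z).
Proof.
move=> t0; have r0 := rt_gt0 t.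
have d1 := theta_dx z decayF decayF1 dF r0.
have d2 := @is_derive1_comp _ _ _ z _ _ (theta_dx (1 - z) decayF decayF1 dF r0) (der_1subr z).
have := is_deriveB (is_deriveB (is_derive_cst (1 : R) z 1) d1) d2.
congr is_derive; last by rewrite /heatv_z; ring.
by apply/funext => z'; rewrite /heatv t0.
Qed.

Lemma is_derive_heatv_zz t z : 0 < t -> is_derive z 1 (heatv_z t) (heatv_zz t z).
Proof.
move=> t0; have r0 := rt_gt0 t.
have d1 := theta_dx z decayF1 decayF1' dF1 r0.
have d2 := @is_derive1_comp _ _ _ z _ _ (theta_dx (1 - z) decayF1 decayF1' dF1 r0) (der_1subr z).
have := is_deriveD (is_deriveN (is_deriveZ (rt t) d1)) (is_deriveZ (rt t) d2).
congr is_derive.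
by rewrite !(theta_scale _ _ decayF2 r0) /heatv_zz /GRing.scale /=; ring.
Qed.

(** The heat equation: the profile satisfies [F'' = - 2 y F'], and the scale [r = rt t] satisfies
    [r' = - 2 r^3], so one time derivative and two space derivatives of [F (x r)] both give
    [- 2 r^2 (x r) F' (x r)]. *)
Lemma is_derive_heatv_t t z : 0 < t -> is_derive t 1 (heatv ^~ z) (heatv_zz t z).
Proof.
move=> t0; have r0 := rt_gt0 t.
have d1 := @is_derive1_comp _ _ _ t _ _ (theta_dr z decayF decayF2 dF r0) (is_derive_rt t0).
have d2 := @is_derive1_comp _ _ _ t _ _ (theta_dr (1 - z) decayF decayF2 dF r0) (is_derive_rt t0).
apply: near_eq_is_derive; last first.
  have := is_deriveB (is_deriveB (is_derive_cst (1 : R) t 1) d1) d2.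
  congr is_derive; rewrite /heatv_zz -/F2; field; by rewrite gt_eqF.
by apply: (near_sub (lt_nbhsr t0)) => s s0; rewrite /heatv s0.
Qed.

Lemma continuous_theta_rt (T : topologicalType) (h : R -> R) (Ch : R) (f g : T -> R) (p : T) :
  exp_decay Ch h -> continuous h -> 0 < f p -> {for p, continuous f} -> {for p, continuous g} ->
  {for p, continuous (fun p => theta h (rt (f p)) (g p))}.
Proof.
move=> hd ch f0 cf cg.
apply: (@ct_comp _ _ _ (fun p => (rt (f p), g p)) (fun rx : R * R => theta h rx.1 rx.2)); last first.
  exact: (theta_continuous hd ch (rt_gt0 _)).
apply: ct_pair => //; apply: (@ct_comp _ _ _ f rt) => //.
exact: (is_derive1_continuous (is_derive_rt f0)).
Qed.

Lemma continuous_heatv (T : topologicalType) (f g : T -> R) (p : T) :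
  0 < f p -> {for p, continuous f} -> {for p, continuous g} ->
  {for p, continuous (fun p => heatv (f p) (g p))}.
Proof.
move=> f0 cf cg.
apply: (@ct_eq _ _ (fun p => 1 - theta F (rt (f p)) (g p) - theta F (rt (f p)) (1 - g p))).
  by apply: (near_sub (cvgr_gt _ cf _ f0)) => q q0; rewrite /heatv q0.
have cg' : {for p, continuous (fun p => 1 - g p)} by apply: ctB => //; exact: ct_cst.
apply: ctB; last exact: (continuous_theta_rt decayF).
by apply: ctB; [exact: ct_cst|exact: (continuous_theta_rt decayF)].
Qed.

Lemma continuous_heatv_zz t z : 0 < t -> {for z, continuous (heatv_zz t)}.
Proof.
move=> t0; apply: ctM; first exact: ct_cst.
have cz : {for z, continuous (fun z : R => 1 - z)} by apply: ctB; [exact: ct_cst|exact: cvg_id].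
apply: ctD; [apply: (@continuous_theta_rt R F2 C1 (fun=> t) id) => //|
  apply: (@continuous_theta_rt R F2 C1 (fun=> t) (fun z => 1 - z)) => //]; try exact: ct_cst.
Qed.

Lemma heatv_bound t z : 0 < t ->
  `|heatv t z - 1| <= C * (expR (- (z * rt t)) + expR (- ((1 - z) * rt t))) / (1 - expR (- rt t)).
Proof.
move=> t0; have r0 := rt_gt0 t.
have [_ h1] := theta_cvg z decayF r0; have [_ h2] := theta_cvg (1 - z) decayF r0.
rewrite /heatv t0 (_ : _ - _ - _ - 1 = - (theta F (rt t) z + theta F (rt t) (1 - z))); last by ring.
rewrite normrN; apply: (le_trans (ler_normD _ _)); rewrite mulrDr mulrDl.
exact: lerD.
Qed.

End HeatKernel.

(** * The heat flow on the cylinder *)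

Section HeatFlow.
Context {R : realType} {n : nat} (B : 'M[R]_n) (uB : B \in unitmx).
Variables (mu : {measure set (borel (cyl R n)) -> \bar R}).
Hypothesis mu_box : forall c (a b : 'rV[R]_n.+1), fatlas B c ->
  (forall i, a 0 i <= b 0 i) -> box a b `<=` cod c ->
  mu (bwd c @` box a b) = (\prod_i (b 0 i - a 0 i))%:E.
Hypothesis mu_boundary : mu (~` atlas_interior (fatlas B)) = 0%E.
Hypothesis mu_lty : (mu setT < +oo)%E.
Local Notation M := (cylM uB mu_box mu_boundary).

Variables (F : R -> R) (c C : R).
Hypotheses (F0 : F 0 = 1) (C0 : 0 < C) (Fb : forall y, `|F y| <= C * expR (- y))
  (dF : forall y : R, is_derive y 1 F (- c * expR (- y ^+ 2))).

Definition heatu (t : R) (p : cyl R n) : R := heatv F t (cht p).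

Lemma is_derive_ver (g : R -> R) (d : R) (x : 'rV[R]_n.+1) i : is_derive (ver x) 1 g d ->
  is_derive x (basis_vec i) (fun x => g (ver x)) ((i == ord_max)%:R * d).
Proof.
move=> dg; apply/is_derive_lineP.
set a : R := (i == ord_max)%:R.
have d1 := is_derive_affine a (ver x) 0.
rewrite (_ : (fun h : R => g (ver (h *: basis_vec i + x))) = (fun h : R => g (a * h + ver x))); last first.
  by apply/funext => h; rewrite linearD linearZ /= ver_basis mulrC.
have dg' : is_derive (a * 0 + ver x) 1 g d by rewrite mulr0 add0r.
by have := @is_derive1_comp _ g (fun h => a * h + ver x) 0 _ _ dg' d1; rewrite mulrC.
Qed.

Lemma heatu_C2 (t : R) : 0 < t ->
  C2_interior (heatu t : M -> R) /\
  laplacianM_eq (heatu t : M -> R) (fun p => - heatv_zz c t (cht p)).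
Proof.
move=> t0.
apply: (@C2_laplacian_intro _ _ _ uB _ mu_box mu_boundary (heatu t) (fun p => - heatv_zz c t (cht p))) => b.
pose f x := heatu t (proj B (flipb b x)).
have chtE x : slab x -> cht (proj B (flipb b x)) = if b then 1 - ver x else ver x.
  by move=> /andP[x0 x1]; rewrite ver_proj // ver_flipb; case: (b); lra.
have fE x : slab x -> f x = heatv F t (ver x).
  by move=> sx; rewrite /f /heatu chtE //; case: (b); rewrite ?heatv_sym.
have zzsym z : heatv_zz c t (1 - z) = heatv_zz c t z.
  by rewrite /heatv_zz subKr [theta _ _ (1 - z) + _]addrC.
pose k (i : 'I_n.+1) : R := (i == ord_max)%:R.
pose df i (x : 'rV[R]_n.+1) : R := k i * heatv_z c t (ver x).
pose ddf i j (x : 'rV[R]_n.+1) : R := k i * (k j * heatv_zz c t (ver x)).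
have d1 z := is_derive_heatv_z C0 Fb dF z t0.
have d2 z := is_derive_heatv_zz c z t0.
have cver (g : R -> R) (x : 'rV[R]_n.+1) : {for ver x, continuous g} -> {for x, continuous (fun x : 'rV[R]_n.+1 => g (ver x))}.
  by move=> cg; apply: (@ct_comp _ _ _ (@ver R n) g) => //; exact: continuous_ver.
have H4 i x : slab x -> is_derive x (basis_vec i) f (df i x).
  move=> sx; apply: near_eq_is_derive (is_derive_ver i (d1 (ver x))).
  by apply: near_open (@slab_open R n) sx _ => y sy; rewrite fE.
have H5 i j x : slab x -> is_derive x (basis_vec j) (df i) (ddf i j x).
  by move=> sx; have := is_deriveZ (k i) (is_derive_ver j (d2 (ver x))).
have H1 : {in slab, continuous f}.
  move=> x; rewrite inE => sx; apply: (@ct_eq _ _ (fun x : 'rV[R]_n.+1 => heatv F t (ver x))).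
    by apply: near_open (@slab_open R n) sx _ => y sy; rewrite fE.
  by apply: cver; exact: (is_derive1_continuous (d1 (ver x))).
have H2 i : {in slab, continuous (df i)}.
  suff H (x : 'rV[R]_n.+1) : {for x, continuous (df i)} by move=> x _; exact: H.
  by apply: ctM; [exact: ct_cst|apply: cver; exact: (is_derive1_continuous (d2 (ver x)))].
have H3 i j : {in slab, continuous (ddf i j)}.
  suff H (x : 'rV[R]_n.+1) : {for x, continuous (ddf i j)} by move=> x _; exact: H.
  apply: ctM; first exact: ct_cst.
  apply: ctM; first exact: ct_cst.
  by apply: cver; exact: (@continuous_heatv_zz R c t (ver x) t0).
have [h1 h2] := C2_intro (@slab_open R n) H1 H2 H3 H4 H5.
split => // x sx; rewrite h2 // chtE //; congr (- _).
rewrite (bigD1 ord_max) //= /ddf /k eqxx !mul1r big1 ?addr0 => [|i /negbTE ->]; last by rewrite mul0r.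
by case: (b); rewrite ?zzsym.
Qed.

Lemma continuous_heatu_pair (T : topologicalType := (R * cyl R n)%type) (p : T) : 0 < p.1 ->
  {for p, continuous (fun z : T => heatu z.1 z.2)}.
Proof.
move=> t0.
have h1 : {for p, continuous (fun z : T => z.1)} by exact: cvg_fst.
have h2 : {for p, continuous (fun z : T => z.2)} by exact: cvg_snd.
have h3 := @ct_comp T _ _ _ (@cht R n) _ h2 (@continuous_cht R n p.2).
exact: (@continuous_heatv R F c C C0 Fb dF T (fun z : T => z.1) (fun z : T => cht z.2) p t0 h1 h3).
Qed.

Lemma continuous_heatu (t : R) : continuous (heatu t).
Proof.
suff H (p : cyl R n) : {for p, continuous (heatu t)} by move=> p; exact: H.
have [t0|t0] := ltP 0 t; last first.
  rewrite (_ : heatu t = fun=> 1); first exact: ct_cst.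
  by apply/funext => p'; rewrite /heatu /heatv ltNge t0.
have h1 : {for p, continuous (fun=> t)} by exact: ct_cst.
have H := @continuous_heatv R F c C C0 Fb dF _ (fun=> t) (@cht R n) p t0 h1 (@continuous_cht R n p).
exact H.
Qed.

Lemma rt_ge_half (t : R) : 0 < t -> t <= 1 -> 2^-1 <= rt t.
Proof.
move=> t0 t1; rewrite /rt ler_peMr // -expR0 ler_expR.
by rewrite mulNr oppr_ge0 mulr_ge0_le0 // ln_le0.
Qed.

(** The two bounds serve dominated convergence as [t] tends to 0: a constant majorant, and pointwise
    convergence at interior heights. *)
Lemma heatv_bound_unif : exists2 K : R, 0 <= K & forall t z : R, 0 < t -> t <= 1 -> 0 <= z <= 1 ->
  `|heatv F t z - 1| <= K /\ (0 < z < 1 -> `|heatv F t z - 1| <= K * (z ^- 2 + (1 - z) ^- 2) * t).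
Proof.
pose q : R := 1 - expR (- 2^-1).
have q0 : 0 < q by rewrite subr_gt0 -expR0 ltr_expR oppr_lt0 invr_gt0.
(* With [w = y * rt t], the bounds [expR w >= (w / 2) ^+ 2] and [rt t ^+ 2 = (4 * t)^-1] give
   [expR (- w) <= 16 * y ^- 2 * t]; [q] is a lower bound of the denominator for [t <= 1]. *)
exists (16 * C / q) => [|t z t0 t1 z01]; first by rewrite divr_ge0 ?mulr_ge0 // ltW.
have hr := rt_ge_half t0 t1; have r0 := rt_gt0 t.
have qle : q <= 1 - expR (- rt t) by rewrite lerD2l lerN2 ler_expR lerN2.
have H := heatv_bound C0 Fb z t0.
have Cq : 0 < C / q by rewrite divr_gt0.
set e1 := expR (- (z * _)) in H; set e2 := expR (- (_ * _)) in H.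
have e10 : 0 < e1 by exact: expR_gt0.
have e20 : 0 < e2 by exact: expR_gt0.
have H' : `|heatv F t z - 1| <= C / q * (e1 + e2).
  apply: (le_trans H); rewrite mulrAC; apply: ler_wpM2r; first by rewrite addr_ge0 // ltW.
  by rewrite ler_pM2l // lef_pV2 ?posrE // (lt_le_trans q0 qle).
have e1le : e1 <= 1 by rewrite /e1 -expR0 ler_expR oppr_le0 mulr_ge0 //; [lra|exact: ltW].
have e2le : e2 <= 1.
  have zz : 0 <= (1 - z) * rt t by rewrite mulr_ge0 ?(ltW r0) // subr_ge0; case/andP: z01.
  by rewrite /e2 -[leRHS]expR0 ler_expR oppr_le0.
split.
  apply: (le_trans H'); rewrite (_ : 16 * C / q = C / q * 16); last by field; rewrite gt_eqF.
  by rewrite ler_pM2l //; lra.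
move=> /andP[z0 z1].
have expb (y : R) : 0 < y -> expR (- (y * rt t)) <= 16 * y ^- 2 * t.
  move=> y0; set w := y * rt t; have w0 : 0 < w by rewrite mulr_gt0.
  have h1 : w / 2 <= expR (w / 2) by apply: le_trans (expR_ge1Dx _); rewrite lerDr.
  have h2 : (w / 2) ^+ 2 <= expR w.
    rewrite (_ : expR w = expR (w / 2) ^+ 2).
      by apply: lerXn2r => //; rewrite nnegrE ?expR_ge0 // divr_ge0 // ltW.
    by rewrite expr2 -expRD; congr expR; field.
  rewrite expRN -[leRHS]invrK lef_pV2 ?posrE ?expR_gt0 ?invr_gt0 ?mulr_gt0 ?invr_gt0 ?exprn_gt0 //.
  apply: le_trans h2; rewrite le_eqVlt; apply/orP; left; apply/eqP.
  rewrite /w [RHS](_ : _ = y ^+ 2 * rt t ^+ 2 / 4); last by field.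
  rewrite rt_sqr //; field; by rewrite !gt_eqF.
have b1 : e1 <= 16 * z ^- 2 * t by exact: expb.
have b2 : e2 <= 16 * (1 - z) ^- 2 * t by apply: expb; lra.
apply: (le_trans H').
rewrite (_ : 16 * C / q * _ * t = C / q * (16 * z ^- 2 * t + 16 * (1 - z) ^- 2 * t)); last by ring.
by rewrite ler_pM2l //; lra.
Qed.

Lemma open_cht01 : open [set p : cyl R n | 0 < cht p < 1].
Proof.
rewrite (_ : [set p | _] = @cht R n @^-1` (`]0, 1[%classic)); last by apply/seteqP; split => p /=; rewrite in_itv.
by apply: open_comp; [move=> p _; exact: continuous_cht|exact: interval_open].
Qed.

(** At the boundary the solution is 0 for positive times and does not tend to 1, but the boundary is
    a null set and the volume is finite, so dominated convergence applies. *)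
Lemma heatu_initial :
  ((\int[mu]_p (((heatu t p - heatu 0 p) ^+ 2)%:E))%E @[t --> 0^'+] --> 0%E).
Proof.
have [K K0 hK] := heatv_bound_unif.
have cht01 (p : cyl R n) : 0 <= cht p <= 1.
  by have [y [z [_ ->]]] := cpt_surj p; rewrite cht_cpt clamp_ge0 clamp_le1.
have u0 p : heatu 0 p = 1 by rewrite /heatu /heatv ltxx.
(* Capping the time at 1 makes the majorant valid along the whole sequence of times, without
   changing the limit at 0. *)
pose f (t : R) (p : borel (cyl R n)) : \bar R := ((heatu (Num.min t 1) p - 1) ^+ 2)%:E.
suff H : ((\int[mu]_p f t p)%E @[t --> 0^'+] --> 0%E).
  apply: cvg_trans H; apply: near_eq_cvg; near=> t.
  apply: eq_integral => p _; rewrite /f u0 min_l //; near: t.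
  exact: nbhs_right_le.
apply/cvge_at_rightP => s [s0 s_cvg].
have min01 m : 0 < Num.min (s m) 1 /\ Num.min (s m) 1 <= 1.
  by rewrite lt_min s0 ltr01 ge_min lexx orbT.
have mf m : measurable_fun [set: borel (cyl R n)] (f (s m)).
  apply/measurable_EFinP; apply: (continuous_measurable_borel (f := fun p => (heatu (Num.min (s m) 1) p - 1) ^+ 2)).
  suff H (p : cyl R n) : {for p, continuous (fun p => (heatu (Num.min (s m) 1) p - 1) ^+ 2)} by move=> p; exact: H.
  by apply: ctM; (apply: ctB; [exact: continuous_heatu|exact: ct_cst]).
have fK m p : (`|f (s m) p| <= (K ^+ 2)%:E)%E.
  have [m0 m1] := min01 m; have [hb _] := hK _ _ m0 m1 (cht01 p).
  rewrite /f /= lee_fin ger0_norm ?sqr_ge0 // -[leLHS]real_normK ?num_real //.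
  by apply: lerXn2r => //; rewrite nnegrE.
have fcvg p : 0 < cht p < 1 -> f (s m) p @[m --> \oo] --> 0%E.
  move=> cp; set L : R := K * (cht p ^- 2 + (1 - cht p) ^- 2).
  have L0 : 0 <= L by rewrite mulr_ge0 // addr_ge0 // invr_ge0 sqr_ge0.
  have hs : (L * s m) ^+ 2 @[m --> \oo] --> (0 : R).
    have h : L * s m @[m --> \oo] --> (0 : R).
      by rewrite -(mulr0 L); apply: cvgM => //; exact: cvg_cst.
    by rewrite -(mulr0 (0 : R)); exact: cvgM.
  have hf : (heatu (Num.min (s m) 1) p - 1) ^+ 2 @[m --> \oo] --> (0 : R).
    apply: (@squeeze_cvgr _ _ _ _ (cst 0) (fun m => (L * s m) ^+ 2)) => //; last exact: cvg_cst.
    apply: nearW => m; rewrite /= sqr_ge0 /=.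
    have [m0 m1] := min01 m; have [_ /(_ cp) hb] := hK _ _ m0 m1 (cht01 p).
    rewrite -[leLHS]real_normK ?num_real //; apply: lerXn2r; rewrite ?nnegrE //.
      by rewrite mulr_ge0 // ltW.
    by apply: (le_trans hb); rewrite -/L ler_wpM2l // ge_min lexx.
  by apply/fine_cvgP; split; [exact: nearW|exact: hf].
have iK : mu.-integrable setT (cst (K ^+ 2)%:E).
  by apply: (@measurable_bounded_integrable _ _ _ mu (cst (K ^+ 2)) setT) => //; exact: bounded_cst.
have ae1 : {ae mu, forall p, setT p -> f (s m) p @[m --> \oo] --> cst 0%E p}.
  exists (~` atlas_interior (fatlas B)); split => //.
    apply: measurableC; rewrite fatlas_interior //.
    apply: sub_sigma_algebra; exact: open_cht01.
  by move=> p /=; rewrite fatlas_interior // => h hp; apply: h => _; exact: fcvg.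
have ae2 : {ae mu, forall p m, setT p -> (`|f (s m) p| <= cst (K ^+ 2)%:E p)%E}.
  by apply: aeW => p m _; exact: fK.
have [_ _] := @dominated_convergence _ _ R mu setT measurableT (fun m => f (s m)) (cst 0%E) (cst (K ^+ 2)%:E) mf
  (measurable_cst _) ae1 iK ae2.
by rewrite integral0.
Unshelve. all: by end_near.
Qed.

Theorem heatu_solution : is_heat_solution (M := M) heatu.
Proof.
split.
- apply: continuous_in_subspaceT => z /set_mem /= t0; exact: continuous_heatu_pair.
- move=> t t0; have [h1 h2] := heatu_C2 t0.
  have d (p : cyl R n) := is_derive_heatv_t C0 Fb dF (cht p) t0.
  split; [|exact: h1|]; first by move=> p _; have [] := d (p : cyl R n).
  move=> ch hc x hx; rewrite h2 //; congr (- _).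
  by rewrite derive1E; have [_ <-] := d (bwd ch x).
- move=> t p t0 /boundaryME; rewrite /heatu; have [b0 b1] := heatv_boundary F0 C0 Fb t0.
  by case => ->.
- by move=> p; rewrite /heatu /heatv ltxx.
exact: heatu_initial.
Qed.

End HeatFlow.

Section HeatContent.
Context {R : realType} {n : nat}.

Lemma mrestr_integral_eq d (T : measurableType d) (nu : {measure set T -> \bar R}) (C1 C2 : set T)
  (m1 : measurable C1) (m2 : measurable C2) (f : T -> \bar R) : C1 = C2 ->
  (\int[mrestr nu m1]_t f t = \int[mrestr nu m2]_t f t)%E.
Proof. by move=> e; subst C2; rewrite (Prop_irrelevance m1 m2). Qed.

Lemma heatu_bound (F : R -> R) (C : R) (C0 : 0 < C) (Fb : forall y, `|F y| <= C * expR (- y)) (t : R) (p : cyl R n) :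
  0 < t -> `|heatu F t p| <= 1 + C * 2 / (1 - expR (- rt t)).
Proof.
move=> t0; have r0 := rt_gt0 t.
have /andP[z0 z1] : 0 <= cht p <= 1.
  by have [y [z [_ ->]]] := cpt_surj p; rewrite cht_cpt clamp_ge0 clamp_le1.
have q0 : 0 < 1 - expR (- rt t) by rewrite subr_gt0 -[ltRHS]expR0 ltr_expR oppr_lt0.
have H := heatv_bound C0 Fb (cht p) t0.
have eb (a : R) : 0 <= a -> expR (- (a * rt t)) <= 1.
  by move=> a0; rewrite -[leRHS]expR0 ler_expR oppr_le0 mulr_ge0 // ltW.
have e1 := eb _ z0; have e2 := eb (1 - cht p) ltac:(by rewrite subr_ge0).
rewrite /heatu -[heatv _ _ _](subrK 1) addrC; apply: (le_trans (ler_normD _ _)); rewrite normr1 lerD2l.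
apply: (le_trans H); rewrite ler_wpM2r ?invr_ge0 ?(ltW q0) // ler_wpM2l ?(ltW C0) //.
lra.
Qed.

Variables (B1 B2 : 'M[R]_n) (uB1 : B1 \in unitmx) (uB2 : B2 \in unitmx).
Hypothesis tB1 : forall i j : 'I_n, (i < j)%N -> B1 i j = 0.
Hypothesis dB1 : forall i, 0 < B1 i i.
Hypothesis tB2 : forall i j : 'I_n, (i < j)%N -> B2 i j = 0.
Hypothesis dB2 : forall i, 0 < B2 i i.
Hypothesis diag_eq : forall i, B1 i i = B2 i i.
Context d (T : measurableType d) (nu : {measure set T -> \bar R})
  (x : T -> 'rV[R]_n.+1).
Hypothesis mx : forall i, measurable_fun setT (fun t => x t 0 i).
Hypothesis nu_box : forall (A : 'I_n.+1 -> set R) (a : 'I_n.+1 -> R), (forall i, measurable (A i)) ->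
    (forall i, lebesgue_measure (A i) = (a i)%:E) ->
    nu [set t | forall i, A i (x t 0 i)] = (\prod_i a i)%:E.

(** Equal diagonals give the same fundamental cell, and pulled back to it the heat flow is the same
    function of the height for both lattices, so the integrals agree. *)
Theorem cyl_same_heat_content :
  same_heat_content (cylM uB1 (cyl_volume_chart uB1 tB1 dB1 mx nu_box) (cyl_volume_boundary uB1 dB1 mx nu_box))
    (cylM uB2 (cyl_volume_chart uB2 tB2 dB2 mx nu_box) (cyl_volume_boundary uB2 dB2 mx nu_box)).
Proof.
have [F [c [C [F0 C0 Fb dF]]]] := @erfc_ex R.
have cellE : cell B1 x = cell B2 x.
  by apply/seteqP; split => t h i; have := h i; rewrite /cell_side; case: unlift => // j; rewrite diag_eq.
pose K t : R := 1 + C * 2 / (1 - expR (- rt t)).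
have ub (t : R) : 0 < t -> forall p : cyl R n, `|heatu F t p| <= K t by move=> t0 p; exact: (heatu_bound C0 Fb p t0).
have cu (t : R) : continuous (heatu F t : cyl R n -> R) by exact: (continuous_heatu C0 Fb dF).
have int1 (t : R) : 0 < t -> (\int[cyl_volume B1 nu mx]_p (heatu F t p)%:E = \int[cyl_volume B2 nu mx]_p (heatu F t p)%:E)%E.
  move=> t0; rewrite (cyl_volume_integral dB1 mx nu_box (cu t) (ub t t0)) (cyl_volume_integral dB2 mx nu_box (cu t) (ub t t0)).
  rewrite (mrestr_integral_eq nu _ (measurable_cell B2 mx) _ cellE); congr integral; apply/funext => s; by rewrite /heatu /proj !cht_cpt.
have intfin (t : R) : 0 < t -> (\int[cyl_volume B1 nu mx]_p (heatu F t p)%:E \is a fin_num)%E.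
  move=> t0; apply: integrable_fin_num => //.
  apply: (@measurable_bounded_integrable _ _ _ _ (heatu F t : borel (cyl R n) -> R) setT) => //.
  - exact: cyl_volume_lty.
  - exact: continuous_measurable_borel.
  - by exists (K t); split; [exact: num_real|move=> M hM p _; exact: le_trans (ub t t0 p) (ltW hM)].
exists (fun t => fine (\int[cyl_volume B1 nu mx]_p (heatu F t p)%:E)%E); split; exists (heatu F).
  split; first exact: (heatu_solution _ _ _ (cyl_volume_lty dB1 mx nu_box) F0 C0 Fb dF).
  by move=> t t0; rewrite fineK // intfin.
split; first exact: (heatu_solution _ _ _ (cyl_volume_lty dB2 mx nu_box) F0 C0 Fb dF).
by move=> t t0; rewrite fineK ?intfin // int1.
Qed.

End HeatContent.

(** * The two lattices *)

Section LatticeMatrix.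
Context {R : realType} {n : nat} (w : 'I_n -> R) (w0 : forall i, 0 < w i).

Definition lattice_mx (T : 'M[int]_n) : 'M[R]_n := map_mx intr T *m diag_mx (\row_i w i).

Lemma lattice_mxE T i j : lattice_mx T i j = (T i j)%:~R * w j.
Proof. by rewrite /lattice_mx mul_mx_diag !mxE. Qed.

Lemma intv_lattice (T : 'M[int]_n) m : intv R m *m lattice_mx T = \row_i (((m *m T) 0 i)%:~R * w i).
Proof.
rewrite /lattice_mx mulmxA /intv -map_mxM /= mul_mx_diag.
by apply/rowP => i; rewrite !mxE.
Qed.

Variables (N : nat) (N0 : (0 < N)%N) (T U : 'M[int]_n) (TU : T *m U^T = N%:R%:M).

Let V : 'M[R]_n := \matrix_(i, j) ((U j i)%:~R / (N%:R * w i)).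

Let NR0 : N%:R != 0 :> R. Proof. by rewrite pnatr_eq0 -lt0n N0. Qed.

Let TV : lattice_mx T *m V = 1%:M.
Proof.
apply/matrixP => i j; rewrite !mxE.
transitivity (((T *m U^T) i j)%:~R / N%:R : R).
  rewrite mxE rmorph_sum /= mulr_suml; apply: eq_bigr => k _.
  rewrite lattice_mxE !mxE rmorphM /=; field.
  by rewrite NR0 gt_eqF ?w0.
rewrite TU !mxE; case: eqP => _; last by rewrite mulr0n mul0r.
by rewrite mulr1n rmorph_nat divff.
Qed.

Lemma lattice_mx_unit : lattice_mx T \in unitmx.
Proof. by have [] := mulmx1_unit TV. Qed.

(** The inverse matrix is read off from [T *m U^T], so [freq] lists the coordinates of a dual
    vector. Only their squares enter, so sign changes of coordinates are harmless for any
    weights. *)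
Lemma lattice_mx_energy m : energy (lattice_mx T) m =
  \sum_i (tau * (((m *m U) 0 i)%:~R / (N%:R * w i))) ^+ 2.
Proof.
have invE : invmx (lattice_mx T) = V by rewrite -[RHS](mulKmx lattice_mx_unit) TV mulmx1.
rewrite /energy big_ord_recr /= [X in _ + X](_ : _ = 0) ?addr0; last first.
  rewrite /freq /unitc (_ : hor _ = 0) ?mul0mx.
    by rewrite /dotz big1 ?mulr0 ?expr0n // => i _; rewrite mxE mulr0.
  by apply/rowP => i; rewrite !mxE /= eq_sym (negbTE (neq_lift _ _)).
apply: eq_bigr => i _; congr ((_ * _) ^+ 2).
rewrite /freq /unitc (_ : hor _ = delta_mx 0 i); last first.
  apply/rowP => j; rewrite !mxE /=; congr (_%:R); congr nat_of_bool.
  rewrite (_ : lift ord_max j = widen_ord (leqnSn n) j); last by apply/val_inj; rewrite [LHS]lift_max.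
  by rewrite -(inj_eq val_inj).
rewrite -rowE invE /dotz mxE rmorph_sum /= mulr_suml; apply: eq_bigr => k _.
by rewrite !mxE rmorphM /= mulrA.
Qed.

End LatticeMatrix.

Section Quaternary.
Implicit Types (a b c d : int) (m : 'rV[int]_4).

Definition rv4 a b c d : 'rV[int]_4 := \row_i nth 0 [:: a; b; c; d] i.

Lemma rv4_surj m : exists a b c d, m = rv4 a b c d.
Proof.
pose k (j : nat) : int := m 0 (inord j).
exists (k 0%N), (k 1%N), (k 2%N), (k 3%N); apply/rowP => i; rewrite mxE.
have -> : m 0 i = k i by rewrite /k inord_val.
by case: i => [[|[|[|[|//]]]] ?].
Qed.

Definition mx4 (s : seq (seq int)) : 'M[int]_4 := \matrix_(i, j) nth 0 (nth [::] s i) j.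

(* [Tplus] and [Tminus] are triangular bases of the lattices generated by the rows
   of H and of its transpose, where H = [[3,-1,-1,-1],[1,3,-1,1],[1,1,3,-1],[1,-1,1,3]]
   satisfies H H^T = 12.  The rows of [Uplus / 12] and [Uminus / 12] are the dual
   bases. *)
Definition Tplus := mx4 [:: [:: 12; 0; 0; 0]; [:: 6; 6; 0; 0]; [:: 2; 4; 2; 0]; [:: 9; 1; 1; 1]].
Definition Uplus := mx4 [:: [:: 1; -1; 1; -9]; [:: 0; 2; -4; 2]; [:: 0; 0; 6; -6]; [:: 0; 0; 0; 12]].
Definition Tminus := mx4 [:: [:: 12; 0; 0; 0]; [:: 6; 6; 0; 0]; [:: 2; 4; 2; 0]; [:: 3; 1; 1; 1]].
Definition Uminus := mx4 [:: [:: 1; -1; 1; -3]; [:: 0; 2; -4; 2]; [:: 0; 0; 6; -6]; [:: 0; 0; 0; 12]].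

Lemma Tplus_dual : Tplus *m Uplus^T = 12%:R%:M.
Proof.
apply/matrixP => i j; rewrite !mxE !big_ord_recl big_ord0 !mxE /=.
by case: i => [[|[|[|[|//]]]] ?]; case: j => [[|[|[|[|//]]]] ?].
Qed.

Lemma Tminus_dual : Tminus *m Uminus^T = 12%:R%:M.
Proof.
apply/matrixP => i j; rewrite !mxE !big_ord_recl big_ord0 !mxE /=.
by case: i => [[|[|[|[|//]]]] ?]; case: j => [[|[|[|[|//]]]] ?].
Qed.

Lemma rv4_mul a b c d s : rv4 a b c d *m mx4 s =
  let col j := a * nth 0 (nth [::] s 0) j + b * nth 0 (nth [::] s 1) j
    + c * nth 0 (nth [::] s 2) j + d * nth 0 (nth [::] s 3) j in
  rv4 (col 0%N) (col 1%N) (col 2%N) (col 3%N).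
Proof.
apply/rowP => i; rewrite !mxE !big_ord_recl big_ord0 !mxE /= addr0 !addrA.
by case: i => [[|[|[|[|//]]]] ?].
Qed.

(* [beta4 m] is the vector m' such that m' *m Uminus is obtained from m *m Uplus by
   changing the sign of its first coordinate divisible by 3. *)
Definition beta4 (q : int * int * int * int) : int * int * int * int :=
  let: (a, b, c, d) := q in
  if (3 %| a)%Z then (- a, b - a, c - (a %/ 3)%Z, d - a)
  else if (3 %| a + b)%Z then (a, a - b, c - 2 * b + 2 * ((a + b) %/ 3)%Z, d - ((a + b) %/ 3)%Z)
  else if (3 %| b)%Z then (a, b, c, a - (b %/ 3)%Z + c - d)
  else (a, b, - c + ((4 * b - a) %/ 3)%Z, d - c - 2 * ((a - b) %/ 3)%Z).

Definition beta4inv (q : int * int * int * int) : int * int * int * int :=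
  let: (a, b, c, d) := q in
  if (3 %| a)%Z then (- a, b - a, c - (a %/ 3)%Z, d - a)
  else if (3 %| a + b)%Z then
    (a, a - b, c - 2 * b + 2 * ((a + b) %/ 3)%Z, d + ((2 * a - b) %/ 3)%Z)
  else if (3 %| b)%Z then (a, b, c, a - (b %/ 3)%Z + c - d)
  else let c' := - c + ((4 * b - a) %/ 3)%Z in (a, b, c', d + c' + 2 * ((a - b) %/ 3)%Z).

(** Modulo 3 the coordinates of [m *m Uplus] are, up to sign, [a], [a + b], [a - b] and [b]; exactly
    one of them vanishes unless [a] and [b] both do. Hence the last branch has [a] congruent to [b],
    its quotients are exact, and the inverse enters the same branch. *)
Lemma beta4K : cancel beta4 beta4inv.
Proof.
move=> [[[a b] c] d]; rewrite /beta4 /beta4inv.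
case: ifPn => h1; [|case: ifPn => h2; [|case: ifPn => h3]].
- have -> : (3 %| - a)%Z by lia.
  congr (_, _, _, _); lia.
- rewrite (negbTE h1) (_ : (3 %| a + (a - b))%Z); last by lia.
  by congr (_, _, _, _); lia.
- by rewrite (negbTE h1) (negbTE h2) h3; congr (_, _, _, _); lia.
- rewrite (negbTE h1) (negbTE h2) (negbTE h3); congr (_, _, _, _); lia.
Qed.

Lemma beta4invK : cancel beta4inv beta4.
Proof.
move=> [[[a b] c] d]; rewrite /beta4 /beta4inv.
case: ifPn => h1; [|case: ifPn => h2; [|case: ifPn => h3]].
- have -> : (3 %| - a)%Z by lia.
  congr (_, _, _, _); lia.
- rewrite (negbTE h1) (_ : (3 %| a + (a - b))%Z); last by lia.
  by congr (_, _, _, _); lia.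
- by rewrite (negbTE h1) (negbTE h2) h3; congr (_, _, _, _); lia.
- rewrite /= (negbTE h1) (negbTE h2) (negbTE h3); congr (_, _, _, _); lia.
Qed.

Definition quad m : int * int * int * int :=
  (m 0 (inord 0), m 0 (inord 1), m 0 (inord 2), m 0 (inord 3)).

Definition unquad (q : int * int * int * int) : 'rV[int]_4 := let: (a, b, c, d) := q in rv4 a b c d.

Lemma quadK : cancel quad unquad.
Proof.
move=> m; apply/rowP => i; rewrite mxE -[i in RHS]inord_val.
by case: i => [[|[|[|[|//]]]] ?].
Qed.

Lemma unquadK : cancel unquad quad.
Proof. by move=> [[[a b] c] d]; rewrite /quad !mxE !inordK. Qed.

Definition betav m := unquad (beta4 (quad m)).

Lemma betav_bij : bijective betav.
Proof.
exists (fun m => unquad (beta4inv (quad m))) => m; rewrite /betav unquadK.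
  by rewrite beta4K quadK.
by rewrite beta4invK quadK.
Qed.

Lemma betav_energy m i : ((betav m *m Uminus) 0 i) ^+ 2 = ((m *m Uplus) 0 i) ^+ 2.
Proof.
have sq (x y : int) : x = y \/ x = - y -> x ^+ 2 = y ^+ 2 by case=> ->; rewrite ?sqrrN.
apply: sq; have -> : m *m Uplus = unquad (quad m) *m Uplus by rewrite quadK.
rewrite /betav; case: (quad m) => [[[a b] c] d] /=.
case: ifPn => h1; [|case: ifPn => h2; [|case: ifPn => h3]]; rewrite !rv4_mul !mxE /=;
  by case: i => [[|[|[|[|//]]]] ?] /=; lia.
Qed.

(** The inner product after scaling the axes by [13 ^ i]. It is integral, so comparing the two
    lattices becomes arithmetic. *)
Definition quad_form (x y : 'rV[int]_4) : int := \sum_i x 0 i * y 0 i * 169 ^+ i.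

Lemma quad_form4 a b c d a' b' c' d' : quad_form (rv4 a b c d) (rv4 a' b' c' d') =
  a * a' + 169 * (b * b' + 169 * (c * c' + 169 * (d * d'))).
Proof. by rewrite /quad_form !big_ord_recl big_ord0 !mxE /= /bump /= !exprS expr0; ring. Qed.

(* As 169 > 12 ^ 2, such an f must send 12 e_i to 12 e_i or - 12 e_i, for i = 0, 1, 2
   successively; but no choice of signs maps the first lattice into the second. *)
Lemma no_lattice_isometry (f : 'rV[int]_4 -> 'rV[int]_4) :
  ~ forall m m', quad_form (f m *m Tminus) (f m' *m Tminus) = quad_form (m *m Tplus) (m' *m Tplus).
Proof.
move=> H.
have sq (x : int) : x = 0 \/ 1 <= x * x by nia.
have nn (x : int) : 0 <= x * x by nia.
have sqr12 (x y : int) : x * x = y * y -> x = y \/ x = - y by nia.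
have im m : exists a b c d, f m *m Tminus = rv4 (12 * a + 6 * b + 2 * c + 3 * d) (6 * b + 4 * c + d) (2 * c + d) d.
  have [a [b [c [d ->]]]] := rv4_surj (f m); exists a, b, c, d.
  rewrite rv4_mul /=; congr rv4; lia.
pose e0 := rv4 1 0 0 0; pose e1 := rv4 (-1) 2 0 0; pose e2 := rv4 1 (-4) 6 0.
have E0 : e0 *m Tplus = rv4 12 0 0 0 by rewrite rv4_mul.
have E1 : e1 *m Tplus = rv4 0 12 0 0 by rewrite rv4_mul.
have E2 : e2 *m Tplus = rv4 0 0 12 0 by rewrite rv4_mul.
have E4 : rv4 0 0 1 0 *m Tplus = rv4 2 4 2 0 by rewrite rv4_mul.
have E5 : rv4 0 0 0 1 *m Tplus = rv4 9 1 1 1 by rewrite rv4_mul.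
have Q0 : exists s0 : int, (s0 = 1 \/ s0 = -1) /\ f e0 *m Tminus = rv4 (12 * s0) 0 0 0.
  have := H e0 e0; rewrite E0; have [x [y [z [d ->]]]] := rv4_surj (f e0 *m Tminus); rewrite !quad_form4.
  move=> h.
  have := (nn x, nn y, nn z, nn d) => -[[[n1 n2] n3] n4].
  have [hy|hy] := sq y; last by lia.
  have [hz|hz] := sq z; last by lia.
  have [hd|hd] := sq d; last by lia.
  subst y z d.
  have [hx|hx] : x = 12 \/ x = - 12 by apply: sqr12; lia.
    by exists 1; split; [left|rewrite hx].
  by exists (-1); split; [right|rewrite hx].
have [s0 [hs0 F0]] := Q0.
have Q1 : exists s1 : int, (s1 = 1 \/ s1 = -1) /\ f e1 *m Tminus = rv4 0 (12 * s1) 0 0.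
  have := H e1 e0; have := H e1 e1; rewrite E1 E0 F0.
  have [x [y [z [d ->]]]] := rv4_surj (f e1 *m Tminus); rewrite !quad_form4.
  move=> h h0.
  have hx : x = 0 by case: hs0 h0 => ->; lia.
  subst x; have := (nn y, nn z, nn d) => -[[n2 n3] n4].
  have [hz|hz] := sq z; last by lia.
  have [hd|hd] := sq d; last by lia.
  subst z d.
  have [hy|hy] : y = 12 \/ y = - 12 by apply: sqr12; lia.
    by exists 1; split; [left|rewrite hy].
  by exists (-1); split; [right|rewrite hy].
have [s1 [hs1 F1]] := Q1.
have Q2 : exists s2 : int, (s2 = 1 \/ s2 = -1) /\ f e2 *m Tminus = rv4 0 0 (12 * s2) 0.
  have := H e2 e0; have := H e2 e1; have := H e2 e2; rewrite E2 E1 E0 F0 F1.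
  have [x [y [z [d ->]]]] := rv4_surj (f e2 *m Tminus); rewrite !quad_form4.
  move=> h h1 h0.
  have hx : x = 0 by case: hs0 h0 => ->; lia.
  have hy : y = 0 by case: hs1 h1 => ->; lia.
  subst x y; have := (nn z, nn d) => -[n3 n4].
  have [hd|hd] := sq d; last by lia.
  subst d.
  have [hz|hz] : z = 12 \/ z = - 12 by apply: sqr12; lia.
    by exists 1; split; [left|rewrite hz].
  by exists (-1); split; [right|rewrite hz].
have [s2 [hs2 F2]] := Q2.
(* Inner products with the three axis vectors, whose images are known, fix the first three
   coordinates of the image; its length then fixes the last one up to sign. *)
have image A x y z t : A *m Tplus = rv4 x y z t -> exists a b c d, [/\ d * d = t * t,
    2 * c + d = s2 * z, 6 * b + 4 * c + d = s1 * y & 12 * a + 6 * b + 2 * c + 3 * d = s0 * x].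
  move=> EA; have := H A e0; have := H A e1; have := H A e2; have := H A A.
  rewrite EA E0 E1 E2 F0 F1 F2; have [a [b [c [d ->]]]] := im A.
  move eX : (12 * a + _ + _ + _) => X.
  move eY : (6 * b + _ + _) => Y.
  move eZ : (2 * c + _) => Z.
  rewrite !quad_form4 => h3 h2 h1 h0; exists a, b, c, d.
  have hZ : Z = s2 * z by case: hs2 h2 => ->; lia.
  have hY : Y = s1 * y by case: hs1 h1 => ->; lia.
  have hX : X = s0 * x by case: hs0 h0 => ->; lia.
  have sgn (r u : int) : (r = 1 \/ r = -1) -> (r * u) * (r * u) = u * u by case=> ->; lia.
  have dd : d * d = t * t by move: h3; rewrite hX hY hZ !sgn //; lia.
  by rewrite eX eY eZ.
(* The third basis vector forces [s0 = s1 = s2]. The fourth then forces [d'] to be the same sign,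
   [b' = c' = 0] and [12 * a' = 6 * s0], which has no integer solution. *)
have [a [b [c [d [d2 h2 h1 h0]]]]] := image _ _ _ _ _ E4.
have [a' [b' [c' [d' [d2' h2' h1' h0']]]]] := image _ _ _ _ _ E5.
have hd : d = 0 by case: (sq d) => //; rewrite d2; lia.
have hd' : d' = 1 \/ d' = - 1 by exact: sqr12.
clear - hs0 hs1 hs2 hd hd' h0 h1 h2 h0' h1' h2'; subst d.
by case: hs0 hs1 hs2 hd' h0 h1 h2 h0' h1' h2' => -> [] -> [] -> [] ->; lia.
Qed.

End Quaternary.

Section Pair.
Context {R : realType}.

(** The ratio 13 is an integer, which keeps the inner products integral, and it exceeds 12, the
    length of the vectors [12 e_i] before scaling. *)
Definition weight (i : 'I_4) : R := 13 ^+ i.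

Lemma weight_gt0 i : 0 < weight i. Proof. exact: exprn_gt0. Qed.

Local Notation Bplus := (lattice_mx weight Tplus).
Local Notation Bminus := (lattice_mx weight Tminus).

Lemma Bplus_unit : Bplus \in unitmx. Proof. exact: (lattice_mx_unit weight_gt0 _ Tplus_dual). Qed.

Lemma Bminus_unit : Bminus \in unitmx. Proof. exact: (lattice_mx_unit weight_gt0 _ Tminus_dual). Qed.

Lemma Bplus_trig (i j : 'I_4) : (i < j)%N -> Bplus i j = 0.
Proof.
move=> ij; rewrite lattice_mxE mxE; move: ij.
by case: i => [[|[|[|[|//]]]] ?]; case: j => [[|[|[|[|//]]]] ?] // _; rewrite mul0r.
Qed.

Lemma Bminus_trig (i j : 'I_4) : (i < j)%N -> Bminus i j = 0.
Proof.
move=> ij; rewrite lattice_mxE mxE; move: ij.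
by case: i => [[|[|[|[|//]]]] ?]; case: j => [[|[|[|[|//]]]] ?] // _; rewrite mul0r.
Qed.

Lemma Bplus_diag i : 0 < Bplus i i.
Proof.
rewrite lattice_mxE mulr_gt0 ?weight_gt0 // ltr0z mxE.
by case: i => [[|[|[|[|//]]]] ?].
Qed.

Lemma B_diag_eq i : Bplus i i = Bminus i i.
Proof. by rewrite !lattice_mxE !mxE; case: i => [[|[|[|[|//]]]] ?]. Qed.

Lemma Bminus_diag i : 0 < Bminus i i.
Proof. by rewrite -B_diag_eq Bplus_diag. Qed.

Lemma betav_energy_eq m : energy Bminus (betav m) = energy Bplus m.
Proof.
rewrite (lattice_mx_energy weight_gt0 _ Tplus_dual) // (lattice_mx_energy weight_gt0 _ Tminus_dual) //.
apply: eq_bigr => i _; rewrite !exprMn -!rmorphXn; congr (_ * (_ * _)).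
by rewrite betav_energy.
Qed.

Lemma dot_lattice (T1 T2 : 'M[int]_4) m1 m2 :
  dot (mkpt (intv R m1 *m lattice_mx weight T1) 0) (mkpt (intv R m2 *m lattice_mx weight T2) 0) =
  (quad_form (m1 *m T1) (m2 *m T2))%:~R.
Proof.
rewrite /dot big_ord_recr /= !mkpt_max mulr0 addr0 /quad_form rmorph_sum /=.
apply: eq_bigr => i _.
rewrite (_ : widen_ord _ i = lift ord_max i); last by apply/val_inj; rewrite [RHS]lift_max.
rewrite !mkpt_lift !intv_lattice !mxE !rmorphM rmorphXn /= /weight mulrACA -expr2 -exprM mulnC exprM.
by congr (_ * _ ^+ _); rewrite -natrX.
Qed.

Lemma not_isometric (u1 : Bplus \in unitmx) (u2 : Bminus \in unitmx) mu1 mu2 mu_box1 mu_box2 mu_boundary1 mu_boundary2 :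
  ~ isometric (@cylM R 4 Bplus u1 mu1 mu_box1 mu_boundary1)
              (@cylM R 4 Bminus u2 mu2 mu_box2 mu_boundary2).
Proof.
move=> [f [cf [g [cg fgK gfK]] f_orth]].
have [A [oA hA]] := isometry_lattice u1 u2 cf cg fgK gfK f_orth.
have [h hh] := choice hA.
apply: (@no_lattice_isometry h) => m m'.
apply: (@intr_inj R); rewrite -!dot_lattice -!hh.
exact: dot_orth.
Qed.

End Pair.

Theorem mainTheorem8 (R : realType) :
  exists (n : nat) (M N : flat_manifold R n),
    ([/\ compact [set: M], connected [set: M] & exists p : M, boundaryM p] /\
     [/\ compact [set: N], connected [set: N] & exists p : N, boundaryM p]) /\
    [/\ ~ isometric M N, dirichlet_isospectral M N & same_heat_content M N].
Proof.
(* One carrier of 5-dimensional Lebesgue measure, for four torus directions and the height, provides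
   the volumes of both manifolds. *)
have [d [T [nu [x [mx nu_box]]]]] := lebesgue_coords R 5.
have u1 := @Bplus_unit R; have u2 := @Bminus_unit R.
have t1 := @Bplus_trig R; have t2 := @Bminus_trig R.
have d1 := @Bplus_diag R; have d2 := @Bminus_diag R.
exists 4, (cylM u1 (cyl_volume_chart u1 t1 d1 mx nu_box) (cyl_volume_boundary u1 d1 mx nu_box)),
  (cylM u2 (cyl_volume_chart u2 t2 d2 mx nu_box) (cyl_volume_boundary u2 d2 mx nu_box)).
split.
  by split; (split; [exact: cyl_compact|exact: cyl_connected|exact: cylM_has_boundary]).
split.
- exact: not_isometric.
- exact: (cylM_isospectral _ _ _ _ _ _ betav_bij betav_energy_eq).
- exact: (cyl_same_heat_content _ _ _ _ _ _ B_diag_eq).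
Qed.
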